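(* Let $a\ge-\frac12$, $\bar a\ge-\frac12$, let $\xi_0:\mathbb R^d\to[a,+\infty]$ be lower semi-continuous and $\bar\xi_1:\mathbb R^d\to[-\infty,-\bar a]$ upper semi-continuous with $\mathscr P_1\xi_0\ge\bar\xi_1$, and set $\xi_t:=\mathscr P_t\xi_0$, $\bar\xi_t:=\mathscr R_{1-t}\bar\xi_1$, $\Xi_t:=\{\xi_t=\bar\xi_t\}$ for $t\in[0,1]$. Fix $s\in(0,1)$, $x\in\Xi_s$, $y\in\mathfrak D_s$, and define for $t\in(0,1)$ $$\boldsymbol T(t):=\boldsymbol T_{s\to t}(x),\quad q(t):=q_{s\to t}(x),\quad \boldsymbol Y(t):=\boldsymbol T_{s\to t}(y),\quad \mathsf B(t):=\mathrm D\boldsymbol T_{s\to t}(y),\quad\delta(t):=\det\mathsf B(t).$$ Then $\boldsymbol T(s)=x$, $q(s)=1$, $\mathsf B(s)=\mathbb I$, $\delta(s)=1$, and for all $t\in(0,1)$: $$\dot{\boldsymbol T}(t)=\nabla\xi_t(\boldsymbol T(t)),\qquad \ddot{\boldsymbol T}(t)=-4\,\xi_t(\boldsymbol T(t))\,\nabla\xi_t(\boldsymbol T(t)),$$ $$\dot q(t)=2\xi_t(\boldsymbol T(t))\,q(t),\qquad \ddot q(t)=|\nabla\xi_t(\boldsymbol T(t))|^2\,q(t),$$ $$\dot{\mathsf B}(t)=\mathrm D^2\xi_t(\boldsymbol Y(t))\,\mathsf B(t),\qquad \ddot{\mathsf B}(t)=-4\big(\nabla\xi_t\otimes\nabla\xi_t+\xi_t\,\mathrm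 D^2\xi_t\big)(\boldsymbol Y(t))\,\mathsf B(t),$$ $$\dot\delta(t)=\Delta\xi_t(\boldsymbol Y(t))\,\delta(t),\qquad \frac{\ddot\delta(t)}{\delta(t)}=\Big((\Delta\xi_t)^2-|\mathrm D^2\xi_t|^2-4|\nabla\xi_t|^2-4\xi_t\Delta\xi_t\Big)(\boldsymbol Y(t)),$$ where $\Delta\xi_t=\mathrm{tr}(\mathrm D^2\xi_t)$ and $|\mathrm D^2\xi_t|^2$ is the sum of the squares of the entries of $\mathrm D^2\xi_t$.
   Context: Generalized Hopf--Lax operators: for $t\in(0,1]$, $$(\mathscr P_t\xi)(x)=\inf_{|y-x|<\pi/2}\frac1{2t}\Big(1-\frac{\cos^2(|x-y|)}{1+2t\xi(y)}\Big),\qquad \mathscr R_t\bar\xi:=-\mathscr P_t(-\bar\xi),$$ with the conventions $c/0=+\infty$, $c/(+\infty)=0$ for $c>0$; $\mathscr P_0,\mathscr R_0$ are the identity. For $t\in(0,1)$ the functions $\xi_t$ and $\bar\xi_t$ are differentiable at every $x\in\Xi_t$ with common gradient $\nabla\xi_t(x)$, and $\nabla\xi_t$ is Lipschitz on the closed set $\Xi_t$. For $s,t\in(0,1)$, $x\in\Xi_s$, $\tau=t-s$ (one has $1+2\tau\xi_s(x)>0$), $$\boldsymbol T_{s\to t}(x)=x+\boldsymbol{\arctan}\Big(\frac{\tau\nabla\xi_s(x)}{1+2\tau\xi_s(x)}\Big),\qquad q_{s\to t}(x)=\big((1+2\tau\xi_s(x))^2+\tau^2|\nabla\xi_s(x)|^2\big)^{1/2},$$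 with $\boldsymbol{\arctan}(w)=\arctan(|w|)\frac w{|w|}$, $\boldsymbol{\arctan}(0)=0$. A map $G:\Xi_s\to\mathbb R^d$ is differentiable at a Lebesgue density point $x\in\Xi_s$ of $\Xi_s$ with differential $\mathrm DG(x)=\mathsf A$ if $|G(y)-G(x)-\mathsf A(y-x)|=o(|y-x|)$ as $y\to x$, $y\in\Xi_s$. $\mathfrak D_s$ is the set of density points of $\Xi_s$ that belong to $\Xi_s$ and at which $\nabla\xi_s:\Xi_s\to\mathbb R^d$ is differentiable in this sense, and $\mathrm D^2\xi_s(x)$ denotes that differential. For $s,t\in(0,1)$, $\boldsymbol T_{s\to t}$ is differentiable in this sense at every point of $\mathfrak D_s$ and $\boldsymbol T_{s\to t}(\mathfrak D_s)=\mathfrak D_t$. *)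

(* Defs.v *)
From HB Require Import structures.
From mathcomp Require Import all_boot all_order all_algebra.
From mathcomp Require Import all_classical all_reals all_analysis.

Set Implicit Arguments.
Unset Strict Implicit.
Unset Printing Implicit Defensive.

Import Order.TTheory GRing.Theory Num.Theory.
Import numFieldNormedType.Exports.

Local Open Scope classical_set_scope.
Local Open Scope ring_scope.

(* Points of R^d are column vectors 'cV[R]_d.  The library norm `|v| on
   matrices is the sup norm (it induces the same topology), so the Euclidean
   norm is defined separately. *)
Definition enorm (R : realType) (d : nat) (v : 'cV[R]_d) : R :=
  Num.sqrt (\sum_(i < d) v i 0 ^+ 2).

Definition upper_semicontinuous (R : realType) (X : topologicalType)
    (f : X -> \bar R) : Prop :=
  forall x a, (f x < a%:E)%E ->
    exists2 V, nbhs x V & forall y, V y -> (f y < a%:E)%E.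

(* Library conventions used below: in \bar R, 0^-1 = +oo and +oo^-1 = 0.  On
   the range |y - x| < pi / 2 the numerator cos^2 is positive, and
   1 + 2 t xi y >= 0 as soon as xi >= - 1/2 and t <= 1. *)
Definition hopf_laxP (R : realType) (d : nat) (t : R)
    (xi : 'cV[R]_d -> \bar R) (x : 'cV[R]_d) : \bar R :=
  if t == 0 then xi x else
  ereal_inf [set ((2 * t)^-1%:E *
      (1 - (cos (enorm (x - y)) ^+ 2)%:E / (1 + (2 * t)%:E * xi y)))%E
    | y in [set y | enorm (y - x) < pi / 2]].

Definition hopf_laxR (R : realType) (d : nat) (t : R)
    (xibar : 'cV[R]_d -> \bar R) (x : 'cV[R]_d) : \bar R :=
  (- hopf_laxP t (fun y => - xibar y) x)%E.

(* Gradient read off the Frechet differential. *)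
Definition grad (R : realType) (d : nat) (f : 'cV[R]_d -> R) (x : 'cV[R]_d) :
    'cV[R]_d :=
  \col_i 'd f x (delta_mx i 0).

(* For w = 0 the scalar is atan 0 / 0 = 0, whence arctanv 0 = 0. *)
Definition arctanv (R : realType) (d : nat) (w : 'cV[R]_d) : 'cV[R]_d :=
  (atan (enorm w) / enorm w) *: w.

(* With f = xi_s and tau = t - s these are T_{s -> t} and q_{s -> t}. *)
Definition transport (R : realType) (d : nat) (f : 'cV[R]_d -> R) (tau : R)
    (x : 'cV[R]_d) : 'cV[R]_d :=
  x + arctanv ((tau / (1 + 2 * tau * f x)) *: grad f x).

Definition dilation (R : realType) (d : nat) (f : 'cV[R]_d -> R) (tau : R)
    (x : 'cV[R]_d) : R :=
  Num.sqrt ((1 + 2 * tau * f x) ^+ 2 + tau ^+ 2 * enorm (grad f x) ^+ 2).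

(* d-dimensional Lebesgue measure: the library provides it on R only, so it is
   the iterated product measure on d-tuples, transported to column vectors. *)
Fixpoint lebesgue_tuple (R : realType) (n : nat) :
    set (n.-tuple (measurableTypeR R)) -> \bar R :=
  match n return set (n.-tuple (measurableTypeR R)) -> \bar R with
  | 0%N => dirac [tuple]
  | m.+1 => pushforward (@lebesgue_measure R \x @lebesgue_tuple R m)%E
              (fun p => [tuple of p.1 :: p.2])
  end.

Definition lebesgue_cV (R : realType) (d : nat) (A : set 'cV[R]_d) : \bar R :=
  @lebesgue_tuple R d [set u | A (\col_i tnth u i)].

Definition density_point (R : realType) (d : nat) (X : set 'cV[R]_d)
    (x : 'cV[R]_d) : Prop :=
  let B (r : R) := [set y | enorm (y - x) < r] in
  (lebesgue_cV (X `&` B r) / lebesgue_cV (B r))%E @[r --> 0^'+] --> 1%E.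

(* G has differential A at x relative to X.  At a density point x of X there is
   at most one such A, so diff_on X G x is then the differential of G at x;
   it is the zero matrix where no differential exists. *)
Definition has_diff_on (R : realType) (d : nat) (X : set 'cV[R]_d)
    (G : 'cV[R]_d -> 'cV[R]_d) (x : 'cV[R]_d) (A : 'M[R]_d) : Prop :=
  forall e : R, 0 < e -> \forall y \near within X (nbhs x),
    enorm (G y - G x - A *m (y - x)) <= e * enorm (y - x).

Definition diff_on (R : realType) (d : nat) (X : set 'cV[R]_d)
    (G : 'cV[R]_d -> 'cV[R]_d) (x : 'cV[R]_d) : 'M[R]_d :=
  xget 0 [set A | has_diff_on X G x A].

Definition diff_points (R : realType) (d : nat) (X : set 'cV[R]_d)
    (G : 'cV[R]_d -> 'cV[R]_d) : set 'cV[R]_d :=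
  [set x | [/\ X x, density_point X x & exists A, has_diff_on X G x A]].

(* Main.v *)
Require Import Defs.
From HB Require Import structures.
From mathcomp Require Import all_boot all_order all_algebra.
From mathcomp Require Import all_classical all_reals all_analysis.
From mathcomp Require Import perm ring lra.

Set Implicit Arguments.
Unset Strict Implicit.
Unset Printing Implicit Defensive.

Import Order.TTheory GRing.Theory Num.Theory.
Import numFieldNormedType.Exports.

Local Open Scope classical_set_scope.
Local Open Scope ring_scope.

(** The value [xi t x] is the value at radius one of a Hamilton--Jacobi solution
    on the cone over R^d, and [cos^2] comes from the cone distance.  At a contact
    point the infimum and the supremum that define the two functions are attained
    ([hl_attained]), at points joined by a geodesic of the cone through the
    contact point; the transport follows the projection of that geodesic and the
    dilation is its radius.  In the flat coordinates of the plane sector carrying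
    the geodesic everything is rational in the time lapse [tau]: with [u] and [p]
    the value and the gradient at time [s], the squared dilation is
    [(1 + 2 tau u)^2 + tau^2 |p|^2], the velocity of the transport is [p] divided
    by it, and the equations for the transport and the dilation follow by
    differentiating explicit functions.

    The work is to show that value and gradient at later times are the ones
    predicted by these formulas.  The kernel [cos^2] is convex in the squared
    radius ([cos2_semiconvex]), so the infimum is semiconcave with explicit
    constants ([hl_semiconcave]).  Since the lower function stays below the upper
    one ([hl_order]), at a contact point both have the same gradient and a
    two-sided quadratic bound ([contact_touches]).  An optimal point for time [s]
    gives an upper bound at the transported point at time [t], the optimal point
    of the other function gives the same lower bound, and the two functions are
    squeezed together there ([contact_flow]).

    For the equations involving second differentials, density points matter only
    through the property [fills]: at small scales the set is relatively close to
    every point ([density_fills]).  It makes relative differentials unique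
    ([diff_onE]) and, because of the quadratic bounds, makes the relative Hessian
    symmetric ([fills_hessian_sym]).  It is carried along by the transport, whose
    differential [flow_diff] is computed by the chain rule ([flow_map_has_diff])
    and is invertible since backward transport is Lipschitz
    ([transport_diff_unitmx]).  As the gradient at the transported point is the
    velocity, the Hessian there is the differential of the velocity times the
    inverse of [flow_diff] ([hessian_has_diff]); but the differential of the
    velocity is also the time derivative of [flow_diff], which is the first
    equation for [B], and one more time derivative gives the second.  Jacobi's
    formula then yields the equations for the determinant ([is_derive_det],
    [is_derive2_det]), where the symmetry of the Hessian [N] turns [tr (N N)] into
    the sum of the squares of its entries. *)

(** * Euclidean structure on column vectors *)

Section Euclid.
Context {R : realType} {d : nat}.
Implicit Types (u v w x y : 'cV[R]_d) (c r : R).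

Definition dot u v : R := \sum_(i < d) u i 0 * v i 0.

Lemma dotC u v : dot u v = dot v u.
Proof. by apply: eq_bigr => i _; rewrite mulrC. Qed.

Lemma dotDl u v w : dot (u + v) w = dot u w + dot v w.
Proof. by rewrite -big_split; apply: eq_bigr => i _; rewrite !mxE mulrDl. Qed.

Lemma dotZl c u v : dot (c *: u) v = c * dot u v.
Proof. by rewrite mulr_sumr; apply: eq_bigr => i _; rewrite !mxE mulrA. Qed.

Lemma dotNl u v : dot (- u) v = - dot u v.
Proof. by rewrite -scaleN1r dotZl mulN1r. Qed.

Lemma dotBl u v w : dot (u - v) w = dot u w - dot v w.
Proof. by rewrite dotDl dotNl. Qed.

Lemma dotDr u v w : dot w (u + v) = dot w u + dot w v.
Proof. by rewrite !(dotC w) dotDl. Qed.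

Lemma dotZr c u v : dot u (c *: v) = c * dot u v.
Proof. by rewrite !(dotC u) dotZl. Qed.

Lemma dotNr u v : dot u (- v) = - dot u v.
Proof. by rewrite !(dotC u) dotNl. Qed.

Lemma dotBr u v w : dot w (u - v) = dot w u - dot w v.
Proof. by rewrite dotDr dotNr. Qed.

Lemma dot0l u : dot 0 u = 0.
Proof. by rewrite -(scale0r 0) dotZl mul0r. Qed.

Lemma dot0r u : dot u 0 = 0.
Proof. by rewrite dotC dot0l. Qed.

Lemma dot_ge0 u : 0 <= dot u u.
Proof. by apply: sumr_ge0 => i _; rewrite -expr2 sqr_ge0. Qed.

Lemma dot_eq0 u : dot u u = 0 -> u = 0.
Proof.
move=> /eqP; rewrite psumr_eq0 => [|i _]; last by rewrite -expr2 sqr_ge0.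
move=> /allP h; apply/colP => i; rewrite mxE.
by have := h i (mem_index_enum i); rewrite mulf_eq0 orbb => /eqP.
Qed.

Lemma enormE v : enorm v = Num.sqrt (dot v v).
Proof. by congr Num.sqrt; apply: eq_bigr => i _; rewrite expr2. Qed.

Lemma enorm_ge0 v : 0 <= enorm v.
Proof. by rewrite enormE sqrtr_ge0. Qed.

Lemma sqr_enorm v : enorm v ^+ 2 = dot v v.
Proof. by rewrite enormE sqr_sqrtr// dot_ge0. Qed.

Lemma enorm0 : enorm (0 : 'cV[R]_d) = 0.
Proof. by rewrite enormE dot0l sqrtr0. Qed.

Lemma enorm_eq0 v : enorm v = 0 -> v = 0.
Proof. by move=> h; apply: dot_eq0; rewrite -sqr_enorm h expr0n. Qed.

Lemma enorm_gt0 v : v != 0 -> 0 < enorm v.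
Proof.
move=> v0; rewrite lt_neqAle enorm_ge0 andbT eq_sym.
by apply: contra_neq v0; exact: enorm_eq0.
Qed.

Lemma enormZ c v : enorm (c *: v) = `|c| * enorm v.
Proof.
by rewrite !enormE dotZl dotZr mulrA -expr2 sqrtrM ?sqr_ge0// sqrtr_sqr.
Qed.

Lemma enormN v : enorm (- v) = enorm v.
Proof. by rewrite -scaleN1r enormZ normrN1 mul1r. Qed.

Lemma enormBC u v : enorm (u - v) = enorm (v - u).
Proof. by rewrite -enormN opprB. Qed.

Lemma dot_le_enorm u v : dot u v <= enorm u * enorm v.
Proof.
have [->|u0] := eqVneq u 0; first by rewrite dot0l enorm0 mul0r.
have [->|v0] := eqVneq v 0; first by rewrite dot0r enorm0 mulr0.
have a0 := enorm_gt0 u0; have b0 := enorm_gt0 v0.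
have := dot_ge0 (enorm v *: u - enorm u *: v).
rewrite !(dotBl, dotBr, dotZl, dotZr) -!sqr_enorm (dotC v u) => h.
have ab0 : 0 < enorm u * enorm v by rewrite mulr_gt0.
rewrite -(ler_pM2l ab0); nra.
Qed.

Lemma normr_dot_le u v : `|dot u v| <= enorm u * enorm v.
Proof.
rewrite ler_norml dot_le_enorm andbT lerNl -dotNl.
by rewrite -(enormN u) dot_le_enorm.
Qed.

Lemma ler_enormD u v : enorm (u + v) <= enorm u + enorm v.
Proof.
rewrite -ler_sqr ?nnegrE ?addr_ge0 ?enorm_ge0//.
rewrite sqr_enorm sqrrD !sqr_enorm !(dotDl, dotDr) (dotC v u).
have := dot_le_enorm u v; lra.
Qed.

Lemma ler_enormB u v : enorm (u - v) <= enorm u + enorm v.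
Proof. by rewrite -(enormN v) ler_enormD. Qed.

Lemma ler_distD u v w : enorm (u - w) <= enorm (u - v) + enorm (v - w).
Proof. by rewrite -[u - w](subrKA v); exact: ler_enormD. Qed.

Lemma ler_dist_enorm u v : `|enorm u - enorm v| <= enorm (u - v).
Proof.
have h1 := ler_enormD (u - v) v; have h2 := ler_enormD (v - u) u.
move: h1 h2; rewrite !subrK (enormBC v u) ler_norml => h1 h2; lra.
Qed.

Lemma coord_le_enorm v i : `|v i 0| <= enorm v.
Proof.
rewrite -ler_sqr ?nnegrE ?enorm_ge0// sqr_enorm real_normK ?num_real//.
rewrite /dot (bigD1 i)//= -expr2 lerDl; apply: sumr_ge0 => j _.
by rewrite -expr2 sqr_ge0.
Qed.

Lemma enorm_le_sum v : enorm v <= \sum_i `|v i 0|.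
Proof.
rewrite -ler_sqr ?nnegrE ?enorm_ge0// ?sumr_ge0// sqr_enorm.
rewrite expr2 mulr_suml; apply: ler_sum => i _.
rewrite (le_trans (ler_norm _))// normrM ler_wpM2l//.
by rewrite (bigD1 i)//= lerDl sumr_ge0.
Qed.

Lemma norm_le_enorm v : `|v| <= enorm v.
Proof.
rewrite {1}/Num.Def.normr/= mx_normrE (bigmax_le _ (enorm_ge0 v))//= => -[i j] _.
by rewrite ord1 coord_le_enorm.
Qed.

Lemma enorm_le_norm v : enorm v <= d%:R * `|v|.
Proof.
apply: le_trans (enorm_le_sum v) _.
rewrite mulr_natl -[X in _ *+ X]card_ord -sumr_const; apply: ler_sum => i _.
rewrite [leRHS]/Num.Def.normr/= mx_normrE.
exact: (le_bigmax _ (fun ij : 'I_d * 'I_1 => `|v ij.1 ij.2|) (i, 0)).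
Qed.

(** The sup norm carried by matrices and the Euclidean norm are equivalent, so
    neighbourhoods may be tested on Euclidean balls. *)
Lemma nbhs_enormP x (P : set 'cV[R]_d) :
  nbhs x P <-> exists2 r, 0 < r & forall y, enorm (y - x) < r -> P y.
Proof.
split=> [/(nbhs_normP x P).1[r /= r0 h]|[r r0 h]].
  exists r => // y yr; apply: h => /=; rewrite distrC.
  exact: le_lt_trans (norm_le_enorm _) yr.
have D0 : 0 < d%:R + 1 :> R by rewrite ltr_wpDl.
apply/(nbhs_normP x P); exists (r / (d%:R + 1)); first by rewrite /= divr_gt0.
move=> y /=; rewrite distrC => yr; apply: h.
apply: le_lt_trans (enorm_le_norm _) _.
apply: (@le_lt_trans _ _ ((d%:R + 1) * `|y - x|)).
  by rewrite ler_wpM2r// lerDl.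
by rewrite mulrC -ltr_pdivlMr.
Qed.

End Euclid.

#[global] Hint Extern 0 (is_true (0 <= enorm _)) =>
  solve [apply: enorm_ge0] : core.

Lemma enorm_mulmx_le {R : realType} {d : nat} (A : 'M[R]_d) (v : 'cV[R]_d) :
  enorm (A *m v) <= (\sum_i \sum_j `|A i j|) * enorm v.
Proof.
apply: le_trans (enorm_le_sum _) _; rewrite mulr_suml; apply: ler_sum => i _.
rewrite mxE; apply: le_trans (ler_norm_sum _ _ _) _.
rewrite mulr_suml; apply: ler_sum => j _.
by rewrite normrM ler_wpM2l// coord_le_enorm.
Qed.

Lemma dot_mx {R : realType} {d : nat} (u v : 'cV[R]_d) :
  u^T *m v = (dot u v)%:M.
Proof.
apply/matrixP => i j; rewrite !ord1 !mxE eqxx mulr1n.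
by apply: eq_bigr => k _; rewrite mxE.
Qed.

(** * Lebesgue measure of boxes and density points *)

Section lower_integral.
Context d (T : measurableType d) (R : realType).
Variable mu : {measure set T -> \bar R}.
Local Open Scope ereal_scope.
Import HBNNSimple.

(** The integral of a nonnegative function is a supremum over the simple
    functions below it; monotonicity and superadditivity can be read off this
    supremum for arbitrary functions, such as the measures of the sections of an
    arbitrary set. *)
Lemma le_integral_nonneg (f g : T -> \bar R) :
  (forall x, 0 <= f x) -> (forall x, f x <= g x) ->
  \int[mu]_x f x <= \int[mu]_x g x.
Proof.
move=> f0 fg; have g0 x : 0 <= g x := le_trans (f0 x) (fg x).
rewrite !ge0_integralTE//; apply: le_ereal_sup => _ [h hf <-].
by exists h => // x; exact: le_trans (hf x) (fg x).
Qed.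

Lemma integral_superadditive (f g : T -> \bar R) :
  (forall x, 0 <= f x) -> (forall x, 0 <= g x) ->
  \int[mu]_x f x + \int[mu]_x g x <= \int[mu]_x (f x + g x).
Proof.
move=> f0 g0; have fg0 x : 0 <= f x + g x by rewrite adde_ge0.
have [->|finfg] := eqVneq (\int[mu]_x (f x + g x)) +oo; first by rewrite leey.
have I0 : 0 <= \int[mu]_x (f x + g x) by apply: integral_ge0.
have finI : \int[mu]_x (f x + g x) \is a fin_num.
  by rewrite ge0_fin_numE// lt_neqAle finfg leey.
have fin_sub h : (forall x, 0 <= h x) -> (forall x, h x <= f x + g x) ->
    \int[mu]_x h x \is a fin_num.
  move=> h0 hfg; have := le_integral_nonneg h0 hfg => le.
  rewrite ge0_fin_numE; last by apply: integral_ge0.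
  by apply: le_lt_trans le _; rewrite -ge0_fin_numE.
have finf : \int[mu]_x f x \is a fin_num by apply: fin_sub => // x; rewrite leeDl.
rewrite -leeBrDl//.
rewrite [in leLHS]ge0_integralTE//; apply: ge_ereal_sup => _ [k kg <-].
have fink : sintegral mu k \is a fin_num.
  rewrite -integralT_nnsfun; apply: fin_sub => x; first by rewrite lee_fin.
  by apply: le_trans (kg x) _; rewrite leeDr.
rewrite leeBrDl// -leeBrDr//.
rewrite [in leLHS]ge0_integralTE//; apply: ge_ereal_sup => _ [h hf <-].
rewrite leeBrDr// -sintegralD// -(integralT_nnsfun _ (h \+ k)%R).
apply: le_integral_nonneg => x; first by rewrite lee_fin addr_ge0.
by rewrite /= EFinD leeD.
Qed.

End lower_integral.

Section lebesgue_tuple_theory.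
Context {R : realType}.
Local Open Scope ereal_scope.
Local Notation lam n := (@lebesgue_tuple R n).

Let cut n (A : set (n.+1.-tuple (measurableTypeR R))) (x : R) :
    set (n.-tuple (measurableTypeR R)) :=
  [set u : n.-tuple _ | A [tuple of (x : measurableTypeR R) :: u]].

Let lamS n A : lam n.+1 A = \int[@lebesgue_measure R]_x lam n (cut A x).
Proof.
rewrite /= /pushforward /product_measure1; apply: eq_integral => x _ /=.
congr (lam n _); apply/seteqP; split => u; rewrite /xsection /= inE//.
Qed.

Lemma lebesgue_tuple_ge0 n A : 0 <= lam n A.
Proof.
elim: n A => [|n IH] A; first exact: measure_ge0.
by rewrite lamS; apply: integral_ge0 => x _; exact: IH.
Qed.

Lemma le_lebesgue_tuple n A B : A `<=` B -> lam n A <= lam n B.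
Proof.
elim: n A B => [|n IH] A B AB /=.
  rewrite !diracE lee_fin ler_nat.
  by have [/set_mem/AB/mem_set->|] := boolP ([tuple] \in A).
rewrite -/(lam n.+1 A) -/(lam n.+1 B) !lamS.
apply: le_integral_nonneg => x; first exact: lebesgue_tuple_ge0.
by apply: IH => u; exact: AB.
Qed.

Lemma lebesgue_tuple_superadditive n A B : A `&` B = set0 ->
  lam n A + lam n B <= lam n (A `|` B).
Proof.
elim: n A B => [|n IH] A B AB /=.
  rewrite !diracE -EFinD lee_fin -natrD ler_nat in_setU.
  have [Ax|_] := boolP ([tuple] \in A); have [Bx|_] := boolP ([tuple] \in B) => //.
  have : (A `&` B) [tuple] by split; exact: set_mem.
  by rewrite AB.
rewrite -/(lam n.+1 A) -/(lam n.+1 B) -/(lam n.+1 (A `|` B)) !lamS.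
apply: le_trans (integral_superadditive _ _ _) _;
  [by move=> x; exact: lebesgue_tuple_ge0|by move=> x; exact: lebesgue_tuple_ge0|].
apply: le_integral_nonneg => x; first by rewrite adde_ge0// lebesgue_tuple_ge0.
apply: le_trans (IH _ _ _) _ => //.
apply/seteqP; split => // u [Au Bu].
suff : (A `&` B) [tuple of (x : measurableTypeR R) :: u] by rewrite AB.
by split; [exact: Au|exact: Bu].
Qed.

Lemma lebesgue_tuple0 n : lam n set0 = 0.
Proof.
elim: n => [|n IH] /=; first by rewrite diracE memNset.
rewrite -/(lam n.+1 _) lamS (eq_integral (cst 0)) ?integral0//.
Qed.

Lemma lebesgue_tuple_box n (a b : 'I_n -> R) : (forall i, (a i <= b i)%R) ->
  lam n [set u | forall i, (a i < tnth u i < b i)%R] =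
  (\prod_(i < n) (b i - a i)%R)%:E.
Proof.
elim: n a b => [|n IH] a b ab /=.
  by rewrite diracE big_ord0 mem_set// => -[].
rewrite -/(lam n.+1 _) lamS big_ord_recl.
set P := (\prod_(i < n) _)%R.
have -> : \int[@lebesgue_measure R]_x lam n
      (cut [set u | forall i, (a i < tnth u i < b i)%R] x) =
    \int[@lebesgue_measure R]_x ((cst P%:E) \_ `]a ord0, b ord0[%classic) x.
  apply: eq_integral.
  move=> x _; rewrite patchE; case: ifPn => [|] xab.
    rewrite /= -(IH (fun i => a (lift ord0 i)) (fun i => b (lift ord0 i)))//.
    congr (lam n _); apply/seteqP; split => u /= h i.
      by have := h (lift ord0 i); rewrite tnthS.
    have [->|[j ->]] : i = ord0 \/ exists j, i = lift ord0 j.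
      by case: (unliftP ord0 i) => [j ->|->]; [right; exists j|left].
      by move: xab; rewrite tnth0 inE /= in_itv.
    by rewrite tnthS; exact: h.
  have -> : cut [set u | forall i, (a i < tnth u i < b i)%R] x = set0.
    apply/seteqP; split => // u /= /(_ ord0); rewrite tnth0 => h.
    by move: xab; rewrite notin_setE /= in_itv /= h.
  exact: lebesgue_tuple0.
rewrite -integral_mkcond integral_cst//= lebesgue_measure_itv /=.
rewrite lte_fin; case: ltP => ab0; first by rewrite -EFinD -EFinM mulrC.
by rewrite mule0 (_ : b ord0 = a ord0) ?subrr ?mul0r//; apply/eqP; rewrite eq_le ab0 ab.
Qed.
End lebesgue_tuple_theory.

Section density.
Context {R : realType} {d : nat}.
Implicit Types (X : set 'cV[R]_d) (x y h : 'cV[R]_d).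

(** At small scales the set comes relatively close to every point.  Unlike
    Lebesgue density, which implies it, this property is easily transported by
    maps with an invertible relative differential. *)
Definition fills X x := forall e : R, 0 < e ->
  exists2 rho, 0 < rho & forall h, enorm h < rho ->
    exists2 z, X z & enorm (z - (x + h)) <= e * enorm h.

Let cube y (c : R) : set 'cV[R]_d := [set z | forall i, `|z i 0 - y i 0| < c].

Let lebesgue_cube y c : 0 <= c -> lebesgue_cV (cube y c) = ((c *+ 2) ^+ d)%:E.
Proof.
move=> c0; rewrite /lebesgue_cV.
have -> : [set u : d.-tuple (measurableTypeR R) | cube y c (\col_i tnth u i)] =
    [set u | forall i, y i 0 - c < tnth u i < y i 0 + c].
  by apply/seteqP; split => u /= h i; have := h i; rewrite mxE ltr_distl.
rewrite lebesgue_tuple_box => [|i]; last by rewrite lerD2l ge0_cp.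
congr EFin; rewrite -[d in RHS]card_ord -prodr_const; apply: eq_bigr => i _.
by rewrite opprD addrACA subrr add0r opprK mulr2n.
Qed.

Let le_lebesgue_cV (A B : set 'cV[R]_d) : A `<=` B ->
  (lebesgue_cV A <= lebesgue_cV B)%E.
Proof. by move=> AB; apply: le_lebesgue_tuple => u; exact: AB. Qed.

Lemma enorm_lt_cube y (c r : R) z : 0 < c -> d%:R * c < r -> cube y c z ->
  enorm (z - y) < r.
Proof.
move=> c0 cr zc; apply: le_lt_trans cr; apply: le_trans (enorm_le_sum _) _.
rewrite mulr_natl -[X in _ *+ X]card_ord -sumr_const; apply: ler_sum => i _.
by rewrite !mxE ltW.
Qed.

(** If the set missed a ball of radius comparable to the distance from the
    density point, it would miss a fixed fraction of the measure of a
    concentric ball. *)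
Lemma density_fills X x : X x -> density_point X x -> fills X x.
Proof.
move=> Xx dens e0 e0_gt0.
pose e := Num.min e0 2^-1.
have e_gt0 : 0 < e by rewrite lt_min e0_gt0 invr_gt0 ltr0n.
have e_le : e <= 2^-1 by rewrite ge_min lexx orbT.
have ee0 : e <= e0 by rewrite ge_min lexx.
pose D : R := d%:R + 1.
have D0 : 0 < D by rewrite ltr_wpDl.
pose kap := (e / (2 * D)) ^+ d.
have kap0 : 0 < kap by rewrite exprn_gt0// divr_gt0// mulr_gt0.
have : nbhs 1%E [set z : \bar R | ((1 - kap)%:E < z)%E].
  apply: open_nbhs_nbhs; split; first exact: open_ereal_gt_ereal.
  by rewrite /= lte_fin ltrBlDr ltrDl.
move=> /dens /nbhs_ballP[rho /= rho0 near_rho].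
exists (rho / 2); first by rewrite divr_gt0 ?ltr0n.
move=> h hrho; have [->|h0] := eqVneq h 0.
  by exists x => //; rewrite addr0 subrr enorm0 mulr0.
have k0 := enorm_gt0 h0; set k := enorm h in hrho k0 *.
apply: contrapT => noz.
have k2 : 0 < k *+ 2 by rewrite pmulrn_lgt0.
have k2rho : `|0 - k *+ 2| < rho.
  by rewrite sub0r normrN gtr0_norm// -mulr_natr -ltr_pdivlMr.
have {near_rho} := near_rho _ k2rho k2.
rewrite /=; set B := [set y | _]; apply/negP; rewrite -leNgt.
pose c := e * k / D.
have c0 : 0 < c by rewrite divr_gt0// mulr_gt0.
have dc : d%:R * c < e * k.
  by rewrite /c mulrCA -[ltRHS]mulr1 ltr_pM2l ?mulr_gt0// ltr_pdivrMr// mul1r ltrDl.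
have QB : cube (x + h) c `<=` B.
  move=> z /(enorm_lt_cube c0 dc) zc; rewrite /B /=.
  rewrite -(subrKA (x + h)); apply: le_lt_trans (ler_enormD _ _) _.
  rewrite [x + h - x]addrAC subrr add0r -/k; have : e * k <= 2^-1 * k by rewrite ler_pM2r.
  lra.
have BQ : B `<=` cube x (k *+ 2).
  move=> z zB i; apply: le_lt_trans zB.
  by have := coord_le_enorm (z - x) i; rewrite !mxE.
have XQ : (X `&` B) `&` cube (x + h) c = set0.
  apply/seteqP; split => // z [[Xz _] /(enorm_lt_cube c0 dc) zc].
  apply: noz; exists z => //; apply: le_trans (ltW zc) _.
  by rewrite ler_pM2r.
have sup : (lebesgue_cV (X `&` B) + lebesgue_cV (cube (x + h) c) <=
    lebesgue_cV B)%E.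
  rewrite /lebesgue_cV; apply: le_trans (lebesgue_tuple_superadditive _) _.
    apply/seteqP; split => // u [Xu Qu].
    suff : ((X `&` B) `&` cube (x + h) c) (\col_i tnth u i) by rewrite XQ.
    by split.
  by apply: le_lebesgue_tuple => u [[]|/QB].
rewrite lebesgue_cube in sup; last exact: ltW.
have := le_lebesgue_cV BQ; rewrite lebesgue_cube; last exact: ltW.
have XB0 : (0 <= lebesgue_cV (X `&` B))%E by exact: lebesgue_tuple_ge0.
have B0 : (0 <= lebesgue_cV B)%E by exact: lebesgue_tuple_ge0.
move: sup XB0 B0.
case: (lebesgue_cV (X `&` B)) => [m||]//; case: (lebesgue_cV B) => [b||]//=.
rewrite !lee_fin => mb m0 b00 bk.
have q0 : 0 < (c *+ 2) ^+ d by rewrite exprn_gt0// pmulrn_lgt0.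
have b0 : 0 < b by lra.
rewrite inver (gt_eqF b0) -EFinM lee_fin ler_pdivrMr//.
have : kap * b <= (c *+ 2) ^+ d.
  apply: le_trans (_ : kap * ((k *+ 2) *+ 2) ^+ d <= _).
    by rewrite ler_pM2l.
  rewrite -exprMn le_eqVlt; apply/orP; left; apply/eqP; congr (_ ^+ _).
  rewrite /c; field; exact: lt0r_neq0.
lra.
Qed.

End density.

(** * Differentials relative to a set *)

Lemma is_derive_expansion {R : realType} (h : R -> R) (a c e : R) :
  is_derive a 1 h c -> 0 < e ->
  \forall u \near a, `|h u - h a - c * (u - a)| <= e * `|u - a|.
Proof.
move=> [dh hc] e0; have : (fun k => k^-1 *: (h (k *: 1 + a) - h a)) @ 0^' --> c.
  by rewrite -hc; exact: dh.
move=> /cvgrPdist_le/(_ _ e0) /nbhs_ballP[r /= r0 hr].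
apply/nbhs_ballP; exists r => // u /= ur.
have [->|ua] := eqVneq u a; first by rewrite !subrr mulr0 subr0 normr0 mulr0.
have k0 : u - a != 0 by rewrite subr_eq0.
have ur' : ball (0 : R) r (u - a).
  by move: ur; rewrite -!ball_normE /ball_ /= sub0r normrN distrC.
have := hr _ ur' k0.
rewrite /GRing.scale /= mulr1 subrK => le_e.
have -> : h u - h a - c * (u - a) = - ((u - a) * (c - (u - a)^-1 * (h u - h a))).
  by field.
by rewrite normrN normrM mulrC ler_wpM2r.
Qed.

Lemma exists_small_factor {R : realType} (e K : R) : 0 < e -> 0 <= K ->
  exists2 e1, 0 < e1 & e1 * K <= e.
Proof.
move=> e0 K0; have K1 : 0 < K + 1 by rewrite ltr_wpDl.
exists (e / (K + 1)); first exact: divr_gt0.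
by rewrite mulrAC ler_pdivrMr// ler_pM2l// lerDl.
Qed.

Section scalar_differential.
Context {R : realType} {d : nat} (X : set 'cV[R]_d) (y : 'cV[R]_d).
Implicit Types (f g : 'cV[R]_d -> R) (p q v : 'cV[R]_d).

Definition has_sdiff f p := forall e : R, 0 < e ->
  \forall z \near within X (nbhs y),
    `|f z - f y - dot p (z - y)| <= e * enorm (z - y).

Definition lipschitz_at f := exists2 K : R, 0 <= K &
  \forall z \near within X (nbhs y), `|f z - f y| <= K * enorm (z - y).

Lemma near_enorm (r : R) : 0 < r ->
  \forall z \near within X (nbhs y), enorm (z - y) < r.
Proof.
by move=> r0; apply: cvg_within; apply/nbhs_enormP; exists r.
Qed.

Lemma has_sdiff_lipschitz f p : has_sdiff f p -> lipschitz_at f.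
Proof.
move=> /(_ 1 ltr01) fp; exists (1 + enorm p); first by rewrite addr_ge0// enorm_ge0.
apply: filterS fp => z; set E := _ - dot _ _ => hE.
have -> : f z - f y = E + dot p (z - y) by rewrite /E; ring.
apply: le_trans (ler_normD _ _) _; rewrite mulrDl lerD//; exact: normr_dot_le.
Qed.

Lemma lipschitz_at_cvg f : lipschitz_at f ->
  f z @[z --> within X (nbhs y)] --> f y.
Proof.
move=> [K K0 fK]; apply/cvgrPdist_le => e e0.
have K1 : 0 < K + 1 by rewrite ltr_wpDl.
have := near_enorm (divr_gt0 e0 K1); apply: filter_app.
apply: filterS fK => z fz; rewrite ltr_pdivlMr// => ze.
rewrite distrC; apply: le_trans fz _; apply: le_trans (ltW ze).
by rewrite mulrC ler_wpM2l ?enorm_ge0// lerDl.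
Qed.

Lemma has_sdiff_ext f g p : (forall z, f z = g z) -> has_sdiff f p -> has_sdiff g p.
Proof. by move=> /funext ->. Qed.

Lemma has_sdiff_cst c : has_sdiff (fun=> c) 0.
Proof.
move=> e e0; apply: nearW => z.
by rewrite subrr dot0l subr0 normr0 mulr_ge0// ltW.
Qed.

Lemma has_sdiff_coord i : has_sdiff (fun z => z i 0) (delta_mx i 0).
Proof.
move=> e e0; apply: nearW => z.
rewrite /dot (bigD1 i)//= big1 => [|j ji]; last by rewrite mxE (negbTE ji) mul0r.
by rewrite !mxE !eqxx mul1r addr0 subrr normr0 mulr_ge0// ltW.
Qed.

Lemma has_sdiffD f g p q : has_sdiff f p -> has_sdiff g q ->
  has_sdiff (fun z => f z + g z) (p + q).
Proof.
move=> fp gq e e0; have e2 : 0 < e / 2 by rewrite divr_gt0.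
have := fp _ e2; apply: filter_app; apply: filterS (gq _ e2) => z hg hf.
have -> : f z + g z - (f y + g y) - dot (p + q) (z - y) =
   (f z - f y - dot p (z - y)) + (g z - g y - dot q (z - y)).
  by rewrite dotDl; ring.
by apply: le_trans (ler_normD _ _) _; rewrite (splitr e) mulrDl lerD.
Qed.

Lemma has_sdiff_comp f p (h : R -> R) c : is_derive (f y) 1 h c ->
  has_sdiff f p -> has_sdiff (fun z => h (f z)) (c *: p).
Proof.
move=> hc fp e e0; have [K K0 fK] := has_sdiff_lipschitz fp.
have e2 : 0 < e / 2 by rewrite divr_gt0.
have [e1 e10 e1K] := exists_small_factor e2 K0.
have [e3 e30 e3c] := exists_small_factor e2 (normr_ge0 c).
have : \forall z \near within X (nbhs y),
    `|h (f z) - h (f y) - c * (f z - f y)| <= e1 * `|f z - f y|.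
  exact: (lipschitz_at_cvg (has_sdiff_lipschitz fp) (is_derive_expansion hc e10)).
apply: filter_app; have := fp _ e30; apply: filter_app.
apply: filterS fK => z hK hf hh; set N := enorm (z - y) in hK hf *.
have N0 : 0 <= N by exact: enorm_ge0.
have -> : h (f z) - h (f y) - dot (c *: p) (z - y) =
  (h (f z) - h (f y) - c * (f z - f y)) + c * (f z - f y - dot p (z - y)).
  by rewrite dotZl; ring.
apply: le_trans (ler_normD _ _) _; rewrite (splitr e) mulrDl lerD//.
  apply: le_trans hh _; apply: le_trans (ler_wpM2l (ltW e10) hK) _.
  by rewrite mulrA ler_wpM2r.
rewrite normrM; apply: le_trans (ler_wpM2l (normr_ge0 c) hf) _.
by rewrite mulrA ler_wpM2r// mulrC.
Qed.

Lemma has_sdiffZ f p c : has_sdiff f p -> has_sdiff (fun z => c * f z) (c *: p).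
Proof.
move=> fp; apply: (@has_sdiff_comp f p ( *%R c)) => //.
by apply: is_derive_eq; rewrite /GRing.scale /= mulr1.
Qed.

(** Polarization reduces the product rule to sums and squares. *)
Lemma has_sdiffM f g p q : has_sdiff f p -> has_sdiff g q ->
  has_sdiff (fun z => f z * g z) (g y *: p + f y *: q).
Proof.
move=> fp gq.
have sq h r : has_sdiff h r -> has_sdiff (fun z => h z ^+ 2) ((2 * h y) *: r).
  move=> hr; apply: (@has_sdiff_comp h r (fun u => u ^+ 2)) => //.
  by apply: is_derive_eq; rewrite /GRing.scale /=; ring.
have h1 := sq _ _ (has_sdiffD fp gq).
have h2 := has_sdiffZ (-1) (has_sdiffD (sq _ _ fp) (sq _ _ gq)).
have h3 := has_sdiffZ (2^-1) (has_sdiffD h1 h2).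
have -> : g y *: p + f y *: q = 2^-1 *: ((2 * (f y + g y)) *: (p + q) +
   -1 *: ((2 * f y) *: p + (2 * g y) *: q)).
  by apply/matrixP => i j; rewrite !mxE; field.
by apply: has_sdiff_ext h3 => z; field.
Qed.

Lemma lipschitz_atM f g : lipschitz_at f -> lipschitz_at g ->
  lipschitz_at (fun z => f z * g z).
Proof.
move=> lf lg; have [K K0 fK] := lf; have [L L0 gL] := lg.
exists (K * (`|g y| + 1) + `|f y| * L); first by rewrite addr_ge0 ?mulr_ge0// addr_ge0.
have /cvgrPdist_le/(_ _ ltr01) := lipschitz_at_cvg lg; apply: filter_app.
apply: filter_app gL; apply: filterS fK => z hf hg hb.
have -> : f z * g z - f y * g y = (f z - f y) * g z + f y * (g z - g y) by ring.
apply: le_trans (ler_normD _ _) _; rewrite !normrM [leRHS]mulrDl lerD//.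
  rewrite mulrAC ler_pM//; rewrite -[g z](subrK (g y)).
  by apply: le_trans (ler_normD _ _) _; rewrite addrC lerD2l distrC.
by rewrite -mulrA ler_wpM2l.
Qed.

Lemma lipschitz_at_comp f (h : R -> R) c : is_derive (f y) 1 h c ->
  lipschitz_at f -> lipschitz_at (fun z => h (f z)).
Proof.
move=> hc lf; have [K K0 fK] := lf.
exists ((1 + `|c|) * K); first by rewrite mulr_ge0// addr_ge0.
have : \forall z \near within X (nbhs y),
    `|h (f z) - h (f y) - c * (f z - f y)| <= 1 * `|f z - f y|.
  exact: (lipschitz_at_cvg lf (is_derive_expansion hc ltr01)).
apply: filter_app; apply: filterS fK => z hK hh.
have -> : h (f z) - h (f y) =
  (h (f z) - h (f y) - c * (f z - f y)) + c * (f z - f y) by ring.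
apply: le_trans (ler_normD _ _) _; rewrite normrM.
apply: le_trans (lerD hh (lexx _)) _.
by rewrite -mulrDl -mulrA ler_wpM2l// addr_ge0.
Qed.

Lemma has_diff_onP (G : 'cV[R]_d -> 'cV[R]_d) (A : 'M[R]_d) :
  has_diff_on X G y A <-> forall i, has_sdiff (fun z => G z i 0) (row i A)^T.
Proof.
have comp z i : (G z - G y - A *m (z - y)) i 0 =
    G z i 0 - G y i 0 - dot (row i A)^T (z - y).
  rewrite !mxE /dot; congr (_ - _).
  by apply: eq_bigr => j _; rewrite !mxE.
split=> [GA i e e0|GA e e0].
  apply: filterS (GA _ e0) => z; apply: le_trans.
  by rewrite -comp coord_le_enorm.
have D0 : 0 <= d%:R :> R by [].
have [e1 e10 e1d] := exists_small_factor e0 D0.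
have : \forall z \near within X (nbhs y), forall i,
    `|G z i 0 - G y i 0 - dot (row i A)^T (z - y)| <= e1 * enorm (z - y).
  by apply: filter_forall => i; exact: GA.
apply: filterS => z hz; apply: le_trans (enorm_le_sum _) _.
apply: le_trans (_ : (e1 * d%:R) * enorm (z - y) <= _).
  rewrite mulrAC mulr_natr -[X in _ *+ X]card_ord -sumr_const.
  by apply: ler_sum => i _; rewrite comp.
by rewrite ler_wpM2r// enorm_ge0.
Qed.

End scalar_differential.

(** * Differentials at filled points *)

Section fills_theory.
Context {R : realType} {d : nat}.
Implicit Types (X : set 'cV[R]_d) (x y v w h : 'cV[R]_d).

Lemma le0_small_factor (a M : R) : 0 <= M ->
  (forall e, 0 < e <= 1 -> a <= e * M) -> a <= 0.
Proof.
move=> M0 aM; rewrite leNgt; apply/negP => a0.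
have a2 : 0 < a / 2 by rewrite divr_gt0.
have [e e0 eM] := exists_small_factor a2 M0.
have e1 : 0 < Num.min e 1 <= 1 by rewrite lt_min e0 ltr01 ge_min lexx orbT.
have := aM _ e1; have : Num.min e 1 * M <= e * M.
  by rewrite ler_wpM2r// ge_min lexx.
lra.
Qed.

(** Every vector is a tangent direction of a set at a point it fills, within any
    relative neighbourhood: scale the vector down and approximate it. *)
Lemma fills_tangent X x (P : set 'cV[R]_d) h (e : R) : fills X x ->
  (\forall z \near within X (nbhs x), P z) -> 0 < e ->
  exists r z, [/\ 0 < r, X z, P z & enorm (z - x - r *: h) <= e * r].
Proof.
move=> fX /nbhs_enormP[rho rho0 PX] e0.
have [e1 e10 e1h] := exists_small_factor e0 (enorm_ge0 h).
have [rho1 rho10 fe] := fX _ e10.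
have M0 : 0 <= enorm h + e by rewrite addr_ge0// ltW.
have mn : 0 < Num.min rho rho1 / 2 by rewrite divr_gt0// lt_min rho0.
have [r r0 rM] := exists_small_factor mn M0.
have := rM; rewrite ler_pdivlMr// => rM2.
have [mr mr1] : Num.min rho rho1 <= rho /\ Num.min rho rho1 <= rho1.
  by rewrite !ge_min !lexx orbT.
have rh0 : 0 <= r * enorm h by rewrite mulr_ge0// ltW.
have re0 : 0 < r * e by rewrite mulr_gt0.
have nrh : enorm (r *: h) = r * enorm h by rewrite enormZ gtr0_norm.
have [|z Xz zh] := fe (r *: h); first by rewrite nrh; nra.
have zr : enorm (z - x - r *: h) <= e * r.
  rewrite -addrA -opprD; apply: le_trans zh _; rewrite nrh mulrCA (mulrC e).
  by rewrite ler_pM2l.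
exists r, z; split => //; apply: PX => //.
have : enorm (z - x) <= enorm (z - x - r *: h) + enorm (r *: h).
  by rewrite -{1}[z - x](subrK (r *: h)) ler_enormD.
by rewrite nrh; nra.
Qed.

Lemma fills_mulmx_eq0 X x (A : 'M[R]_d) : fills X x ->
  (forall e : R, 0 < e -> \forall z \near within X (nbhs x),
    enorm (A *m (z - x)) <= e * enorm (z - x)) -> A = 0.
Proof.
move=> fX hA; suff A0 h : A *m h = 0.
  apply/matrixP => i j; have := congr1 (fun M : 'cV[R]_d => M i 0) (A0 (delta_mx j 0)).
  by rewrite -colE !mxE.
apply: enorm_eq0; apply/eqP; rewrite eq_le enorm_ge0 andbT.
set K := \sum_i \sum_j `|A i j|.
have K0 : 0 <= K by apply: sumr_ge0 => i _; apply: sumr_ge0.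
apply: (@le0_small_factor _ (enorm h + 1 + K)) => [|e /andP[e0 e1]].
  by rewrite !addr_ge0.
have [r [z [r0 Xz Az zr]]] := fills_tangent h fX (hA _ e0) e0.
have zx : enorm (z - x) <= r * enorm h + e * r.
  rewrite -[z - x](subrK (r *: h)); apply: le_trans (ler_enormD _ _) _.
  by rewrite addrC enormZ gtr0_norm// lerD2l.
have : r * enorm (A *m h) <= enorm (A *m (z - x)) + K * enorm (z - x - r *: h).
  rewrite -{1}(gtr0_norm r0) -enormZ scalemxAr.
  set u := z - x - r *: h.
  have -> : r *: h = (z - x) - u by rewrite opprB addrCA subrr addr0.
  rewrite mulmxBr; apply: le_trans (ler_enormB _ _) _; rewrite lerD2l.
  exact: enorm_mulmx_le.
move=> le1; rewrite -(ler_pM2l r0).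
have := ler_wpM2l (ltW e0) zx; have := ler_wpM2l K0 zr.
have : e * (e * r) <= e * r by rewrite ler_piMl// mulr_ge0// ltW.
nra.
Qed.

(** The difference of two relative differentials is negligible on the set, hence
    in all tangent directions, that is, for all vectors. *)
Lemma fills_diff_unique X x (G : 'cV[R]_d -> 'cV[R]_d) (A B : 'M[R]_d) :
  fills X x -> has_diff_on X G x A -> has_diff_on X G x B -> A = B.
Proof.
move=> fX GA GB; apply/eqP; rewrite -subr_eq0; apply/eqP.
apply: (fills_mulmx_eq0 fX) => e e0; have e2 : 0 < e / 2 by rewrite divr_gt0.
have := GA _ e2; apply: filter_app; apply: filterS (GB _ e2) => z hB hA.
have -> : (A - B) *m (z - x) =
    (G z - G x - B *m (z - x)) - (G z - G x - A *m (z - x)).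
  rewrite mulmxBl; move: (A *m _) (B *m _) (G z) (G x) => a b u v.
  by apply/matrixP => i j; rewrite !mxE; ring.
by apply: le_trans (ler_enormB _ _) _; rewrite (splitr e) mulrDl lerD.
Qed.

Lemma diff_onE X x (G : 'cV[R]_d -> 'cV[R]_d) (A : 'M[R]_d) :
  fills X x -> has_diff_on X G x A -> diff_on X G x = A.
Proof.
move=> fX GA; apply: xget_unique => // B GB; exact: fills_diff_unique GB GA.
Qed.

(** All vectors being tangent directions, the lower bound on distances passes to
    the differential and makes its kernel trivial. *)
Lemma fills_diff_unitmx X x (G : 'cV[R]_d -> 'cV[R]_d) (B : 'M[R]_d) (K : R) :
  fills X x -> has_diff_on X G x B -> 0 <= K ->
  (\forall z \near within X (nbhs x), enorm (z - x) <= K * enorm (G z - G x)) ->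
  B \in unitmx.
Proof.
move=> fX GB K0 lowG; suff ker h : B *m h = 0 -> h = 0.
  rewrite -unitmx_tr -row_free_unit -kermx_eq0; apply/eqP/row_matrixP => i.
  rewrite row0; apply: trmx_inj; rewrite trmx0; apply: ker.
  rewrite -{1}[B]trmxK -trmx_mul -row_mul mulmx_ker row0 trmx0//.
move=> Bh; apply: enorm_eq0; apply/eqP; rewrite eq_le enorm_ge0 andbT.
set L := \sum_i \sum_j `|B i j|.
have L0 : 0 <= L by apply: sumr_ge0 => i _; apply: sumr_ge0.
apply: (@le0_small_factor _ (1 + K * L + K * (enorm h + 1))) => [|e /andP[e0 e1]].
  by rewrite !addr_ge0// mulr_ge0// addr_ge0.
have nearP : \forall z \near within X (nbhs x),
    enorm (z - x) <= K * enorm (G z - G x) /\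
    enorm (G z - G x - B *m (z - x)) <= e * enorm (z - x).
  by apply: filterI => //; exact: GB.
have [r [z [r0 Xz [lowz dz] zr]]] := fills_tangent h fX nearP e0.
have zx : enorm (z - x) <= r * enorm h + e * r.
  rewrite -[z - x](subrK (r *: h)); apply: le_trans (ler_enormD _ _) _.
  by rewrite addrC enormZ gtr0_norm// lerD2l.
have zx' : r * enorm h <= enorm (z - x) + e * r.
  rewrite -{1}(gtr0_norm r0) -enormZ.
  set u := z - x - r *: h in zr *.
  have -> : r *: h = (z - x) - u by rewrite opprB addrCA subrr addr0.
  by apply: le_trans (ler_enormB _ _) _; rewrite lerD2l.
have Bz : enorm (B *m (z - x)) <= L * (e * r).
  rewrite -[z - x](subrK (r *: h)) mulmxDr -scalemxAr Bh scaler0 addr0.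
  by apply: le_trans (enorm_mulmx_le _ _) _; rewrite ler_wpM2l.
have Gz : enorm (G z - G x) <= e * enorm (z - x) + L * (e * r).
  rewrite -[G z - G x](subrK (B *m (z - x))).
  by apply: le_trans (ler_enormD _ _) _; rewrite lerD.
have er0 : 0 <= e * r by rewrite mulr_ge0// ltW.
have eer : e * (e * r) <= e * r by rewrite ler_piMl.
have := ler_wpM2l K0 Gz; have := ler_wpM2l (ltW e0) zx => h1 h2.
have := ler_wpM2l K0 h1; have := ler_wpM2l K0 eer => h3 h4.
by rewrite -(ler_pM2l r0); nra.
Qed.

(** To come close to [G x + h], take a point of [X] close to [x + B^-1 h]: the
    norms of [B] and [B^-1] control the loss in the relative precision. *)
Lemma fills_image X Y x (G : 'cV[R]_d -> 'cV[R]_d) (B : 'M[R]_d) :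
  fills X x -> has_diff_on X G x B -> B \in unitmx ->
  (forall z, X z -> Y (G z)) -> fills Y (G x).
Proof.
move=> fX GB Bu XY e e0.
set L := \sum_i \sum_j `|B i j|; set M := \sum_i \sum_j `|invmx B i j|.
have L0 : 0 <= L by apply: sumr_ge0 => i _; apply: sumr_ge0.
have M0 : 0 <= M by apply: sumr_ge0 => i _; apply: sumr_ge0.
have e2 : 0 < e / 2 by rewrite divr_gt0.
have LM0 : 0 <= L * M by rewrite mulr_ge0.
have [a0 a00 a0L] := exists_small_factor e2 LM0.
pose a := Num.min a0 1.
have a_gt0 : 0 < a by rewrite lt_min a00 ltr01.
have a1 : a <= 1 by rewrite ge_min lexx orbT.
have aL : a * (L * M) <= e / 2.
  by apply: le_trans a0L; rewrite ler_wpM2r// ge_min lexx.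
have M20 : 0 <= 2 * M by rewrite mulr_ge0.
have [b b0 bM] := exists_small_factor e2 M20.
have [r1 r10 near1] := (nbhs_enormP _ _).1 (GB _ b0).
have [r2 r20 near2] := fX _ a_gt0.
have mn : 0 < Num.min r1 r2 / 4 by rewrite divr_gt0// lt_min r10.
have [r r0 rM] := exists_small_factor mn M0.
exists r => // h hr; pose v := invmx B *m h.
have vM : enorm v <= M * enorm h by exact: enorm_mulmx_le.
have vmn : enorm v <= Num.min r1 r2 / 4.
  apply: le_trans vM _; apply: le_trans rM; rewrite mulrC ler_wpM2r// ltW//.
have := vmn; rewrite ler_pdivlMr// => vmn2.
have [mr mr1] : Num.min r1 r2 <= r1 /\ Num.min r1 r2 <= r2.
  by rewrite !ge_min !lexx orbT.
have v0 := enorm_ge0 v; have n0 := enorm_ge0 h.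
have mn0 : 0 < Num.min r1 r2 by rewrite lt_min r10.
have [|z Xz zv] := near2 v; first lra.
have av : a * enorm v <= enorm v by rewrite ler_piMl.
have zx : enorm (z - x) <= 2 * enorm v.
  rewrite -[z - x](subrK v); apply: le_trans (ler_enormD _ _) _.
  rewrite mulrDl !mul1r lerD2r -addrA -opprD.
  exact: le_trans zv av.
exists (G z); first exact: XY.
have -> : G z - (G x + h) =
    (G z - G x - B *m (z - x)) + B *m (z - (x + v)).
  rewrite (opprD x v) addrA !mulmxBr /v mulKVmx//.
  move: (B *m z) (B *m x) (G z) (G x) => c c' g g'.
  by apply/matrixP => i j; rewrite !mxE; ring.
apply: le_trans (ler_enormD _ _) _; rewrite (splitr e) mulrDl lerD//.
  apply: le_trans (near1 _ _ Xz) _; first lra.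
  apply: le_trans (ler_wpM2l (ltW b0) zx) _.
  apply: le_trans (_ : b * (2 * (M * enorm h)) <= _).
    by apply: ler_wpM2l (ltW b0) _ _ _; apply: ler_wpM2l.
  by rewrite !mulrA -[b * 2 * M]mulrA ler_wpM2r.
apply: le_trans (enorm_mulmx_le _ _) _.
apply: le_trans (_ : L * (a * (M * enorm h)) <= _).
  rewrite ler_wpM2l//; apply: le_trans zv _.
  by rewrite ler_wpM2l// ltW.
apply: le_trans (_ : a * (L * M) * enorm h <= _); last by rewrite ler_wpM2r.
by rewrite le_eqVlt; apply/orP; left; apply/eqP; ring.
Qed.

End fills_theory.

(** * Symmetry of the relative Hessian *)

Section symmetry.
Context {R : realType} {d : nat}.
Variables (X : set 'cV[R]_d) (x : 'cV[R]_d) (f : 'cV[R]_d -> R).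
Variables (p : 'cV[R]_d -> 'cV[R]_d) (C : R) (H : 'M[R]_d).
Hypotheses (fX : fills X x) (C0 : 0 <= C).
Hypothesis quad : forall z w, X z ->
  `|f w - f z - dot (p z) (w - z)| <= C * enorm (w - z) ^+ 2.
Hypothesis pH : has_diff_on X p x H.

Let KH := \sum_i \sum_j `|H i j|.

Let KH0 : 0 <= KH. Proof. by apply: sumr_ge0 => i _; apply: sumr_ge0. Qed.

Let D := 2 * C + KH.

Let D0 : 0 <= D. Proof. by rewrite addr_ge0// mulr_ge0. Qed.

(* The remainder of f after removing the candidate second-order expansion. *)
Let E w := f (x + w) - f x - dot (p x) w - 2^-1 * dot w (H *m w).

(* Twice the antisymmetric part of H. *)
Let S v w := dot w (H *m v) - dot v (H *m w).

Let dotH_le v w : `|dot v (H *m w)| <= KH * (enorm v * enorm w).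
Proof.
apply: le_trans (normr_dot_le _ _) _; rewrite mulrCA ler_wpM2l//.
exact: enorm_mulmx_le.
Qed.

(* Expand [f] at a point of [X] close to [x + v], where the slope is known to first
   order from [H]. *)
Let increment (eta : R) : 0 < eta -> exists2 rho, 0 < rho &
  forall r v w, r < rho -> enorm v <= r -> enorm w <= r ->
  `|E (v + w) - E v - 2^-1 * S v w| <= D * enorm w ^+ 2 + eta * r ^+ 2.
Proof.
move=> eta0.
have M0 : 0 <= 3 * C + KH + 2 by rewrite !addr_ge0// mulr_ge0.
have [e0 e00 e0M] := exists_small_factor eta0 M0.
pose e := Num.min e0 1.
have e_gt0 : 0 < e by rewrite lt_min e00 ltr01.
have e1 : e <= 1 by rewrite ge_min lexx orbT.
have eM : e * (3 * C + KH + 2) <= eta.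
  by apply: le_trans e0M; rewrite ler_wpM2r// ge_min lexx.
have [r1 r10 near1] := (nbhs_enormP _ _).1 (pH e_gt0).
have [r2 r20 near2] := fX e_gt0.
exists (Num.min (r1 / 2) r2); first by rewrite lt_min r20 divr_gt0.
move=> r v w; rewrite lt_min => /andP[rr1 rr2] vr wr.
have v0 := enorm_ge0 v; have w0 := enorm_ge0 w.
have r0 : 0 <= r by exact: le_trans vr.
have [|z Xz] := near2 v; first exact: le_lt_trans rr2.
set u := z - (x + v) => uv.
have zx : z - x = u + v by rewrite /u opprD addrA subrK.
have zu : x + v - z = - u by rewrite opprB.
have zuw : x + v + w - z = w - u by rewrite addrAC zu addrC.
clearbody u.
have ur : enorm u <= e * r by apply: le_trans uv _; rewrite ler_pM2l.
have u0 := enorm_ge0 u.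
have er : e * r <= r by rewrite ler_piMl.
have zx2 : enorm (z - x) <= 2 * r.
  by rewrite zx; apply: le_trans (ler_enormD _ _) _; lra.
have pz := near1 z _ Xz; have {}pz : enorm (p z - p x - H *m (u + v)) <= e * (2 * r).
  have zr1 : enorm (z - x) < r1 by move: rr1; rewrite ltr_pdivlMr// => ?; lra.
  by rewrite -zx; apply: le_trans (pz zr1) _; rewrite ler_pM2l.
set g := p z - p x - H *m (u + v) in pz.
have q1 := quad (x + v + w) Xz; have q2 := quad (x + v) Xz.
rewrite zu enormN in q2; rewrite zuw in q1.
have pzE : p z = p x + H *m u + H *m v + g.
  rewrite /g mulmxDr; move: (p z) (p x) (H *m u) (H *m v) => a b c c'.
  by apply/matrixP => i j; rewrite !mxE; ring.
set A1 := f (x + v + w) - _ - _ in q1; set A2 := f (x + v) - _ - _ in q2.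
have gw : `|dot g w| <= e * (2 * r) * enorm w.
  by apply: le_trans (normr_dot_le _ _) _; rewrite ler_wpM2r.
have uw : `|dot w (H *m u)| <= KH * (enorm w * enorm u) by exact: dotH_le.
have ww : `|dot w (H *m w)| <= KH * (enorm w * enorm w) by exact: dotH_le.
have -> : E (v + w) - E v - 2^-1 * S v w =
    A1 - A2 + dot w (H *m u) + dot g w - 2^-1 * dot w (H *m w).
  rewrite /E /S /A1 /A2 addrA pzE !mulmxDr.
  rewrite !(dotDl, dotDr, dotNr, dotBr) (dotC (H *m u) w) (dotC (H *m v) w).
  by field.
have wu2 : enorm (w - u) ^+ 2 <= 2 * enorm w ^+ 2 + 2 * enorm u ^+ 2.
  have := ler_enormB w u; rewrite -ler_sqr ?nnegrE ?addr_ge0//.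
  have := sqr_ge0 (enorm w - enorm u); nra.
have u2 : enorm u ^+ 2 <= e * r ^+ 2.
  have : enorm u * enorm u <= e * r * r.
    by apply: ler_pM => //; exact: le_trans er.
  by rewrite expr2 mulrA.
have uwr : enorm w * enorm u <= e * r ^+ 2.
  by rewrite mulrC expr2 mulrA; apply: ler_pM.
have rw : r * enorm w <= r ^+ 2 by rewrite expr2 ler_wpM2l.
have b1 := ler_wpM2l C0 wu2; have b2 := ler_wpM2l C0 u2.
have b3 := ler_wpM2l KH0 uwr; have b4 := ler_wpM2l (ltW e_gt0) rw.
have b5 := ler_wpM2r (sqr_ge0 r) eM.
have b6 : 0 <= KH * (enorm w * enorm w) by rewrite !mulr_ge0.
have tri (a b c c' b' : R) :
    `|a - b + c + c' - 2^-1 * b'| <= `|a| + `|b| + `|c| + `|c'| + 2^-1 * `|b'|.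
  apply: le_trans (ler_normB _ _) _; rewrite normrM (@ger0_norm _ 2^-1) ?invr_ge0//.
  rewrite lerD2r; apply: le_trans (ler_normD _ _) _; rewrite lerD2r.
  by apply: le_trans (ler_normD _ _) _; rewrite lerD2r ler_normB.
apply: le_trans (tri _ _ _ _ _) _; rewrite /D; nra.
Qed.

(* Along a ray S vanishes, so n small steps accumulate an error of order 1 / n
   plus n times an arbitrarily small one. *)
Let remainder (eta : R) : 0 < eta -> exists2 rho, 0 < rho &
  forall r w, r < rho -> enorm w <= r -> `|E w| <= eta * r ^+ 2.
Proof.
move=> eta0; have eta2 : 0 < eta / 2 by rewrite divr_gt0.
have [c c0 cD] := exists_small_factor eta2 D0.
pose n := (Num.truncn c^-1).+1.
have n0 : 0 < n%:R :> R by [].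
have nc : n%:R^-1 <= c.
  by rewrite invf_ple ?posrE//; apply: ltW; rewrite Num.Theory.truncnS_gt.
have [a a0 an] := exists_small_factor eta2 (ltW n0).
have [rho rho0 inc] := increment a0.
exists rho => // r w rrho wr.
have w0 := enorm_ge0 w; have r0 : 0 <= r by exact: le_trans wr.
have step k : (k <= n)%N -> `|E ((k%:R / n%:R) *: w)| <=
    k%:R * (D * (enorm w / n%:R) ^+ 2 + a * r ^+ 2).
  elim: k => [_|k IH kn].
    rewrite !mul0r scale0r /E addr0 subrr dot0r dot0l mulr0 !subr0 normr0//.
  have /IH {}IH := ltnW kn.
  have nk : enorm ((k%:R / n%:R) *: w) = k%:R / n%:R * enorm w.
    by rewrite enormZ ger0_norm.
  have nn : enorm (n%:R^-1 *: w) = n%:R^-1 * enorm w by rewrite enormZ ger0_norm.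
  have := inc r ((k%:R / n%:R) *: w) (n%:R^-1 *: w) rrho.
  rewrite nk nn.
  have kn1 : k%:R / n%:R <= 1 :> R by rewrite ler_pdivrMr// mul1r ler_nat ltnW.
  have n1 : n%:R^-1 <= 1 :> R by rewrite invf_le1// ler1n.
  have h1 : k%:R / n%:R * enorm w <= r by apply: le_trans wr; rewrite ler_piMl.
  have h2 : n%:R^-1 * enorm w <= r by apply: le_trans wr; rewrite ler_piMl.
  move=> /(_ h1 h2).
  have -> : S ((k%:R / n%:R) *: w) (n%:R^-1 *: w) = 0.
    by rewrite /S -!scalemxAr !dotZl !dotZr; ring.
  have -> : (k%:R / n%:R) *: w + n%:R^-1 *: w = (k.+1%:R / n%:R) *: w.
    by rewrite -scalerDl -natr1 mulrDl mul1r.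
  rewrite mulr0 subr0 (mulrC n%:R^-1).
  move=> hk; rewrite -[in leRHS]natr1 [leRHS]mulrDl mul1r -[E _](subrK (E ((k%:R / n%:R) *: w))).
  by apply: le_trans (ler_normD _ _) _; rewrite addrC lerD.
have := step _ (leqnn n); rewrite divff ?lt0r_neq0// scale1r => Ew.
apply: le_trans Ew _; rewrite mulrDr (splitr eta) [leRHS]mulrDl; apply: lerD.
  have -> : n%:R * (D * (enorm w / n%:R) ^+ 2) = n%:R^-1 * D * enorm w ^+ 2.
    by field; exact: lt0r_neq0.
  have w2 : enorm w ^+ 2 <= r ^+ 2 by rewrite ler_sqr.
  apply: le_trans (ler_wpM2l _ w2) _; first by rewrite mulr_ge0// invr_ge0.
  apply: ler_wpM2r; first exact: sqr_ge0.
  by apply: le_trans cD; rewrite ler_wpM2r.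
by rewrite mulrA ler_wpM2r ?sqr_ge0// mulrC.
Qed.

(** If [f] agrees to second order, uniformly on [X], with its affine expansions
    of slope [p], then the relative differential of [p] is symmetric at the
    points that [X] fills: [f] has a second-order Taylor expansion there, and
    comparing the expansions based at two points leaves only the antisymmetric
    part of the differential, to first order in their distance. *)
Lemma fills_hessian_sym : H^T = H.
Proof.
suff S0 v w : enorm v <= 1 -> enorm w <= 1 -> S v w <= 0.
  apply/matrixP => i j; rewrite mxE.
  have en k : enorm (delta_mx k 0 : 'cV[R]_d) <= 1.
    rewrite enormE /dot (bigD1 k)//= big1 => [|l lk].
      by rewrite !mxE !eqxx mulr1 addr0 sqrtr1.
    by rewrite !mxE (negbTE lk) mulr0.
  have HE k l : dot (delta_mx k 0) (H *m delta_mx l 0) = H k l.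
    rewrite /dot (bigD1 k)//= big1 => [|m mk]; last by rewrite mxE (negbTE mk) mul0r.
    by rewrite mxE !eqxx mul1r addr0 -colE mxE.
  have := S0 _ _ (en i) (en j); have := S0 _ _ (en j) (en i).
  by rewrite /S !HE; lra.
move=> v1 w1.
have v0 := enorm_ge0 v; have w0 := enorm_ge0 w.
have M0 : 0 <= 2 * (D + 12) by rewrite mulr_ge0// addr_ge0.
apply: (le0_small_factor M0) => l /andP[l0 l1].
have l20 : 0 < l ^+ 2 by rewrite exprn_gt0.
have [rho1 rho10 inc] := increment l20.
have [rho2 rho20 rem] := remainder l20.
pose r := Num.min rho1 rho2 / 2.
have m0 : 0 < Num.min rho1 rho2 by rewrite lt_min rho10.
have r0 : 0 < r by rewrite divr_gt0.
have [m1 m2] : Num.min rho1 rho2 <= rho1 /\ Num.min rho1 rho2 <= rho2.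
  by rewrite !ge_min !lexx orbT.
have rr1 : r < rho1 by apply: lt_le_trans m1; rewrite /r; lra.
have rr2 : r < rho2 by apply: lt_le_trans m2; rewrite /r; lra.
pose t := r / 2; have t0 : 0 < t by rewrite divr_gt0.
pose v' := t *: v; pose w' := (t * l) *: w.
have tl0 : 0 < t * l by rewrite mulr_gt0.
have tlt : t * l <= t by rewrite ler_piMr// ltW.
have v't : enorm v' <= t by rewrite enormZ gtr0_norm// ler_piMr// ltW.
have w'tl : enorm w' <= t * l by rewrite enormZ gtr0_norm// ler_piMr// ltW.
have tr : t + t = r by rewrite /t -splitr.
have i1 := inc r v' w' rr1; have e1 := rem r (v' + w') rr2.
have e2 := rem r v' rr2.
have {}i1 := i1 ltac:(lra) ltac:(lra); have {}e2 := e2 ltac:(lra).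
have vwr : enorm (v' + w') <= r by have := ler_enormD v' w'; lra.
have {}e1 := e1 vwr.
have SE : S v' w' = t ^+ 2 * l * S v w.
  by rewrite /S /v' /w' -!scalemxAr !dotZl !dotZr; ring.
have w2 : enorm w' ^+ 2 <= (t * l) ^+ 2.
  by rewrite ler_sqr ?nnegrE// ltW.
have Dw := ler_wpM2l D0 w2.
have t2l : 0 < t ^+ 2 * l by rewrite mulr_gt0// exprn_gt0.
rewrite -(ler_pM2l t2l) -SE.
have rt : r ^+ 2 = 4 * t ^+ 2 by rewrite -tr; ring.
rewrite rt in i1 e1 e2.
have -> : t ^+ 2 * l * (l * (2 * (D + 12))) =
  2 * (D * (t * l) ^+ 2 + 3 * (l ^+ 2 * (4 * t ^+ 2))) by ring.
move: i1 e1 e2; rewrite !ler_norml => /andP[i1 i2] /andP[e1 e1'] /andP[e2 e2'].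
by lra.
Qed.

End symmetry.

(** * Trigonometric estimates *)

Section trigonometry.
Context {R : realType}.
Implicit Types (x y a b c : R).

Lemma mean_value (f df : R -> R) a b : (forall x, is_derive x 1 f (df x)) ->
  a <= b -> exists2 c, a <= c <= b & f b - f a = df c * (b - a).
Proof.
move=> dfE ab; have [//|c] := @MVT_segment _ f df a b ab (fun x _ => dfE x).
  apply: continuous_subspaceT => x; apply: differentiable_continuous.
  by apply/derivable1_diffP; have [] := dfE x.
by rewrite in_itv; exists c.
Qed.

Lemma le_cos a b : 0 <= a -> a <= b -> b <= pi -> cos b <= cos a.
Proof.
move=> a0 ab bpi; have [c /andP[ac cb] E] := mean_value (@is_derive_cos R) ab.
have : 0 <= sin c by rewrite sin_ge0_pi// (le_trans a0 ac) (le_trans cb bpi).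
by move: E; nra.
Qed.

Lemma sin_le x : 0 <= x -> sin x <= x.
Proof.
move=> x0; have [c _] := mean_value (@is_derive_sin R) x0.
by rewrite sin0 !subr0 => ->; rewrite ler_piMl// cos_le1.
Qed.

Lemma xcos_le_sin x : 0 <= x <= pi -> x * cos x <= sin x.
Proof.
move=> /andP[x0 xpi]; have [c /andP[c0 cx]] := mean_value (@is_derive_sin R) x0.
rewrite sin0 !subr0 => ->; rewrite mulrC ler_wpM2r//; exact: le_cos.
Qed.

(** Monotonicity of [sin x / x] on the half circle. *)
Lemma sinc_decr x y : 0 <= x -> x <= y -> y <= pi -> x * sin y <= y * sin x.
Proof.
move=> x0 xy ypi; have [c /andP[xc cy] E] := mean_value (@is_derive_sin R) xy.
have hc := le_cos x0 xc (le_trans cy ypi); have := @xcos_le_sin x.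
rewrite x0 (le_trans xy ypi) => /(_ isT) hs.
have -> : sin y = sin x + cos c * (y - x) by lra.
rewrite -subr_ge0.
have -> : y * sin x - x * (sin x + cos c * (y - x)) =
  (y - x) * (sin x - x * cos x + x * (cos x - cos c)) by ring.
by rewrite mulr_ge0 ?subr_ge0// addr_ge0 ?mulr_ge0 ?subr_ge0.
Qed.

(** Minus the derivative of [cos^2] with respect to the squared radius. *)
Definition slope a := sin a * cos a / a.

Lemma slope_ge0_le1 a : 0 <= a < pi / 2 -> 0 <= slope a <= 1.
Proof.
move=> /andP[a0 api]; rewrite /slope; have pi0 := @pi_gt0 R.
have [->|an0] := eqVneq a 0; first by rewrite invr0 mulr0 lexx ler01.
have a_gt0 : 0 < a by rewrite lt_def an0.
have s0 : 0 <= sin a by rewrite sin_ge0_pi// a0; lra.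
have c0 : 0 <= cos a by rewrite cos_ge0_pihalf//; apply/andP; split; lra.
rewrite divr_ge0 ?mulr_ge0//= ler_pdivrMr// mul1r.
apply: le_trans (sin_le a0); rewrite ler_piMr// cos_le1//.
Qed.

(** Cutting the kernel at [pi / 2] makes it convex in the squared radius on the
    whole half line; the costs built with it still bound the value function at
    time [t], which never exceeds [(2 t)^-1], the cost where the kernel vanishes. *)
Definition cos2 b := if b < pi / 2 then cos b ^+ 2 else 0.

(** Tangent inequality for the kernel as a convex function of the squared radius:
    the slope decreases, since [sin x / x] does, so that the difference of the two
    sides is minimal at the point of tangency. *)
Lemma cos2_tangent a b : 0 < a < pi / 2 -> 0 <= b ->
  cos a ^+ 2 - slope a * (b ^+ 2 - a ^+ 2) <= cos2 b.
Proof.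
move=> /andP[a0 api]; have pi0 := @pi_gt0 R.
have /andP[sl0 _] : 0 <= slope a <= 1 by rewrite slope_ge0_le1// api ltW.
pose phi b := cos b ^+ 2 + slope a * b ^+ 2.
pose dphi b := 2 * (slope a * b - sin b * cos b).
have dphiE (t : R) : is_derive t 1 phi (dphi t).
  by apply: is_derive_eq; rewrite /dphi /GRing.scale /=; ring.
have aE : slope a * a = sin a * cos a by rewrite /slope mulfVK// gt_eqF.
have dbl (t : R) : 2 * (sin t * cos t) = sin (2 * t).
  by rewrite [2 * t]mulr_natl mulr2n sinD; ring.
have main (t : R) : 0 <= t <= pi / 2 -> phi a <= phi t.
  move=> /andP[t0 tpi]; rewrite -subr_ge0.
  have [ta|at_] := leP t a.
    have [c /andP[tc ca] E] := mean_value dphiE ta.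
    have h := @sinc_decr (2 * c) (2 * a).
    have : dphi c <= 0.
      rewrite -(ler_pM2l a0) mulr0 /dphi.
      have -> : a * (2 * (slope a * c - sin c * cos c)) =
          c * (2 * (slope a * a)) - a * (2 * (sin c * cos c)) by ring.
      rewrite aE !dbl; have : 2 * c * sin (2 * a) <= 2 * a * sin (2 * c) by apply: h; lra.
      lra.
    by move: E; nra.
  have [c /andP[ac ct] E] := mean_value dphiE (ltW at_).
  have h := @sinc_decr (2 * a) (2 * c).
  have : 0 <= dphi c.
    rewrite -(ler_pM2l a0) mulr0 /dphi.
    have -> : a * (2 * (slope a * c - sin c * cos c)) =
        c * (2 * (slope a * a)) - a * (2 * (sin c * cos c)) by ring.
    rewrite aE !dbl; have : 2 * a * sin (2 * c) <= 2 * c * sin (2 * a) by apply: h; lra.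
    lra.
  by move: E; nra.
move=> b0; rewrite /cos2; case: ltP => bpi.
  by have := main b; rewrite b0 (ltW bpi) => /(_ isT); rewrite /phi; lra.
have pi20 : 0 <= pi / 2 :> R by rewrite divr_ge0// ltW.
have := main (pi / 2); rewrite lexx pi20 => /(_ isT).
rewrite /phi cos_pihalf expr0n /= add0r => h.
have : slope a * (pi / 2) ^+ 2 <= slope a * b ^+ 2.
  by rewrite ler_wpM2l// ler_sqr.
lra.
Qed.

Lemma cos2_ge b : 0 <= b -> 1 - b ^+ 2 <= cos2 b.
Proof.
have pi0 := @pi_gt0 R.
have main (t : R) : 0 <= t <= pi / 2 -> 1 - t ^+ 2 <= cos t ^+ 2.
  move=> /andP[t0 tpi]; have := cos2Dsin2 t; have := sin_le t0.
  have : 0 <= sin t by rewrite sin_ge0_pi// t0; lra.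
  by nra.
move=> b0; rewrite /cos2; case: ltP => bpi; first by apply: main; rewrite b0 ltW.
have pi20 : 0 <= pi / 2 :> R by rewrite divr_ge0// ltW.
have := main (pi / 2); rewrite lexx pi20 => /(_ isT).
rewrite cos_pihalf expr0n /=.
have : (pi / 2 : R) ^+ 2 <= b ^+ 2 by rewrite ler_sqr.
lra.
Qed.

(** The squared radius of [v + h] is itself quadratic in [h], with [|h|^2] as its
    second-order part, and the slope of the kernel is at most one. *)
Lemma cos2_semiconvex d (v h : 'cV[R]_d) : enorm v < pi / 2 ->
  cos (enorm v) ^+ 2 - 2 * slope (enorm v) * dot v h - enorm h ^+ 2 <=
  cos2 (enorm (v + h)).
Proof.
move=> vpi; have [->|v0] := eqVneq v 0.
  rewrite add0r enorm0 cos0 expr1n dot0l mulr0 subr0.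
  exact/cos2_ge/enorm_ge0.
have a0 := enorm_gt0 v0.
have := @cos2_tangent (enorm v) (enorm (v + h)).
rewrite a0 vpi enorm_ge0 => /(_ isT isT); apply: le_trans.
rewrite !sqr_enorm !(dotDl, dotDr) (dotC h v).
have /andP[s0 s1] : 0 <= slope (enorm v) <= 1 by rewrite slope_ge0_le1// vpi enorm_ge0.
have := dot_ge0 h; nra.
Qed.

Lemma tan_atan x : sin (atan x) = x * cos (atan x).
Proof.
have c0 : cos (atan x) != 0.
  by rewrite gt_eqF// cos_gt0_pihalf// atan_gtNpi2 atan_ltpi2.
by rewrite -{2}(atanK x) /tan mulfVK.
Qed.

Lemma atan_lipschitz x y : `|atan x - atan y| <= `|x - y|.
Proof.
wlog yx : x y / y <= x.
  by move=> h; have [/h//|/ltW/h] := leP y x; rewrite distrC (distrC y).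
have [c _ ->] := mean_value (@is_derive1_atan R) yx.
rewrite normrM ler_piMl// ger0_norm ?invr_ge0 ?addr_ge0 ?sqr_ge0//.
by rewrite invf_le1 ?lerDl ?sqr_ge0// ltr_pwDl// sqr_ge0.
Qed.

Lemma atan_ge0 x : 0 <= x -> 0 <= atan x.
Proof.
rewrite le_eqVlt => /predU1P[<-|x0]; first by rewrite atan0.
by rewrite -(@atan0 R) ltW// lt_atan.
Qed.

Lemma atan_le x : 0 <= x -> atan x <= x.
Proof.
move=> x0; have := atan_lipschitz x 0; rewrite atan0 !subr0 (ger0_norm x0).
by apply: le_trans; exact: ler_norm.
Qed.

End trigonometry.

Section arctanv_theory.
Context {R : realType} {d : nat}.
Implicit Types (u v w e : 'cV[R]_d).

Lemma arctanvZ (c : R) e : enorm e = 1 -> arctanv (c *: e) = atan c *: e.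
Proof.
move=> e1; rewrite /arctanv enormZ e1 mulr1 scalerA.
have [->|c0] := eqVneq c 0; first by rewrite mulr0 atan0.
congr (_ *: e); have [cp|cn] := leP 0 c.
  by rewrite ger0_norm// mulfVK.
by rewrite ltr0_norm// atanN invrN mulrNN mulfVK.
Qed.

Lemma arctanv0 : arctanv (0 : 'cV[R]_d) = 0.
Proof. by rewrite /arctanv scaler0. Qed.

Lemma arctanvN v : arctanv (- v) = - arctanv v.
Proof. by rewrite /arctanv enormN scalerN. Qed.

(** Compare [atan r / r] at two radii after multiplication by the radius, which
    avoids differentiating it at the origin. *)
Lemma arctanv_lipschitz u v :
  enorm (arctanv u - arctanv v) <= 3 * enorm (u - v).
Proof.
set a := enorm u; set b := enorm v.
have a0 : 0 <= a := enorm_ge0 u; have b0 : 0 <= b := enorm_ge0 v.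
pose g (t : R) := atan t / t.
have gt (t : R) : g t * t = atan t.
  rewrite /g; have [->|t0] := eqVneq t 0; first by rewrite mulr0 atan0.
  by rewrite mulfVK.
have g01 (t : R) : 0 <= t -> 0 <= g t <= 1.
  rewrite le_eqVlt => /predU1P[<-|t0]; first by rewrite /g invr0 mulr0 lexx ler01.
  have t0' := ltW t0.
  by rewrite /g divr_ge0 ?atan_ge0//= ler_pdivrMr// mul1r atan_le.
have /andP[ga0 ga1] := g01 a a0.
have -> : arctanv u - arctanv v = g a *: (u - v) + (g a - g b) *: v.
  rewrite /arctanv -/a -/b -/(g a) -/(g b).
  by apply/matrixP => i j; rewrite !mxE; ring.
apply: le_trans (ler_enormD _ _) _; rewrite !enormZ -/b ger0_norm//.
have ab : `|a - b| <= enorm (u - v) by exact: ler_dist_enorm.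
have h1 : g a * enorm (u - v) <= enorm (u - v) by rewrite ler_piMl.
have h2 : `|g a - g b| * b <= 2 * `|a - b|.
  rewrite -{2}(ger0_norm b0) -normrM mulrBl gt.
  have -> : g a * b - atan b = g a * (b - a) + (atan a - atan b).
    by rewrite mulrBr gt; ring.
  apply: le_trans (ler_normD _ _) _; rewrite mulrDl !mul1r; apply: lerD.
    by rewrite normrM (ger0_norm ga0) distrC ler_piMl.
  exact: atan_lipschitz.
lra.
Qed.

End arctanv_theory.

(** * The Hopf--Lax operator at interior times *)

Section weight.
Context {R : realType}.
Implicit Types (s t : R) (e : \bar R).

(** At interior times the denominator of the kernel is positive or infinite, so
    its inverse is a real number, which vanishes where the datum is infinite. *)
Definition weight t e : R := fine (1 + (2 * t)%:E * e)^-1%E.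

Lemma weight_fin t (r : R) : 0 < t < 1 -> - 2^-1 <= r ->
  [/\ 0 < 1 + 2 * t * r, weight t r%:E = (1 + 2 * t * r)^-1 &
      ((1 + (2 * t)%:E * r%:E)^-1 = (weight t r%:E)%:E)%E].
Proof.
move=> /andP[t0 t1] r1; have h : 0 < 1 + 2 * t * r by nra.
by rewrite /weight -EFinM -EFinD inver gt_eqF.
Qed.

Lemma weight_pinfty t : 0 < t < 1 ->
  weight t +oo%E = 0 /\ ((1 + (2 * t)%:E * +oo)^-1 = (0 : R)%:E)%E.
Proof.
by move=> /andP[t0 t1]; rewrite /weight gt0_muley ?lte_fin ?mulr_gt0.
Qed.

Lemma weightE t e : 0 < t < 1 -> ((- 2^-1)%:E <= e)%E ->
  ((1 + (2 * t)%:E * e)^-1 = (weight t e)%:E)%E.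
Proof.
case: e => [r||]// t01; rewrite ?lee_fin => r1.
  by have [_ _ ->] := weight_fin t01 r1.
by have [-> ->] := weight_pinfty t01.
Qed.

Lemma weight_ge0 t e : 0 < t < 1 -> ((- 2^-1)%:E <= e)%E -> 0 <= weight t e.
Proof.
case: e => [r||]// t01; rewrite ?lee_fin => r1; last by rewrite (weight_pinfty t01).1.
by have [h -> _] := weight_fin t01 r1; rewrite invr_ge0 ltW.
Qed.

Lemma weight_le t e : 0 < t < 1 -> ((- 2^-1)%:E <= e)%E ->
  weight t e * (1 - t) <= 1.
Proof.
case: e => [r||]// t01; rewrite ?lee_fin => r1;
  last by rewrite (weight_pinfty t01).1 mul0r.
have [h -> _] := weight_fin t01 r1; rewrite mulrC ler_pdivrMr// mul1r.
by move: t01 => /andP[t0 t1]; nra.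
Qed.

(** Elimination of the datum between its weights at two times, in a form that
    covers an infinite datum, for which both weights vanish. *)
Lemma weight_change s t e : 0 < s < 1 -> 0 < t < 1 -> ((- 2^-1)%:E <= e)%E ->
  weight t e * (t - (t - s) * weight s e) = s * weight s e.
Proof.
case: e => [r||]// s01 t01; rewrite ?lee_fin => r1; last first.
  by rewrite (weight_pinfty t01).1 (weight_pinfty s01).1 !mulr0 mul0r.
have [ht -> _] := weight_fin t01 r1; have [hs -> _] := weight_fin s01 r1.
by field; rewrite !gt_eqF.
Qed.

Lemma weight_lt t e c : 0 < t < 1 -> ((- 2^-1)%:E <= e)%E -> 0 < c ->
  (weight t e < c) = (((c^-1 - 1) / (2 * t))%:E < e)%E.
Proof.
case: e => [r||]// t01; rewrite ?lee_fin => r1 c0; last first.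
  by rewrite (weight_pinfty t01).1 c0 ltry.
have [ht -> _] := weight_fin t01 r1; have /andP[t0 t1] := t01.
rewrite lte_fin invf_plt ?posrE// ltr_pdivrMr ?mulr_gt0//.
by rewrite ltrBlDl (mulrC r).
Qed.

End weight.

Section compactness.
Context {R : realType} {d : nat}.

Lemma compact_cV_ball (M : R) :
  compact [set v : 'cV[R]_d | exists2 u : 'rV[R]_d, `|u| <= M & u^T = v].
Proof.
have normT m n (u : 'M[R]_(m, n)) : `|u^T| <= `|u|.
  rewrite {1}/Num.Def.normr/= mx_normrE (bigmax_le _ (normr_ge0 u))//= => -[i j] _.
  rewrite mxE [leRHS]/Num.Def.normr/= mx_normrE.
  exact: (le_bigmax _ (fun ij : 'I_m * 'I_n => `|u ij.1 ij.2|) (j, i)).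
apply: (@continuous_compact _ _ (@trmx R 1 d) [set u | `|u| <= M]).
  apply: continuous_subspaceT => u; apply/(@cvgrPdist_lt _ _ _ (nbhs (u : 'rV[R]_d)) _) => e e0.
  apply/nbhs_ballP; exists e => // v /=; rewrite -ball_normE /= => uv.
  by rewrite -linearB; apply: le_lt_trans (normT _ _ _) uv.
apply: bounded_closed_compact.
  by exists M; split; [exact: num_real|move=> N MN u /= uM; exact: le_trans uM (ltW MN)].
rewrite (_ : [set u | _] = (fun u : 'rV[R]_d => `|u|) @^-1` [set r | r <= M]).
  by apply: closed_comp; [move=> u _; exact: norm_continuous|exact: closed_le].
by [].
Qed.

(** Attainment of the supremum of an upper semicontinuous function on a compact
    set, in contrapositive form. *)
Lemma compact_usc_lt (K : set 'cV[R]_d) (F : 'cV[R]_d -> R) (M : R) :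
  compact K -> (forall y c, F y < c -> \forall z \near y, F z < c) ->
  (forall y, F y < M) -> exists2 c, c < M & forall y, K y -> F y < c.
Proof.
move=> /compact_near_coveringP cK usc FM.
have : \forall c \near M^'-, K `<=` (fun y => F y < c).
  apply: (cK _ _ (fun c y => F y < c)) => y Ky.
  pose m := (F y + M) / 2; have ym : F y < m by rewrite midf_lt.
  have mM : m < M by rewrite midf_lt.
  exists ([set z | F z < m], [set c | m <= c]).
    by split; [exact: usc|exact: nbhs_left_ge].
  by move=> [z c] [/= zm mc]; exact: lt_le_trans mc.
move=> h; have [c [cM Kc]] : exists c, c < M /\ K `<=` (fun y => F y < c).
  near (M^'-) => c; exists c; split; near: c; [exact: nbhs_left_lt|exact: h].
by exists c.
Unshelve. all: by end_near. Qed.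

End compactness.

Section hopf_lax.
Context {R : realType} {d : nat}.
Variables (phi : 'cV[R]_d -> \bar R) (t : R).
Hypotheses (t01 : 0 < t < 1) (phi_ge : forall z, ((- 2^-1)%:E <= phi z)%E).
Implicit Types (x y z w : 'cV[R]_d).

(** Real-valued form of the operator, which is finite at interior times. *)
Definition hl x : R := fine (hopf_laxP t phi x).

Definition cost x y : R :=
  (2 * t)^-1 * (1 - cos (enorm (x - y)) ^+ 2 * weight t (phi y)).

Let t0 : 0 < t. Proof. by case/andP: t01. Qed.
Let t1 : t < 1. Proof. by case/andP: t01. Qed.

Lemma hopf_laxPE x : hopf_laxP t phi x =
  ereal_inf [set (cost x y)%:E | y in [set y | enorm (y - x) < pi / 2]].
Proof.
rewrite /hopf_laxP gt_eqF//; congr ereal_inf; apply: eq_imagel => y _.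
by rewrite weightE// -EFinM -EFinB -EFinM.
Qed.

Let in_ball x : [set y | enorm (y - x) < pi / 2] x.
Proof. by rewrite /= subrr enorm0 divr_gt0// pi_gt0. Qed.

Lemma cost_le x y : cost x y <= (2 * t)^-1.
Proof.
rewrite /cost ler_piMr ?invr_ge0 ?mulr_ge0// ?(ltW t0)// lerBlDr lerDl.
by rewrite mulr_ge0 ?sqr_ge0// weight_ge0.
Qed.

Lemma cost_ge x y : - (2 * (1 - t))^-1 <= cost x y.
Proof.
have t1' : 0 < 1 - t by rewrite subr_gt0.
have W0 := weight_ge0 t01 (phi_ge y); have W1 := weight_le t01 (phi_ge y).
have c1 : cos (enorm (x - y)) ^+ 2 <= 1.
  by have := cos2Dsin2 (enorm (x - y)); have := sqr_ge0 (sin (enorm (x - y))); lra.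
have : cos (enorm (x - y)) ^+ 2 * weight t (phi y) <= (1 - t)^-1.
  apply: le_trans (ler_piMl W0 c1) _.
  by rewrite -[leRHS]mul1r ler_pdivlMr.
move=> h; rewrite /cost.
have -> : - (2 * (1 - t))^-1 = (2 * t)^-1 * (1 - (1 - t)^-1).
  by field; rewrite !gt_eqF.
by rewrite ler_pM2l ?invr_gt0 ?mulr_gt0// lerD2l lerN2.
Qed.

Lemma hlE x : hopf_laxP t phi x = (hl x)%:E.
Proof.
rewrite /hl fineK// hopf_laxPE fin_numElt; apply/andP; split.
  apply: (@lt_le_trans _ _ (- (2 * (1 - t))^-1)%:E); first exact: ltNyr.
  by apply: le_ereal_inf_tmp => _ [y _ <-]; rewrite lee_fin cost_ge.
apply: (@le_lt_trans _ _ (cost x x)%:E); last exact: ltry.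
by apply: ereal_inf_lbound; exists x => //; exact: in_ball.
Qed.

Lemma hl_le_cost x y : enorm (y - x) < pi / 2 -> hl x <= cost x y.
Proof.
move=> xy; rewrite -lee_fin -hlE hopf_laxPE.
by apply: ereal_inf_lbound; exists y.
Qed.

Lemma hl_ge x (c : R) : (forall y, enorm (y - x) < pi / 2 -> c <= cost x y) ->
  c <= hl x.
Proof.
move=> h; rewrite -lee_fin -hlE hopf_laxPE.
by apply: le_ereal_inf_tmp => _ [y xy <-]; rewrite lee_fin h.
Qed.

Lemma hl_bounds x : - (2 * (1 - t))^-1 <= hl x <= (2 * t)^-1.
Proof.
rewrite hl_ge => [|y _]; last exact: cost_ge.
by apply: le_trans (hl_le_cost (in_ball x)) _; exact: cost_le.
Qed.

Let cos2_usc x y c : cos2 (enorm (x - y)) < c ->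
  \forall z \near y, cos2 (enorm (x - z)) < c.
Proof.
have contN : {for y, continuous (fun z : 'cV[R]_d => enorm (x - z))}.
  apply/(@cvgrPdist_lt _ _ _ (nbhs y) _) => e e0.
  apply/nbhs_enormP; exists e => // z zy.
  apply: le_lt_trans (ler_dist_enorm _ _) _.
  by rewrite opprB addrC subrKA.
have [ypi|ypi] := leP (enorm (x - y)) (pi / 2).
  have -> : cos2 (enorm (x - y)) = cos (enorm (x - y)) ^+ 2.
    rewrite /cos2; move: ypi; rewrite le_eqVlt => /predU1P[->|->//].
    by rewrite ltxx cos_pihalf expr0n.
  move=> yc; have cc : {for y, continuous (fun z => cos (enorm (x - z)) ^+ 2)}.
    have c2 : {for enorm (x - y), continuous (fun u : R => cos u ^+ 2)}.
      by apply: differentiable_continuous; exact/derivable1_diffP/ex_derive.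
    exact: (continuous_comp contN c2).
  have near_c : \forall z \near nbhs y, cos (enorm (x - z)) ^+ 2 < c.
    exact: (@cvgr_lt _ _ _ _ _ _ cc _ yc).
  apply: filterS near_c => z; apply: le_lt_trans.
  by rewrite /cos2; case: ifP => // _; exact: sqr_ge0.
move=> c0; have near_pi : \forall z \near nbhs y, pi / 2 < enorm (x - z).
  exact: (@cvgr_gt _ _ _ _ _ _ contN _ ypi).
apply: filterS near_pi => z zpi.
by move: c0; rewrite /cos2 !(ltNge _ (pi / 2)) (ltW zpi) (ltW ypi).
Qed.

(** Minimizing the cost is maximizing the truncated kernel times the weight, an
    upper semicontinuous function; outside the ball it vanishes and does not
    compete. *)
Lemma hl_attained x : lower_semicontinuous phi ->
  exists2 y, enorm (y - x) < pi / 2 & hl x = cost x y.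
Proof.
move=> lsc; apply: contrapT => noy.
have lt_cost y : enorm (y - x) < pi / 2 -> hl x < cost x y.
  move=> xy; rewrite lt_neqAle hl_le_cost// andbT.
  by apply/eqP => E; apply: noy; exists y.
pose F y := cos2 (enorm (x - y)) * weight t (phi y).
pose M := 1 - 2 * t * hl x.
have t2 : 0 < 2 * t by rewrite mulr_gt0.
have hM : hl x = (2 * t)^-1 * (1 - M) by rewrite /M; field; rewrite gt_eqF.
have cF y : enorm (y - x) < pi / 2 -> cost x y = (2 * t)^-1 * (1 - F y).
  by move=> xy; rewrite /cost /F /cos2 enormBC xy.
have W0 y := weight_ge0 t01 (phi_ge y).
have k0 y : 0 <= cos2 (enorm (x - y)) by rewrite /cos2; case: ifP => // _; exact: sqr_ge0.
have F0 y : 0 <= F y by rewrite mulr_ge0.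
have FM1 y : enorm (y - x) < pi / 2 -> F y < M.
  move=> xy; have := lt_cost _ xy; rewrite hM cF// ltr_pM2l ?invr_gt0//; lra.
have M0 : 0 < M by apply: le_lt_trans (F0 x) _; exact/FM1/in_ball.
have FM y : F y < M.
  have [/FM1//|xy] := ltP (enorm (y - x)) (pi / 2).
  by rewrite /F /cos2 enormBC (ltNge _ (pi / 2)) xy mul0r.
have usc y c : F y < c -> \forall z \near y, F z < c.
  move=> yc; set k := cos2 (enorm (x - y)); set W := weight t (phi y).
  have kW : 0 < c - k * W by rewrite subr_gt0.
  have K0 : 0 <= k + W + 1 by rewrite !addr_ge0//; [exact: k0|exact: W0].
  have [e0 e00 eK] := exists_small_factor kW K0.
  pose e := Num.min e0 1.
  have e_gt0 : 0 < e by rewrite lt_min e00 ltr01.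
  have e1 : e <= 1 by rewrite ge_min lexx orbT.
  have ee0 : e * (k + W + 1) <= c - k * W.
    by apply: le_trans eK; rewrite ler_wpM2r// ge_min lexx.
  have W_e : W < W + e by rewrite ltrDl.
  have We0 : 0 < W + e by rewrite ltr_wpDl//; exact: W0.
  have := W_e; rewrite weight_lt// => /lsc[V yV Vlt].
  have k_e : cos2 (enorm (x - y)) < k + e by rewrite ltrDl.
  have := cos2_usc k_e; apply: filter_app; apply: filterS yV => z /Vlt.
  rewrite -weight_lt// => Wz kz.
  apply: lt_le_trans (_ : (k + e) * (W + e) <= c); first by rewrite ltr_pM.
  have -> : (k + e) * (W + e) = k * W + e * (k + W + e) by ring.
  have : e * (k + W + e) <= e * (k + W + 1) by rewrite ler_pM2l// lerD2l.
  lra.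
have [c cM Fc] := compact_usc_lt (@compact_cV_ball R d (pi / 2 + enorm x)) usc FM.
have : (2 * t)^-1 * (1 - c) <= hl x.
  apply: hl_ge => y xy; rewrite cF// ler_pM2l ?invr_gt0// lerD2l lerN2 ltW//.
  apply: Fc; exists y^T; last by rewrite trmxK.
  apply: (@le_trans _ _ (enorm y)).
    rewrite {1}/Num.Def.normr/= mx_normrE (bigmax_le _ (enorm_ge0 y))//= => -[i j] _.
    by rewrite mxE ord1 coord_le_enorm.
  rewrite -[y](subrK x); apply: le_trans (ler_enormD _ _) _.
  by rewrite lerD2r ltW.
rewrite hM ler_pM2l ?invr_gt0//; lra.
Qed.

End hopf_lax.

(** * Transport of optimal points *)

Section optimal_points.
Context {R : realType} {d : nat}.
Variables (phi : 'cV[R]_d -> \bar R).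
Hypothesis phi_ge : forall z, ((- 2^-1)%:E <= phi z)%E.
Implicit Types (s t : R) (x y z w p : 'cV[R]_d).

Definition optimal t x y := enorm (y - x) < pi / 2 /\ hl phi t x = cost phi t x y.

(** Gradient in [x] of the cost of the point [y]. *)
Definition cost_grad t x y : 'cV[R]_d :=
  (weight t (phi y) / t * slope (enorm (x - y))) *: (x - y).

(** The cost of an optimal point touches the value function from above, and the
    costs are uniformly semiconcave because of the convexity of the kernel in
    the squared radius. *)
Lemma hl_semiconcave t x y w : 0 < t < 1 -> optimal t x y ->
  hl phi t w <= hl phi t x + dot (cost_grad t x y) (w - x)
                + (2 * t * (1 - t))^-1 * enorm (w - x) ^+ 2.
Proof.
move=> t01 [xy xE]; have /andP[t0 t1] := t01.
have t1' : 0 < 1 - t by rewrite subr_gt0.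
set W := weight t (phi y).
have W0 : 0 <= W := weight_ge0 t01 (phi_ge y).
have W1 : W * (1 - t) <= 1 := weight_le t01 (phi_ge y).
set h := w - x; set v := x - y.
have wE : w - y = v + h by rewrite /v /h [RHS]addrC addrA subrK.
have up : hl phi t w <= (2 * t)^-1 * (1 - W * cos2 (enorm (v + h))).
  rewrite /cos2 -wE; case: ltP => wy.
    have := @hl_le_cost _ _ phi t t01 phi_ge w y; rewrite enormBC => /(_ wy).
    by rewrite /cost -/W (mulrC W).
  rewrite mulr0 subr0 mulr1.
  by have /andP[] := hl_bounds t01 phi_ge w.
have vpi : enorm v < pi / 2 by rewrite /v enormBC.
have := ler_wpM2l W0 (cos2_semiconvex h vpi) => key.
apply: le_trans up _; rewrite xE /cost -/v -/W /cost_grad -/v -/W dotZl.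
have n0 := sqr_ge0 (enorm h).
have Wn : W * enorm h ^+ 2 <= (1 - t)^-1 * enorm h ^+ 2.
  by rewrite ler_wpM2r// -[leRHS]mul1r ler_pdivlMr.
have -> : (2 * t * (1 - t))^-1 * enorm h ^+ 2 =
    (2 * t)^-1 * ((1 - t)^-1 * enorm h ^+ 2) by field; rewrite !gt_eqF.
have -> : W / t * slope (enorm v) * dot v h =
    (2 * t)^-1 * (W * (2 * slope (enorm v) * dot v h)) by field; rewrite gt_eqF.
rewrite -!mulrDr ler_pM2l ?invr_gt0 ?mulr_gt0//.
rewrite !mulrBr in key; lra.
Qed.

End optimal_points.

(** With [u] and [p] the value and the gradient at a point of a solution, the
    square of the dilation and the value after a time lapse [tau]. *)
Definition dil2 {R : realType} {d : nat} (u tau : R) (p : 'cV[R]_d) : R :=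
  (1 + 2 * tau * u) ^+ 2 + tau ^+ 2 * dot p p.

Definition flow_val {R : realType} {d : nat} (u tau : R) (p : 'cV[R]_d) : R :=
  (2 * u * (1 + 2 * tau * u) + tau * dot p p) / (2 * dil2 u tau p).

Definition flow_map {R : realType} {d : nat} (u tau : R) (p x : 'cV[R]_d) :
  'cV[R]_d := x + arctanv ((tau / (1 + 2 * tau * u)) *: p).

Lemma dil2_gt0 {R : realType} {d : nat} (u tau : R) (p : 'cV[R]_d) :
  0 < 1 + 2 * tau * u -> 0 < dil2 u tau p.
Proof.
move=> a0; rewrite /dil2 ltr_pwDl ?exprn_gt0// mulr_ge0 ?sqr_ge0//.
exact: dot_ge0.
Qed.

(** The bounds on the value at time [s] keep the flow away from the singularity
    of its formulas for all interior times. *)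
Lemma affine_gt0 {R : realType} (s t u : R) : 0 < s < 1 -> 0 < t < 1 ->
  - (2 * (1 - s))^-1 <= u <= (2 * s)^-1 -> 0 < 1 + 2 * (t - s) * u.
Proof.
move=> /andP[s0 s1] /andP[t0 t1] /andP[ul uu].
have s1' : 0 < 1 - s by rewrite subr_gt0.
have h1 : u * (2 * s) <= 1 by rewrite -ler_pdivlMr ?mulr_gt0// div1r.
have h2 : - 1 <= u * (2 * (1 - s)).
  by rewrite -ler_pdivrMr ?mulr_gt0// mulN1r.
have [ts|ts] := leP s t.
  rewrite -(pmulr_rgt0 _ s1').
  have : (t - s) * - 1 <= (t - s) * (u * (2 * (1 - s))).
    by rewrite ler_wpM2l// subr_ge0.
  by nra.
rewrite -(pmulr_rgt0 _ s0).
have : (s - t) * (u * (2 * s)) <= (s - t) * 1.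
  by rewrite ler_wpM2l// subr_ge0 ltW.
by nra.
Qed.

Section transport_optimal.
Context {R : realType} {d : nat}.
Variables (phi : 'cV[R]_d -> \bar R).
Hypothesis phi_ge : forall z, ((- 2^-1)%:E <= phi z)%E.

(** The trigonometry behind the transport: on the ray issued from the optimal
    point with unit direction, [alpha] is the distance at time [s] and
    [alpha + beta] the distance at time [t]; the addition formulas turn the
    transported quantities into rational functions. *)
Lemma transport_angle (s t W Wt alpha : R) :
  0 < s < 1 -> 0 < t < 1 -> 0 <= W -> W * (1 - s) <= 1 ->
  Wt * (t - (t - s) * W) = s * W -> 0 <= alpha < pi / 2 ->
  let u := (2 * s)^-1 * (1 - cos alpha ^+ 2 * W) in
  let sg := W / s * (sin alpha * cos alpha) in
  let a := 1 + 2 * (t - s) * u in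
  let Q := a ^+ 2 + (t - s) ^+ 2 * sg ^+ 2 in
  let gam := alpha + atan ((t - s) / a * sg) in
  0 < a ->
  [/\ `|gam| < pi / 2,
      (2 * t)^-1 * (1 - cos gam ^+ 2 * Wt) =
        (2 * u * a + (t - s) * sg ^+ 2) / (2 * Q) &
      Wt / t * (sin gam * cos gam) = sg / Q].
Proof.
move=> /andP[s0 s1] /andP[t0 t1] W0 W1 WtE /andP[al0 alpi] u sg a Q gam a0.
have pi0 := @pi_gt0 R; set tau := t - s in WtE a Q gam a0 *.
set E := t - tau * W in WtE.
have E0 : 0 < E.
  rewrite /E /tau; have [ts|ts] := leP s t.
    have s1' : 0 < 1 - s by rewrite subr_gt0.
    rewrite -(pmulr_rgt0 _ s1'); have := ler_wpM2l (_ : 0 <= t - s) W1.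
    by rewrite subr_ge0 => /(_ ts); nra.
  have : 0 <= (s - t) * W by rewrite mulr_ge0// subr_ge0 ltW.
  by nra.
set c := cos alpha; set n := sin alpha.
have c0 : 0 < c by rewrite cos_gt0_pihalf//; apply/andP; split; lra.
have n2 : n ^+ 2 = 1 - c ^+ 2 by have := cos2Dsin2 alpha; rewrite -/c -/n; lra.
have Q0 : 0 < Q by rewrite /Q ltr_pwDl ?exprn_gt0// mulr_ge0// sqr_ge0.
have [sn an tn] : [/\ s != 0, a != 0 & t != 0] by rewrite !gt_eqF.
have saE : s * a = t - tau * W * c ^+ 2.
  by rewrite /a /u -/c /tau; field.
set beta := atan _ in gam *; pose cb := cos beta.
have cb0 : 0 < cb by rewrite cos_gt0_pihalf// atan_gtNpi2 atan_ltpi2.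
have sbE : sin beta = tau / a * sg * cb by rewrite /beta tan_atan.
have cb2 : cb ^+ 2 = a ^+ 2 / Q.
  have := cos2Dsin2 beta; rewrite -/cb sbE => h.
  have : cb ^+ 2 * Q = a ^+ 2.
    have -> : cb ^+ 2 * Q = (cb ^+ 2 + (tau / a * sg * cb) ^+ 2) * a ^+ 2.
      by rewrite /Q; field.
    by rewrite h mul1r.
  by move=> <-; rewrite mulfK// gt_eqF.
have cosg : cos gam = cb * c * E / (s * a).
  rewrite /gam cosD -/c -/n -/cb sbE.
  have -> : c * cb - n * (tau / a * sg * cb) =
      cb * (c * (s * a) - tau * W * n ^+ 2 * c) / (s * a).
    by rewrite /sg -/c -/n; field; rewrite sn an.
  have -> : c * (s * a) - tau * W * n ^+ 2 * c = c * E.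
    by rewrite n2 saE /E; ring.
  by rewrite mulrA.
have sing : sin gam = cb * t * n / (s * a).
  rewrite /gam sinD -/c -/n -/cb sbE.
  have -> : n * cb + c * (tau / a * sg * cb) =
      cb * (n * (s * a) + tau * W * c ^+ 2 * n) / (s * a).
    by rewrite /sg -/c -/n; field; rewrite sn an.
  have -> : n * (s * a) + tau * W * c ^+ 2 * n = t * n by rewrite saE; ring.
  by rewrite mulrA.
have cosg0 : 0 < cos gam by rewrite cosg divr_gt0 ?mulr_gt0.
have Wt_E : Wt = s * W / E by rewrite -WtE mulfK// gt_eqF.
have En : E != 0 by rewrite gt_eqF.
have Qn : Q != 0 by rewrite gt_eqF.
split.
- have b1 := atan_gtNpi2 (tau / a * sg); have b2 := atan_ltpi2 (tau / a * sg).
  rewrite -/beta in b1 b2; rewrite ltr_norml; apply/andP; split; first by rewrite /gam; lra.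
  rewrite ltNge; apply/negP => pig.
  have : cos gam <= cos (pi / 2).
    by apply: le_cos => //; rewrite /gam; lra.
  by rewrite cos_pihalf leNgt cosg0.
- have -> : cos gam ^+ 2 * Wt = c ^+ 2 * E * W / (s * Q).
    rewrite cosg Wt_E.
    have -> : (cb * c * E / (s * a)) ^+ 2 * (s * W / E) =
       cb ^+ 2 * (c ^+ 2 * E * W / (s * a ^+ 2)) by field; rewrite ?sn ?an ?tn ?En ?Qn.
    by rewrite cb2; field; rewrite ?sn ?an ?tn ?En ?Qn.
  apply: (mulIf (mulf_neq0 (mulf_neq0 (_ : 2 != 0) tn) Qn)) => //.
  have -> : (2 * t)^-1 * (1 - c ^+ 2 * E * W / (s * Q)) * (2 * t * Q) =
      Q - c ^+ 2 * E * W / s by field; rewrite ?sn ?an ?tn ?En ?Qn.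
  have -> : (2 * u * a + tau * sg ^+ 2) / (2 * Q) * (2 * t * Q) =
     t * (2 * u * a + tau * sg ^+ 2) by field; rewrite ?sn ?an ?tn ?En ?Qn.
  have sg2 : sg ^+ 2 = W ^+ 2 * (1 - c ^+ 2) * c ^+ 2 / s ^+ 2.
    by rewrite -n2 /sg -/c -/n; field.
  by rewrite /Q sg2 /a /u -/c /E /tau; field.
- rewrite cosg sing Wt_E.
  have -> : s * W / E / t * (cb * t * n / (s * a) * (cb * c * E / (s * a))) =
     cb ^+ 2 * (W * n * c / (s * a ^+ 2)) by field; rewrite ?sn ?an ?tn ?En ?Qn.
  by rewrite cb2 /sg -/c -/n; field; rewrite ?sn ?an ?tn ?En ?Qn.
Qed.

(** An optimal point stays optimal along the flow, as far as its cost and the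
    gradient of its cost are concerned. *)
Lemma transport_cost s t x y : 0 < s < 1 -> 0 < t < 1 -> optimal phi s x y ->
  let u := hl phi s x in let p := cost_grad phi s x y in
  let z := flow_map u (t - s) p x in
  [/\ enorm (y - z) < pi / 2, cost phi t z y = flow_val u (t - s) p &
      cost_grad phi t z y = (dil2 u (t - s) p)^-1 *: p].
Proof.
move=> s01 t01 [xy uE] u p z; set tau := t - s in z *.
have a0 : 0 < 1 + 2 * tau * u := affine_gt0 s01 t01 (hl_bounds s01 phi_ge x).
have W0 := weight_ge0 s01 (phi_ge y); have W1 := weight_le s01 (phi_ge y).
have WtE := weight_change s01 t01 (phi_ge y).
set v := x - y; set al := enorm v.
have al_pi : 0 <= al < pi / 2 by rewrite enorm_ge0 /al /v enormBC.
have uE' : u = (2 * s)^-1 * (1 - cos al ^+ 2 * weight s (phi y)) by [].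
have := transport_angle s01 t01 W0 W1 WtE al_pi.
rewrite /= -/tau -uE' => /(_ a0).
set sg := weight s (phi y) / s * _; set g := al + _ => -[gpi costE gradE].
have dirE : exists e, [/\ p = sg *: e, z - y = g *: e, enorm (z - y) = `|g| &
    dot p p = sg ^+ 2].
  have [v0|v0] := eqVneq v 0.
    have al0 : al = 0 by rewrite /al v0 enorm0.
    have sg0 : sg = 0 by rewrite /sg al0 sin0 mul0r mulr0.
    have p0 : p = 0 by rewrite /p /cost_grad -/v v0 scaler0.
    have zy : z - y = 0 by rewrite /z /flow_map p0 scaler0 arctanv0 addr0.
    have g0 : g = 0 by rewrite /g al0 sg0 mulr0 atan0 addr0.
    exists 0; rewrite p0 zy g0 !scaler0 enorm0 normr0 dot0l sg0 expr0n.
    by [].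
  have al0 : 0 < al := enorm_gt0 v0.
  pose e := al^-1 *: v.
  have e1 : enorm e = 1 by rewrite enormZ gtr0_norm ?invr_gt0// mulVf// gt_eqF.
  have vE : v = al *: e by rewrite scalerA divff ?gt_eqF// scale1r.
  have pE : p = sg *: e.
    rewrite /p /cost_grad -/v -/al /slope vE scalerA; congr (_ *: _).
    by rewrite /sg; have /andP[s0 _] := s01; field; rewrite !gt_eqF.
  have zE : z - y = g *: e.
    rewrite /z /flow_map pE scalerA arctanvZ// addrAC -/v vE -scalerDl.
    by [].
  exists e; split => //; first by rewrite zE enormZ e1 mulr1.
  by rewrite pE dotZl dotZr -sqr_enorm e1 expr1n mulr1 expr2.
have [e [pE zE nz pp]] := dirE; split.
- by rewrite enormBC nz.
- rewrite /cost nz; have -> : cos `|g| = cos g by case: ger0P; rewrite ?cosN.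
  by rewrite costE /flow_val /dil2 pp.
- rewrite /cost_grad nz zE /dil2 pp pE !scalerA; congr (_ *: _).
  have -> : slope `|g| = slope g.
    by rewrite /slope; case: ger0P => // _; rewrite sinN cosN invrN mulNr mulrNN.
  rewrite [RHS]mulrC -gradE -!mulrA; congr (_ * (_ * _)).
  have [->|g0] := eqVneq g 0; first by rewrite sin0 !mul0r.
  by rewrite mulVf// mulr1.
Qed.

End transport_optimal.

(** * Contact points *)

Section touching.
Context {R : realType} {d : nat}.
Implicit Types (f : 'cV[R]_d -> R) (x z w p q : 'cV[R]_d) (C : R).

(** Regularity left at a contact point by one-sided bounds of opposite signs;
    being global, it can be compared at different base points. *)
Definition touches f z p C := forall w,
  `|f w - f z - dot p (w - z)| <= C * enorm (w - z) ^+ 2.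

Let dot_linear p : linear (dot p).
Proof. by move=> c u v; rewrite dotDr dotZr. Qed.

HB.instance Definition _ p :=
  @GRing.isLinear.Build R 'cV[R]_d R _ (dot p) (dot_linear p).

Lemma touches_grad f z p C : 0 <= C -> touches f z p C -> grad f z = p.
Proof.
move=> C0 fp; suff dfE : 'd f z = dot p :> ('cV[R]_d -> R).
  apply/colP => i; rewrite /grad mxE dfE /dot (bigD1 i)//= big1 => [|j ji].
    by rewrite !mxE !eqxx mulr1 addr0.
  by rewrite !mxE (negbTE ji) mulr0.
apply: diff_unique.
  move=> v; apply/(@cvgrPdist_lt _ _ _ (nbhs v) _) => e e0.
  have [e1 e10 e1p] := exists_small_factor e0 (enorm_ge0 p).
  apply/nbhs_enormP; exists e1 => // u uv; rewrite -dotBr.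
  apply: le_lt_trans (normr_dot_le _ _) _.
  have [->|p0] := eqVneq p 0; first by rewrite enorm0 mul0r.
  apply: lt_le_trans e1p; rewrite mulrC ltr_pM2r ?enorm_gt0//.
  by rewrite enormBC.
apply/eqaddoP => e e0.
have M0 : 0 <= C * (d%:R ^+ 2) by rewrite mulr_ge0// sqr_ge0.
have [r r0 rM] := exists_small_factor e0 M0.
apply: (nbhs_normP (0 : 'cV[R]_d) _).2; exists r => // w /=.
rewrite sub0r normrN => wr.
have := fp (w + z); rewrite addrK /= !fctE /= opprD addrA => h.
apply: le_trans h _.
have : enorm w ^+ 2 <= (d%:R * `|w|) ^+ 2.
  by rewrite ler_sqr ?nnegrE ?mulr_ge0// enorm_le_norm.
move=> /(ler_wpM2l C0)/le_trans; apply.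
have -> : C * (d%:R * `|w|) ^+ 2 = `|w| * (C * d%:R ^+ 2) * `|w| by ring.
rewrite ler_wpM2r//; apply: le_trans rM.
by rewrite ler_wpM2r// ltW.
Qed.

(** Slopes of uniformly quadratic expansions are Lipschitz: compare the two
    expansions on a sphere centred at one of the points. *)
Lemma touches_lipschitz f C z z' p p' : 0 <= C ->
  touches f z p C -> touches f z' p' C ->
  enorm (p - p') <= 6 * C * enorm (z - z').
Proof.
move=> C0 fz fz'; set r := enorm (z - z').
have r0 : 0 <= r := enorm_ge0 _.
have [->|pp] := eqVneq p p'.
  by rewrite subrr enorm0 !mulr_ge0.
have q0 : 0 < enorm (p - p') by rewrite enorm_gt0// subr_eq0.
set q := p - p' in q0 *; set n := enorm q in q0 *.
pose w := z + (r / n) *: q.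
have wz : w - z = (r / n) *: q by rewrite /w addrC addKr.
have nwz : enorm (w - z) = r.
  by rewrite wz enormZ -/n ger0_norm ?divr_ge0 ?(ltW q0)// mulfVK ?gt_eqF.
have wz' : w - z' = (w - z) + (z - z') by rewrite subrKA.
have nwz' : enorm (w - z') <= 2 * r.
  by rewrite wz'; apply: le_trans (ler_enormD _ _) _; rewrite nwz -/r; lra.
have h1 := fz w; have h2 := fz' w; have h3 := fz' z.
rewrite nwz in h1; rewrite -/r in h3.
have {}h2 : `|f w - f z' - dot p' (w - z')| <= C * (4 * r ^+ 2).
  apply: le_trans h2 _; rewrite ler_wpM2l//.
  have -> : 4 * r ^+ 2 = (2 * r) ^+ 2 by ring.
  by rewrite ler_sqr ?nnegrE ?mulr_ge0.
have dE : dot q (w - z) = r * n.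
  by rewrite wz dotZr -sqr_enorm -/n; field; rewrite gt_eqF.
have E : r * n = (f w - f z' - dot p' (w - z')) - (f w - f z - dot p (w - z))
                  - (f z - f z' - dot p' (z - z')).
  by rewrite -dE /q dotBl wz' (dotDr (w - z)); ring.
have [r00|r00] := eqVneq r 0.
  have zz : z = z' by apply/eqP; rewrite -subr_eq0; apply/eqP/enorm_eq0.
  move: fz fz'; rewrite -zz => fz fz'.
  exfalso; move/eqP: pp; apply; apply/eqP; rewrite -subr_eq0 -/q; apply/eqP.
  apply: dot_eq0; apply/eqP; rewrite eq_le dot_ge0 andbT.
  apply: (@le0_small_factor _ _ (2 * C * dot q q)) => [|e /andP[e0 _]].
    by rewrite !mulr_ge0// dot_ge0.
  have k1 := fz (z + e *: q); have k2 := fz' (z + e *: q).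
  have zq : z + e *: q - z = e *: q by rewrite addrC addKr.
  rewrite zq enormZ (gtr0_norm e0) exprMn sqr_enorm dotZr in k1.
  rewrite zq enormZ (gtr0_norm e0) exprMn sqr_enorm dotZr in k2.
  rewrite -(ler_pM2l e0).
  have -> : e * dot q q = e * dot p q - e * dot p' q by rewrite -mulrBr -dotBl.
  move: k1 k2; rewrite !ler_norml => /andP[k1 k1'] /andP[k2 k2'].
  have -> : e * (e * (2 * C * dot q q)) =
    C * (e ^+ 2 * dot q q) + C * (e ^+ 2 * dot q q) by ring.
  lra.
have rp : 0 < r by rewrite lt_def r00.
rewrite -(ler_pM2l rp) -/n.
have -> : r * (6 * C * r) = C * (4 * r ^+ 2) + C * r ^+ 2 + C * r ^+ 2 by ring.
rewrite E; apply: le_trans (ler_norm _) _.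
apply: le_trans (ler_normB _ _) _; apply: lerD => //.
by apply: le_trans (ler_normB _ _) _; exact: lerD.
Qed.

End touching.

(** The inequality between the forward and the backward kernels: it is the
    arithmetic-geometric mean inequality combined with the addition formula for
    the cosine, [m n >= cos^2 (alpha + beta)] being the compatibility of the two
    data. *)
Lemma kernel_compatible {R : realType} (t m n al be : R) : 0 < t < 1 ->
  0 <= m -> 0 <= n -> 0 <= al < pi / 2 -> 0 <= be < pi / 2 ->
  (0 < cos (al + be) -> cos (al + be) ^+ 2 <= m * n) ->
  t * cos al ^+ 2 * (1 - t + t * n) + (1 - t) * cos be ^+ 2 * (t + (1 - t) * m)
  <= (t + (1 - t) * m) * (1 - t + t * n).
Proof.
move=> /andP[t0 t1] m0 n0 /andP[al0 alpi] /andP[be0 bepi] mn.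
have pi0 := @pi_gt0 R.
have ca0 : 0 <= cos al by rewrite cos_ge0_pihalf//; apply/andP; split; lra.
have cb0 : 0 <= cos be by rewrite cos_ge0_pihalf//; apply/andP; split; lra.
have sa0 : 0 <= sin al by rewrite sin_ge0_pi//; apply/andP; split; lra.
have sb0 : 0 <= sin be by rewrite sin_ge0_pi//; apply/andP; split; lra.
have sa2 : sin al ^+ 2 = 1 - cos al ^+ 2 by have := cos2Dsin2 al; lra.
have sb2 : sin be ^+ 2 = 1 - cos be ^+ 2 by have := cos2Dsin2 be; lra.
rewrite cosD in mn.
set ca := cos al in ca0 sa2 mn *; set cb := cos be in cb0 sb2 mn *.
set sa := sin al in sa0 sa2 mn; set sb := sin be in sb0 sb2 mn.
pose M := Num.sqrt m; pose N := Num.sqrt n.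
have M0 : 0 <= M by exact: sqrtr_ge0.
have N0 : 0 <= N by exact: sqrtr_ge0.
have ME : m = M ^+ 2 by rewrite sqr_sqrtr.
have NE : n = N ^+ 2 by rewrite sqr_sqrtr.
rewrite ME NE in mn *.
have kc : ca * cb <= M * N + sa * sb.
  rewrite -lerBlDr; have [c0|c0] := leP (ca * cb - sa * sb) 0.
    by apply: le_trans c0 _; rewrite mulr_ge0.
  rewrite -ler_sqr ?nnegrE ?mulr_ge0//; last exact: ltW.
  by rewrite exprMn mn.
have k2 : (ca * cb) ^+ 2 <= (M * N + sa * sb) ^+ 2.
  by rewrite ler_sqr ?nnegrE ?addr_ge0 ?mulr_ge0.
have s2 : (sa * sb) ^+ 2 = (1 - ca ^+ 2) * (1 - cb ^+ 2) by rewrite exprMn sa2 sb2.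
have t1' : 0 < t * (1 - t) by rewrite mulr_gt0// subr_gt0.
have sq := sqr_ge0 (t * N * sa - (1 - t) * M * sb).
rewrite -subr_ge0.
have -> : (t + (1 - t) * M ^+ 2) * (1 - t + t * N ^+ 2) -
    (t * ca ^+ 2 * (1 - t + t * N ^+ 2) +
     (1 - t) * cb ^+ 2 * (t + (1 - t) * M ^+ 2)) =
    (t * N * sa - (1 - t) * M * sb) ^+ 2 +
    t * (1 - t) * ((M * N + sa * sb) ^+ 2 - (ca * cb) ^+ 2).
  have -> : ca ^+ 2 = 1 - sa ^+ 2 by rewrite sa2; ring.
  have -> : cb ^+ 2 = 1 - sb ^+ 2 by rewrite sb2; ring.
  have -> : (ca * cb) ^+ 2 = (1 - sa ^+ 2) * (1 - sb ^+ 2).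
    by rewrite exprMn sa2 sb2; ring.
  by ring.
by rewrite addr_ge0// mulr_ge0 ?(ltW t1')// subr_ge0.
Qed.

Section contact.
Context {R : realType} {d : nat}.
Variables (xi0 xibar1 : 'cV[R]_d -> \bar R).
Hypotheses (xi0_ge : forall z, ((- 2^-1)%:E <= xi0 z)%E)
  (xi0_lsc : lower_semicontinuous xi0)
  (xibar1_ge : forall z, ((- 2^-1)%:E <= - xibar1 z)%E)
  (xibar1_lsc : lower_semicontinuous (fun z => (- xibar1 z)%E))
  (compatible : forall z, (xibar1 z <= hopf_laxP 1 xi0 z)%E).
Implicit Types (s t : R) (x y z w p : 'cV[R]_d).

Let f t := hl xi0 t.
Let g t := hl (fun z => (- xibar1 z)%E) (1 - t).

Let onem t : 0 < t < 1 -> 0 < 1 - t < 1.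
Proof. by move=> /andP[t0 t1]; rewrite subr_gt0 t1 ltrBlDr ltrDl. Qed.

Lemma hl_order t x : 0 < t < 1 -> - g t x <= f t x.
Proof.
move=> t01; have /andP[t0 t1] := t01; have t01' := onem t01.
have t1' : 0 < 1 - t by rewrite subr_gt0.
have [y xy fE] := hl_attained t01 xi0_ge x xi0_lsc.
have [z xz gE] := hl_attained t01' xibar1_ge x xibar1_lsc.
rewrite /f /g fE gE /cost.
set W := weight t _; set W' := weight _ _.
set ca := cos (enorm (x - z)); set cb := cos (enorm (x - y)).
suff key : t * (ca ^+ 2 * W') + (1 - t) * (cb ^+ 2 * W) <= 1.
  rewrite -subr_ge0.
  have -> : (2 * t)^-1 * (1 - cb ^+ 2 * W) - - ((2 * (1 - t))^-1 * (1 - ca ^+ 2 * W')) =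
    (2 * t * (1 - t))^-1 * (1 - (t * (ca ^+ 2 * W') + (1 - t) * (cb ^+ 2 * W))).
    by field; rewrite !gt_eqF.
  by rewrite mulr_ge0 ?subr_ge0// invr_ge0 !mulr_ge0// ltW.
have cos_le1' (u : R) : cos u ^+ 2 <= 1.
  by have := cos2Dsin2 u; have := sqr_ge0 (sin u); lra.
have W0 : 0 <= W by exact: weight_ge0.
have W'0 : 0 <= W' by exact: weight_ge0.
have W1 : W * (1 - t) <= 1 by exact: weight_le.
have W'1 : W' * t <= 1.
  by have := weight_le t01' (xibar1_ge z); rewrite subKr.
have trivial_f : W = 0 -> t * (ca ^+ 2 * W') + (1 - t) * (cb ^+ 2 * W) <= 1.
  move=> ->; rewrite !mulr0 addr0 mulrCA (mulrC t).
  by apply: le_trans W'1; apply: ler_piMl; [rewrite mulr_ge0// ltW|exact: cos_le1'].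
have trivial_g : W' = 0 -> t * (ca ^+ 2 * W') + (1 - t) * (cb ^+ 2 * W) <= 1.
  move=> ->; rewrite !mulr0 add0r mulrCA (mulrC (1 - t)).
  by apply: le_trans W1; apply: ler_piMl; [rewrite mulr_ge0// ltW|exact: cos_le1'].
have := xi0_ge y; have := xibar1_ge z.
case ye : (xi0 y) => [eta||]//; last first.
  by move=> _ _; apply: trivial_f; rewrite /W ye (weight_pinfty t01).1.
case ze : (- xibar1 z)%E => [zeta||]//; last first.
  by move=> _ _; apply: trivial_g; rewrite /W' ze (weight_pinfty t01').1.
rewrite !lee_fin => zeta1 eta1.
have [Wd WE _] := weight_fin t01 eta1; have [W'd W'E _] := weight_fin t01' zeta1.
pose n := 1 + 2 * eta; pose m := 1 + 2 * zeta.
have n0 : 0 <= n by rewrite /n; lra.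
have m0 : 0 <= m by rewrite /m; lra.
have mn : enorm (y - z) < pi / 2 -> cos (enorm (z - y)) ^+ 2 <= m * n.
  move=> yz; set c := cos (enorm (z - y)).
  have c0 : 0 < c.
    rewrite cos_gt0_pihalf// enormBC yz andbT.
    by apply: lt_le_trans (enorm_ge0 _); rewrite oppr_lt0 divr_gt0// pi_gt0.
  have xz1 : xibar1 z = (- zeta)%:E by rewrite -[xibar1 z]oppeK ze.
  have := compatible z; rewrite xz1 /hopf_laxP oner_eq0 mulr1.
  have : (ereal_inf [set ((2 : R)^-1%:E *
      (1 - (cos (enorm (z - y)) ^+ 2)%:E / (1 + (2 : R)%:E * xi0 y)))%E
      | y in [set y | (enorm (y - z) < pi / 2)%R]] <=
      (2^-1)%:E * (1 - (c ^+ 2)%:E / (1 + 2%:E * xi0 y)))%E.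
    by apply: ereal_inf_lbound; exists y.
  move=> h1 h2; have {h1 h2} := le_trans h2 h1.
  rewrite ye -EFinM -EFinD -/n inver; case: ifPn => [n00|n00].
    rewrite gt0_muley ?lte_fin ?exprn_gt0//= mulrNy.
    by rewrite gtr0_sg ?invr_gt0// mul1e.
  have n_gt0 : 0 < n by rewrite lt_def n00.
  rewrite (_ : _ * _ = (2^-1 * (1 - c ^+ 2 / n))%:E)%E// lee_fin => h.
  rewrite -ler_pdivrMr//.
  by rewrite /m; lra.
have al_pi : 0 <= enorm (x - z) < pi / 2 by rewrite enorm_ge0 enormBC.
have be_pi : 0 <= enorm (x - y) < pi / 2 by rewrite enorm_ge0 enormBC.
have cc : 0 < cos (enorm (x - z) + enorm (x - y)) ->
    cos (enorm (x - z) + enorm (x - y)) ^+ 2 <= m * n.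
  move=> c0; have pi0 := @pi_gt0 R.
  move/andP: al_pi => [a0 api]; move/andP: be_pi => [b0 bpi].
  have sum_lt : enorm (x - z) + enorm (x - y) < pi / 2.
    rewrite ltNge; apply/negP => h.
    have : cos (enorm (x - z) + enorm (x - y)) <= cos (pi / 2) by apply: le_cos; lra.
    by rewrite cos_pihalf leNgt c0.
  have tri : enorm (z - y) <= enorm (x - z) + enorm (x - y).
    by rewrite (enormBC x z); exact: ler_distD.
  have yz : enorm (y - z) < pi / 2 by rewrite enormBC; exact: le_lt_trans sum_lt.
  apply: le_trans (mn yz); rewrite ler_sqr ?nnegrE; last 2 first.
  - exact: ltW.
  - rewrite cos_ge0_pihalf// (enormBC z y) ltW//= ?andbT; last first.
      by apply: lt_le_trans (enorm_ge0 _); rewrite oppr_lt0 divr_gt0.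
    by rewrite ltW.
  by apply: le_cos => //; lra.
have := kernel_compatible t01 m0 n0 al_pi be_pi cc.
have BE : 1 - t + t * n = 1 + 2 * t * eta by rewrite /n; ring.
have AE : t + (1 - t) * m = 1 + 2 * (1 - t) * zeta by rewrite /m; ring.
rewrite BE AE /W /W' ye ze WE W'E -/ca -/cb => h.
have P0 := mulr_gt0 W'd Wd; rewrite -(ler_pM2r P0) mul1r; apply: le_trans h.
rewrite le_eqVlt; apply/orP; left; apply/eqP; field.
by rewrite !gt_eqF.
Qed.

(** Curvature constant of the value functions at time [t]. *)
Definition curv t : R := (2 * t * (1 - t))^-1.

Lemma curv_ge0 t : 0 < t < 1 -> 0 <= curv t.
Proof. by case/andP=> t0 t1; rewrite invr_ge0 !mulr_ge0 ?subr_ge0// ltW. Qed.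

(** At a contact point the function below and the function above share their
    slope, and inherit each other's one-sided quadratic bounds. *)
Lemma contact_touches t z y y' : 0 < t < 1 -> f t z = - g t z ->
  optimal xi0 t z y -> optimal (fun w => (- xibar1 w)%E) (1 - t) z y' ->
  touches (f t) z (cost_grad xi0 t z y) (curv t) /\
  cost_grad (fun w => (- xibar1 w)%E) (1 - t) z y' = - cost_grad xi0 t z y.
Proof.
move=> t01 fg oy oy'; have t01' := onem t01.
set p := cost_grad xi0 t z y; set p' := cost_grad _ _ z y'.
have C0 := curv_ge0 t01.
have up w : f t w <= f t z + dot p (w - z) + curv t * enorm (w - z) ^+ 2.
  exact: (hl_semiconcave xi0_ge w t01 oy).
have lo w : g t w <= g t z + dot p' (w - z) + curv t * enorm (w - z) ^+ 2.
  have := hl_semiconcave xibar1_ge w t01' oy'; rewrite -/p' subKr.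
  by rewrite /curv [2 * (1 - t) * t]mulrAC.
have pE : p' = - p.
  apply/eqP; rewrite eq_sym -subr_eq0; apply/eqP; set q := - p - p'.
  apply: dot_eq0; apply/eqP; rewrite eq_le dot_ge0 andbT.
  apply: (@le0_small_factor _ _ (2 * curv t * dot q q)) => [|e /andP[e0 _]].
    by rewrite !mulr_ge0// dot_ge0.
  have h1 := up (z + e *: q); have h2 := lo (z + e *: q).
  have h3 := hl_order (z + e *: q) t01.
  have zq : z + e *: q - z = e *: q by rewrite addrC addKr.
  rewrite zq enormZ (gtr0_norm e0) exprMn sqr_enorm dotZr in h1.
  rewrite zq enormZ (gtr0_norm e0) exprMn sqr_enorm dotZr in h2.
  rewrite -(ler_pM2l e0).
  have -> : e * dot q q = - (e * dot p q) - e * dot p' q.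
    by rewrite {1}/q dotBl dotNl; ring.
  have -> : e * (e * (2 * curv t * dot q q)) =
    curv t * (e ^+ 2 * dot q q) + curv t * (e ^+ 2 * dot q q) by ring.
  rewrite fg in h1; lra.
split => // w; have h1 := up w; have h2 := lo w; have h3 := hl_order w t01.
rewrite pE dotNl in h2; rewrite ler_norml; apply/andP; split; lra.
Qed.

(** The flow maps contact points to contact points: along it the upper and the
    lower bounds for the two functions, transported from their optimal points,
    coincide. *)
Lemma contact_flow s z : 0 < s < 1 -> f s z = - g s z ->
  exists2 p, touches (f s) z p (curv s) &
  forall t, 0 < t < 1 ->
  let u := f s z in
  let T := flow_map u (t - s) p z in
  [/\ f t T = - g t T, f t T = flow_val u (t - s) p &
      touches (f t) T ((dil2 u (t - s) p)^-1 *: p) (curv t)].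
Proof.
move=> s01 fg; have s01' := onem s01.
have [y zy fE] := hl_attained s01 xi0_ge z xi0_lsc.
have [y' zy' gE] := hl_attained s01' xibar1_ge z xibar1_lsc.
have oy : optimal xi0 s z y by [].
have oy' : optimal (fun w => (- xibar1 w)%E) (1 - s) z y' by [].
have [touch_s p'E] := contact_touches s01 fg oy oy'.
set p := cost_grad xi0 s z y in touch_s p'E *.
exists p => // t t01 u T; have t01' := onem t01.
have [yT cT gT] := transport_cost xi0_ge s01 t01 oy.
have [yT' cT' gT'] := transport_cost xibar1_ge s01' t01' oy'.
have gu : hl (fun w => (- xibar1 w)%E) (1 - s) z = - u.
  by rewrite /u fg opprK.
have tau' : 1 - t - (1 - s) = - (t - s) by ring.
rewrite -/p -/(f s) -/u -/T in yT cT gT.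
rewrite gu p'E tau' in yT' cT' gT'.
have affE : 1 + 2 * - (t - s) * - u = 1 + 2 * (t - s) * u by ring.
have dilE : dil2 (- u) (- (t - s)) (- p) = dil2 u (t - s) p.
  by rewrite /dil2 affE sqrrN dotNl dotNr opprK.
have TE : flow_map (- u) (- (t - s)) (- p) z = T.
  rewrite /T /flow_map affE; congr (_ + arctanv _).
  by rewrite scalerN mulNr scaleNr opprK.
have valE : flow_val (- u) (- (t - s)) (- p) = - flow_val u (t - s) p.
  rewrite /flow_val affE dilE dotNl dotNr opprK -mulNr; congr (_ / _); ring.
rewrite TE in yT' cT' gT'; rewrite valE in cT'.
have up : f t T <= flow_val u (t - s) p.
  by rewrite -cT; exact: (hl_le_cost t01 xi0_ge yT).
have lo : g t T <= - flow_val u (t - s) p.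
  by rewrite -cT'; exact: (hl_le_cost t01' xibar1_ge yT').
have mid := hl_order T t01.
have fT : f t T = flow_val u (t - s) p by apply/eqP; rewrite eq_le up/=; lra.
have gTE : g t T = - flow_val u (t - s) p by apply/eqP; rewrite eq_le lo/=; lra.
have contT : f t T = - g t T by rewrite fT gTE opprK.
split => //; rewrite -gT.
have oT : optimal xi0 t T y by split => //; rewrite cT.
have oT' : optimal (fun w => (- xibar1 w)%E) (1 - t) T y' by split => //; rewrite cT'.
by have [] := contact_touches t01 contT oT oT'.
Qed.

End contact.

(** * Derivatives of matrix-valued functions *)

Section matrix_derivative.
Context {R : realType}.
Implicit Types (t : R).

Lemma is_derive_ext (V : normedModType R) (f g : R -> V) t (df dg : V) :
  (forall r, f r = g r) -> df = dg -> is_derive t 1 f df -> is_derive t 1 g dg.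
Proof. by move=> /funext -> ->. Qed.

Lemma is_derive_mul (f g : R -> R) t (df dg : R) :
  is_derive t 1 f df -> is_derive t 1 g dg ->
  is_derive t 1 (fun r => f r * g r) (df * g t + f t * dg).
Proof.
move=> hf hg; apply: is_derive_ext (is_deriveM hf hg) => //.
by rewrite /GRing.scale /= addrC mulrC.
Qed.

Lemma is_derive_add (V : normedModType R) (f g : R -> V) t df dg :
  is_derive t 1 f df -> is_derive t 1 g dg ->
  is_derive t 1 (fun r => f r + g r) (df + dg).
Proof. by move=> hf hg; exact: is_deriveD. Qed.

Lemma is_derive_sub (V : normedModType R) (f g : R -> V) t df dg :
  is_derive t 1 f df -> is_derive t 1 g dg ->
  is_derive t 1 (fun r => f r - g r) (df - dg).
Proof. by move=> hf hg; exact: is_deriveB. Qed.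

Lemma is_derive_scale (f : R -> R) t (c df : R) :
  is_derive t 1 f df -> is_derive t 1 (fun r => c * f r) (c * df).
Proof.
move=> hf; apply: is_derive_ext (is_derive_mul (is_derive_cst c t 1) hf) => //.
by rewrite mul0r add0r.
Qed.

Lemma is_derive_bigsum I (s : seq I) (P : pred I) (f : I -> R -> R) t
    (df : I -> R) : (forall i, P i -> is_derive t 1 (f i) (df i)) ->
  is_derive t 1 (fun r => \sum_(i <- s | P i) f i r) (\sum_(i <- s | P i) df i).
Proof.
move=> fd; elim: s => [|i s IH].
  by apply: is_derive_ext (is_derive_cst 0 t 1) => [r|]; rewrite big_nil.
have [Pi|Pi] := boolP (P i); last first.
  by apply: is_derive_ext IH => [r|]; rewrite [in RHS]big_cons (negbTE Pi).
apply: is_derive_ext (is_derive_add (fd i Pi) IH) => [r|]; last by rewrite big_cons Pi.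
by rewrite big_cons Pi.
Qed.

Lemma is_derive_bigprod n (f : 'I_n -> R -> R) t (df : 'I_n -> R) :
  (forall i, is_derive t 1 (f i) (df i)) ->
  is_derive t 1 (fun r => \prod_i f i r)
    (\sum_i df i * \prod_(j | i != j) f j t).
Proof.
elim: n f df => [|n IH] f df fd.
  apply: is_derive_ext (is_derive_cst (1 : R) t 1) => [r|]; first by rewrite big_ord0.
  by rewrite big_ord0.
have h := is_derive_mul (fd ord0) (IH _ _ (fun i => fd (lift ord0 i))).
apply: is_derive_ext h => [r|]; first by rewrite big_ord_recl.
rewrite [RHS]big_ord_recl; congr (_ + _).
  congr (_ * _); rewrite [RHS]big_mkcond big_ord_recl eqxx /= mul1r.
  by apply: eq_bigr.
rewrite mulr_sumr; apply: eq_bigr => i _; rewrite mulrCA; congr (_ * _).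
rewrite [RHS]big_mkcond big_ord_recl /= -big_mkcond; congr (_ * _).
Qed.

Lemma is_derive_mx m n (F : R -> 'M[R]_(m, n)) t (D : 'M[R]_(m, n)) :
  (forall i j, is_derive t 1 (fun r => F r i j) (D i j)) -> is_derive t 1 F D.
Proof.
move=> FD; have dF : derivable F t 1.
  by apply/derivable_mxP => i j; have [] := FD i j.
split => //; rewrite derive_mx//; apply/matrixP => i j; rewrite mxE.
by have [] := FD i j.
Qed.

Lemma is_derive_entry m n (F : R -> 'M[R]_(m, n)) t (D : 'M[R]_(m, n)) i j :
  is_derive t 1 F D -> is_derive t 1 (fun r => F r i j) (D i j).
Proof.
move=> [dF <-]; rewrite derive_mx// mxE.
by apply: derivableP; exact: (derivable_mxP _ _ _).1.
Qed.

Lemma is_derive_mulmx m n l (F : R -> 'M[R]_(m, n)) (G : R -> 'M[R]_(n, l)) t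
    F' G' : is_derive t 1 F F' -> is_derive t 1 G G' ->
  is_derive t 1 (fun r => F r *m G r) (F' *m G t + F t *m G').
Proof.
move=> hF hG; apply: is_derive_mx => i j.
have h k := is_derive_mul (is_derive_entry i k hF) (is_derive_entry k j hG).
apply: is_derive_ext (is_derive_bigsum (index_enum _) (fun k _ => h k)) => [r|].
  by rewrite mxE.
by rewrite !mxE -big_split.
Qed.

Lemma is_derive_scalemx m n (f : R -> R) (A : 'M[R]_(m, n)) t df :
  is_derive t 1 f df -> is_derive t 1 (fun r => f r *: A) (df *: A).
Proof.
move=> hf; apply: is_derive_mx => i j.
apply: is_derive_ext (is_derive_scale (A i j) hf) => [r|].
  by rewrite !mxE mulrC.
by rewrite !mxE mulrC.
Qed.

Lemma is_derive_trace n (F : R -> 'M[R]_n) t F' :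
  is_derive t 1 F F' -> is_derive t 1 (fun r => \tr (F r)) (\tr F').
Proof. by move=> hF; apply: is_derive_bigsum => i _; exact: is_derive_entry. Qed.

(** Jacobi's formula: differentiate the Leibniz expansion and collect the terms
    containing a given entry into its cofactor. *)
Lemma is_derive_det n (F : R -> 'M[R]_n) t F' : is_derive t 1 F F' ->
  is_derive t 1 (fun r => \det (F r)) (\tr (F' *m \adj (F t))).
Proof.
move=> hF.
have h (s : 'S_n) := is_derive_scale ((-1) ^+ (odd_perm s))
  (is_derive_bigprod (fun i => is_derive_entry i (s i) hF)).
apply: is_derive_ext (is_derive_bigsum (index_enum _) (fun s _ => h s)) => //.
rewrite /mxtrace; under eq_bigr do rewrite mulr_sumr.
rewrite exchange_big; apply: eq_bigr => k _; rewrite mxE.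
rewrite (partition_big (fun s : 'S_n => s k) xpredT)//; apply: eq_bigr => j _.
rewrite mxE expand_cofactor mulr_sumr; apply: eq_bigr => s /eqP <-.
by rewrite mulrCA.
Qed.

(** The adjugate is differentiable, its entries being determinants of minors. *)
Lemma derivable_adj n (F : R -> 'M[R]_n) t F' : is_derive t 1 F F' ->
  exists A', is_derive t 1 (fun r => \adj (F r)) A'.
Proof.
move=> hF.
have h i j : exists d, is_derive t 1 (fun r => \adj (F r) i j) d.
  have hm : is_derive t 1 (fun r => row' j (col' i (F r))) (row' j (col' i F')).
    apply: is_derive_mx => k l.
    apply: is_derive_ext (is_derive_entry (lift j k) (lift i l) hF) => [r|];
      by rewrite !mxE.
  have hd := is_derive_scale ((-1) ^+ (j + i)) (is_derive_det hm).
  by eexists; apply: is_derive_ext hd => // r; rewrite mxE.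
exists (\matrix_(i, j) 'D_1 (fun r => \adj (F r) i j) t).
apply: is_derive_mx => i j; rewrite mxE; have [d [hd _]] := h i j.
exact: derivableP.
Qed.

Lemma is_derive_det_linear n (B : R -> 'M[R]_n) t (N : 'M[R]_n) :
  is_derive t 1 B (N *m B t) ->
  is_derive t 1 (fun r => \det (B r)) (\tr N * \det (B t)).
Proof.
move=> hB; apply: is_derive_ext (is_derive_det hB) => //.
by rewrite -mulmxA mul_mx_adj mul_mx_scalar linearZ mulrC.
Qed.

(** Second derivative of the determinant when [B' = M = N B] and [M' = D B].  The
    derivative of the adjugate, read off [B (adj B) = (det B) I], replaces that of
    [N]. *)
Lemma is_derive2_det n (B M : R -> 'M[R]_n) t (N D : 'M[R]_n) :
  B t \in unitmx -> is_derive t 1 B (M t) -> M t = N *m B t ->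
  is_derive t 1 M (D *m B t) ->
  is_derive t 1 (fun r => \tr (M r *m \adj (B r)))
    ((\tr D + \tr N ^+ 2 - \tr (N *m N)) * \det (B t)).
Proof.
move=> Bu hB ME hM; have [A' hA] := derivable_adj hB.
have hd : is_derive t 1 (fun r => \det (B r)) (\tr N * \det (B t)).
  by apply: is_derive_det_linear; rewrite -ME.
have BA' : M t *m \adj (B t) + B t *m A' = (\tr N * \det (B t))%:M.
  have h1 := is_derive_mulmx hB hA.
  have h2 : is_derive t 1 (fun r => B r *m \adj (B r)) (\tr N * \det (B t))%:M.
    apply: is_derive_mx => i j; rewrite !mxE.
    have := is_derive_scale ((i == j)%:R) hd; apply: is_derive_ext => [r|].
      by rewrite mul_mx_adj mxE mulr_natl.
    by rewrite mulr_natl.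
  by have [_ <-] := h1; have [_ <-] := h2.
have NA : N *m B t *m \adj (B t) = \det (B t) *: N.
  by rewrite -mulmxA mul_mx_adj mul_mx_scalar.
apply: is_derive_ext (is_derive_trace (is_derive_mulmx hM hA)) => //.
have -> : M t *m A' = (\tr N * \det (B t)) *: N - \det (B t) *: (N *m N).
  have -> : M t *m A' = N *m (B t *m A') by rewrite ME mulmxA.
  have -> : B t *m A' = (\tr N * \det (B t))%:M - M t *m \adj (B t).
    by rewrite -BA' addrC addKr.
  by rewrite ME NA mulmxBr mul_mx_scalar -scalemxAr.
rewrite -mulmxA mul_mx_adj mul_mx_scalar linearD /= linearB /= !linearZ /=.
by rewrite /GRing.scale /=; ring.
Qed.

End matrix_derivative.

(** * Evolution of the flow and of its differential in time *)

Section time_evolution.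
Context {R : realType} {d : nat}.
Variables (u : R) (p : 'cV[R]_d) (H : 'M[R]_d).
Implicit Types (tau : R) (x : 'cV[R]_d).

Let aff tau := 1 + 2 * tau * u.
Let Q tau := dil2 u tau p.
Let val tau := flow_val u tau p.
(** The flow moves along [p] by [angle]; this is the integral of the inverse of
    [dil2], which is why the formula has to be completed by its limit at
    [p = 0]. *)
Definition angle tau : R :=
  if enorm p == 0 then tau / aff tau
  else atan (tau * enorm p / aff tau) / enorm p.

Lemma arctanv_angle tau : arctanv ((tau / aff tau) *: p) = angle tau *: p.
Proof.
rewrite /angle; case: eqP => [/enorm_eq0 -> | /eqP p0].
  by rewrite !scaler0 arctanv0.
have e1 : enorm ((enorm p)^-1 *: p) = 1.
  by rewrite enormZ ger0_norm ?invr_ge0// mulVf.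
have {1}-> : p = enorm p *: ((enorm p)^-1 *: p) by rewrite scalerA divff// scale1r.
by rewrite scalerA arctanvZ// scalerA mulrAC.
Qed.

Lemma flow_mapE tau x : flow_map u tau p x = x + angle tau *: p.
Proof. by rewrite /flow_map arctanv_angle. Qed.

Lemma angle0 : angle 0 = 0.
Proof. by rewrite /angle !mul0r atan0 mul0r if_same. Qed.

Let is_derive_aff tau : is_derive tau 1 aff (2 * u).
Proof. by apply: is_derive_eq; rewrite /GRing.scale /=; ring. Qed.

Let is_derive_inv_aff tau : aff tau != 0 ->
  is_derive tau 1 (fun r => (aff r)^-1) (- (2 * u) / aff tau ^+ 2).
Proof.
move=> a0; apply: is_derive_ext (is_deriveV a0 (is_derive_aff tau)) => //.
by rewrite /GRing.scale /=; field.
Qed.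

Lemma is_derive_angle tau : aff tau != 0 -> is_derive tau 1 angle (Q tau)^-1.
Proof.
move=> a0; rewrite /angle; have [p0|p0] := eqVneq (enorm p) 0.
  have := is_derive_mul (is_derive_id tau 1) (is_derive_inv_aff a0).
  apply: is_derive_ext => //; rewrite /Q /dil2 -sqr_enorm p0 -/(aff tau).
  have -> : aff tau ^+ 2 + tau ^+ 2 * 0 ^+ 2 = aff tau ^+ 2 by ring.
  rewrite -[X in X = _](mulfK (expf_neq0 2 a0)) -[RHS]mul1r; congr (_ / _).
  have -> : (1 / aff tau + tau * (- (2 * u) / aff tau ^+ 2)) * aff tau ^+ 2 =
    aff tau - 2 * tau * u by field.
  by rewrite /aff; ring.
have h := is_derive_mul (is_derive_mul (is_derive_id tau 1)
  (is_derive_cst (enorm p) tau 1)) (is_derive_inv_aff a0).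
have h2 := @is_derive1_comp _ atan (fun r => r * enorm p / aff r) tau _ _
  (is_derive1_atan (tau * enorm p / aff tau)) h.
have h3 := is_derive_mul h2 (is_derive_cst (enorm p)^-1 tau 1).
apply: is_derive_ext h3 => //; rewrite /= /cst /=.
rewrite /Q /dil2 -sqr_enorm -/(aff tau).
have q0 : aff tau ^+ 2 + tau ^+ 2 * enorm p ^+ 2 != 0.
  have h0 : 0 < aff tau ^+ 2 by rewrite lt_def sqr_ge0 expf_neq0.
  have h1 : 0 <= tau ^+ 2 * enorm p ^+ 2 by rewrite -exprMn sqr_ge0.
  by rewrite gt_eqF// ltr_pwDl.
have -> : (1 * enorm p + tau * 0) / aff tau +
    tau * enorm p * (- (2 * u) / aff tau ^+ 2) =
    enorm p / aff tau ^+ 2 * (aff tau - 2 * tau * u) by field.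
have -> : aff tau - 2 * tau * u = 1 by rewrite /aff; ring.
by field; rewrite exprMn q0 p0 a0.
Qed.

Let Q_gt0 tau : aff tau != 0 -> 0 < Q tau.
Proof.
move=> a0; have h0 : 0 < aff tau ^+ 2 by rewrite lt_def sqr_ge0 expf_neq0.
have h1 : 0 <= tau ^+ 2 * dot p p by rewrite -sqr_enorm -exprMn sqr_ge0.
by rewrite /Q /dil2 ltr_pwDl.
Qed.

Let Q_neq0 tau : aff tau != 0 -> Q tau != 0.
Proof. by move=> a0; rewrite gt_eqF// Q_gt0. Qed.

Let is_derive_Q tau : aff tau != 0 -> is_derive tau 1 Q (4 * val tau * Q tau).
Proof.
move=> a0; have q0 := Q_neq0 a0.
have -> : 4 * val tau * Q tau = 4 * u * aff tau + 2 * tau * dot p p.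
  by rewrite /val /flow_val -/(Q tau) -/(aff tau); field.
have h := is_derive_mul (is_derive_aff tau) (is_derive_aff tau).
have h2 := is_derive_mul (is_derive_mul (is_derive_id tau 1) (is_derive_id tau 1))
  (is_derive_cst (dot p p) tau 1).
by apply: is_derive_ext (is_derive_add h h2) => [r|];
  rewrite /= /cst ?/Q ?/dil2 ?/aff; ring.
Qed.

Let is_derive_invQ tau : aff tau != 0 ->
  is_derive tau 1 (fun r => (Q r)^-1) (- 4 * val tau / Q tau).
Proof.
move=> a0; have q0 := Q_neq0 a0.
apply: is_derive_ext (is_deriveV q0 (is_derive_Q a0)) => //.
by rewrite /GRing.scale /=; field.
Qed.

Lemma is_derive_flow_map tau x : aff tau != 0 ->
  is_derive tau 1 (fun r => flow_map u r p x) ((dil2 u tau p)^-1 *: p).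
Proof.
move=> a0; have h := is_derive_scalemx p (is_derive_angle a0).
apply: is_derive_ext (is_derive_add (is_derive_cst x tau 1) h) => [r|].
  by rewrite flow_mapE.
by rewrite add0r.
Qed.

Lemma is_derive_velocity tau : aff tau != 0 ->
  is_derive tau 1 (fun r => (dil2 u r p)^-1 *: p)
    (- 4 * flow_val u tau p *: ((dil2 u tau p)^-1 *: p)).
Proof.
move=> a0; apply: is_derive_ext (is_derive_scalemx p (is_derive_invQ a0)) => //.
by rewrite scalerA.
Qed.

Lemma is_derive_dilation tau : aff tau != 0 ->
  is_derive tau 1 (fun r => Num.sqrt (dil2 u r p))
    (2 * flow_val u tau p * Num.sqrt (dil2 u tau p)).
Proof.
move=> a0; have q0 := Q_gt0 a0.
have h := @is_derive1_comp _ Num.sqrt Q tau _ _ (is_derive1_sqrt q0) (is_derive_Q a0).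
apply: is_derive_ext h => //; rewrite -/(Q tau) -/(val tau).
rewrite -{2}[Q tau]sqr_sqrtr ?ltW//.
have s0 : Num.sqrt (Q tau) != 0 by rewrite gt_eqF// sqrtr_gt0.
by field.
Qed.

(** With [v] the value along the flow and [q] the dilation, [q' = 2 v q] gives
    [q'' = (2 v' + 4 v^2) q], and the bracket is the squared speed. *)
Lemma is_derive_dilation_rate tau : aff tau != 0 ->
  is_derive tau 1 (fun r => 2 * flow_val u r p * Num.sqrt (dil2 u r p))
    (dot p p / dil2 u tau p ^+ 2 * Num.sqrt (dil2 u tau p)).
Proof.
move=> a0; have q0 := Q_neq0 a0.
have h1 : is_derive tau 1 (fun r => 2 * u * aff r + r * dot p p)
    (4 * u ^+ 2 + dot p p).
  have k1 := is_derive_scale (2 * u) (is_derive_aff tau).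
  have k2 := is_derive_mul (is_derive_id tau 1) (is_derive_cst (dot p p) tau 1).
  by apply: is_derive_ext (is_derive_add k1 k2) => //; rewrite /cst /=; ring.
have h2 := is_derive_mul (is_derive_mul h1 (is_derive_invQ a0)) (is_derive_dilation a0).
apply: is_derive_ext h2 => [r|]; rewrite -?/(Q _) -?/(val _).
  rewrite /val /flow_val -/(Q r) invfM; rewrite -/(aff r).
  by move: (Num.sqrt _) (Q r)^-1 => w iq; field.
set w := Num.sqrt _.
have valE : 2 * u * aff tau + tau * dot p p = 2 * val tau * Q tau.
  by rewrite /val /flow_val -/(Q tau) -/(aff tau); field.
rewrite valE.
have -> : dot p p / Q tau ^+ 2 =
    (4 * u ^+ 2 + dot p p) / Q tau - 4 * val tau ^+ 2.
  apply: (mulIf (expf_neq0 2 q0)); rewrite mulfVK ?expf_neq0//.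
  have -> : ((4 * u ^+ 2 + dot p p) / Q tau - 4 * val tau ^+ 2) * Q tau ^+ 2 =
      (4 * u ^+ 2 + dot p p) * Q tau - (2 * val tau * Q tau) ^+ 2 by field.
  by rewrite -valE /Q /dil2 /aff; ring.
by field.
Qed.

(** Twice the derivative of [angle] with respect to the squared norm of [p], when
    [p] is not zero; when [p] is zero, the term that it multiplies vanishes. *)
Definition bend tau : R :=
  if enorm p == 0 then 0
  else (tau * aff tau / Q tau - angle tau) / enorm p ^+ 2.

(** The differential in space of the flow at a point of value [u], slope [p] and
    relative Hessian [H]. *)
Definition flow_diff tau : 'M[R]_d :=
  1%:M + angle tau *: H + bend tau *: (p *m p^T *m H)
  - (2 * tau ^+ 2 / dil2 u tau p) *: (p *m p^T).

(** The differential in space of the velocity [p / dil2]; it is also the time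
    derivative of [flow_diff]. *)
Definition velocity_diff tau : 'M[R]_d :=
  (dil2 u tau p)^-1 *: H
  - (4 * tau * (1 + 2 * tau * u) / dil2 u tau p ^+ 2) *: (p *m p^T)
  - (2 * tau ^+ 2 / dil2 u tau p ^+ 2) *: (p *m p^T *m H).

Lemma flow_diff0 : flow_diff 0 = 1%:M.
Proof.
have b0 : bend 0 = 0.
  by rewrite /bend angle0 !mul0r subrr mul0r if_same.
by rewrite /flow_diff angle0 b0 expr0n mulr0 mul0r !scale0r !addr0 subr0.
Qed.

Let is_derive_bend tau : aff tau != 0 -> enorm p != 0 ->
  is_derive tau 1 bend (- (2 * tau ^+ 2 / Q tau ^+ 2)).
Proof.
move=> a0 p0; rewrite /bend (negbTE p0); have q0 := Q_neq0 a0.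
have h1 := is_derive_mul (is_derive_mul (is_derive_id tau 1) (is_derive_aff tau))
  (is_derive_invQ a0).
have h2 := is_derive_mul (is_derive_sub h1 (is_derive_angle a0))
  (is_derive_cst (enorm p ^+ 2)^-1 tau 1).
apply: is_derive_ext h2 => //; rewrite /= /cst /= mulr0 addr0 !mul1r.
have s0 : dot p p != 0 by rewrite -sqr_enorm expf_neq0.
rewrite sqr_enorm; apply: (mulIf s0); rewrite mulfVK//.
apply: (mulIf (expf_neq0 2 q0)).
have -> : - (2 * tau ^+ 2 / Q tau ^+ 2) * dot p p * Q tau ^+ 2 =
  - (2 * tau ^+ 2 * dot p p) by field.
have -> : ((aff tau + tau * (2 * u)) / Q tau +
    tau * aff tau * (- 4 * val tau / Q tau) - (Q tau)^-1) * Q tau ^+ 2 =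
  (aff tau + tau * (2 * u) - 1) * Q tau - tau * aff tau * (4 * val tau * Q tau).
  by field.
have -> : 4 * val tau * Q tau = 4 * u * aff tau + 2 * tau * dot p p.
  by rewrite /val /flow_val -/(Q tau) -/(aff tau); field.
by rewrite /Q /dil2 /aff; ring.
Qed.

Lemma is_derive_flow_diff tau : aff tau != 0 ->
  is_derive tau 1 flow_diff (velocity_diff tau).
Proof.
move=> a0; have q0 := Q_neq0 a0.
have hb : is_derive tau 1 (fun r => bend r *: (p *m p^T *m H))
    (- (2 * tau ^+ 2 / Q tau ^+ 2) *: (p *m p^T *m H)).
  have [/enorm_eq0 p0|p0] := eqVneq (enorm p) 0.
    have P0 : p *m p^T *m H = 0 by rewrite p0 !mul0mx.
    apply: is_derive_ext (is_derive_cst (0 : 'M[R]_d) tau 1) => [r|];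
      by rewrite P0 scaler0.
  exact: is_derive_scalemx (is_derive_bend a0 p0).
have hd : is_derive tau 1 (fun r => 2 * r ^+ 2 / Q r)
    (4 * tau * aff tau / Q tau ^+ 2).
  have h1 := is_derive_mul (is_derive_scale 2
    (is_derive_mul (is_derive_id tau 1) (is_derive_id tau 1))) (is_derive_invQ a0).
  apply: is_derive_ext h1 => [r|]; first by rewrite expr2.
  apply: (mulIf (expf_neq0 2 q0)); rewrite mulfVK ?expf_neq0//=.
  have -> : (2 * (1 * tau + tau * 1) / Q tau +
      2 * (tau * tau) * (- 4 * val tau / Q tau)) * Q tau ^+ 2 =
    4 * tau * Q tau - 2 * tau ^+ 2 * (4 * val tau * Q tau) by field.
  have -> : 4 * val tau * Q tau = 4 * u * aff tau + 2 * tau * dot p p.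
    by rewrite /val /flow_val -/(Q tau) -/(aff tau); field.
  by rewrite /Q /dil2 /aff; ring.
have h1 := is_derive_scalemx H (is_derive_angle a0).
have h2 := is_derive_scalemx (p *m p^T) hd.
have h3 := is_derive_add (is_derive_add (is_derive_cst 1%:M tau 1) h1) hb.
apply: is_derive_ext (is_derive_sub h3 h2) => //.
rewrite /velocity_diff add0r -/(Q tau) -/(aff tau) scaleNr addrAC.
by [].
Qed.

(* The combination of [angle] and [bend] that occurs here is rational. *)
Let outer_flow_diff tau : aff tau != 0 ->
  p *m p^T *m flow_diff tau =
  ((1 - 2 * tau ^+ 2 * dot p p / Q tau) *: (p *m p^T)
   + (tau * aff tau / Q tau) *: (p *m p^T *m H)).
Proof.
move=> a0; have q0 := Q_neq0 a0.
have PP : p *m p^T *m (p *m p^T) = dot p p *: (p *m p^T).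
  by rewrite -mulmxA (mulmxA p^T) dot_mx mul_scalar_mx -scalemxAr.
rewrite /flow_diff mulmxBr !mulmxDr mulmx1 -!scalemxAr (mulmxA _ _ H) PP.
rewrite -[dot p p *: _ *m H]scalemxAl !scalerA.
have -> : (angle tau *: (p *m p^T *m H)) =
    (tau * aff tau / Q tau - bend tau * dot p p) *: (p *m p^T *m H).
  have [/enorm_eq0 p0|p0] := eqVneq (enorm p) 0.
    by have -> : p *m p^T *m H = 0 by [rewrite p0 !mul0mx]; rewrite !scaler0.
  congr (_ *: _); rewrite /bend (negbTE p0) -sqr_enorm mulfVK ?expf_neq0//.
  by rewrite opprB addrC subrK.
rewrite -/(Q tau); move: (p *m p^T *m H) => AH; move: (p *m p^T) => A.
by apply/matrixP => i j; rewrite !mxE; ring.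
Qed.

(** The acceleration is minus four times the value times the velocity.  The right
    hand side is formally its space differential; the second term comes from the
    value along the flow, whose gradient is the velocity. *)
Lemma is_derive_velocity_diff tau : aff tau != 0 ->
  is_derive tau 1 velocity_diff
   (- 4 *: (flow_val u tau p *: velocity_diff tau +
            (dil2 u tau p) ^- 2 *: (p *m p^T *m flow_diff tau))).
Proof.
move=> a0; have q0 := Q_neq0 a0.
have hQ := is_derive_invQ a0; have hQ2 := is_derive_mul hQ hQ.
have id := is_derive_id tau 1.
have h1 := is_derive_scalemx H hQ.
have h2 := is_derive_scalemx (p *m p^T)
  (is_derive_mul (is_derive_scale 4 (is_derive_mul id (is_derive_aff tau))) hQ2).
have h3 := is_derive_scalemx (p *m p^T *m H)
  (is_derive_mul (is_derive_scale 2 (is_derive_mul id id)) hQ2).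
apply: is_derive_ext (is_derive_sub (is_derive_sub h1 h2) h3) => [r|].
  rewrite /velocity_diff -/(Q r) -/(aff r).
  congr (_ - _ *: _ - _ *: _).
    by rewrite -invfM -expr2 !mulrA.
  by rewrite -invfM -!expr2.
rewrite outer_flow_diff// /velocity_diff -/(Q tau) -/(val tau) -/(aff tau).
have valE : val tau = (2 * u * aff tau + tau * dot p p) / (2 * Q tau) by [].
move: (p *m p^T *m H) => AH; move: (p *m p^T) => A.
apply/matrixP => i j; rewrite !mxE valE; move: q0; rewrite /Q /dil2 /aff => q0.
by move: (H i j) (A i j) (AH i j) (dot p p) q0 => h b c n q0; field.
Qed.

End time_evolution.

(** * Differential of the flow in space *)

Lemma is_derive_inv {R : realType} (c : R) : c != 0 ->
  is_derive c 1 (@GRing.inv R) (- c ^- 2).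
Proof.
move=> c0; apply: is_derive_ext (@is_deriveV R id c _ 1 c0 (is_derive_id c 1)) => //.
by rewrite /GRing.scale /= mulr1.
Qed.

Section flow_differential.
Context {R : realType} {d : nat}.
Variables (X : set 'cV[R]_d) (y : 'cV[R]_d).
Implicit Types (f : 'cV[R]_d -> R) (G : 'cV[R]_d -> 'cV[R]_d) (p : 'cV[R]_d).

Lemma touches_has_sdiff f p C : 0 <= C -> touches f y p C -> has_sdiff X y f p.
Proof.
move=> C0 fp e e0; have [r r0 rC] := exists_small_factor e0 C0.
apply: filterS (near_enorm X y r0) => z zr; apply: le_trans (fp z) _.
rewrite expr2 mulrA ler_wpM2r//; apply: le_trans rC; rewrite mulrC.
by rewrite ler_wpM2r// ltW.
Qed.

Lemma has_sdiff_sum (g : 'I_d -> 'cV[R]_d -> R) (q : 'I_d -> 'cV[R]_d) :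
  (forall i, has_sdiff X y (g i) (q i)) ->
  has_sdiff X y (fun z => \sum_i g i z) (\sum_i q i).
Proof.
move=> gq.
suff h (s : seq 'I_d) : has_sdiff X y (fun z => \sum_(i <- s) g i z) (\sum_(i <- s) q i).
  exact: h.
elim: s => [|i s IH].
  rewrite big_nil; apply: has_sdiff_ext (has_sdiff_cst X y 0) => z.
  by rewrite big_nil.
rewrite big_cons; apply: has_sdiff_ext (has_sdiffD (gq i) IH) => z.
by rewrite big_cons.
Qed.

Lemma lipschitz_at_enorm G : (forall i, lipschitz_at X y (fun z => G z i 0)) ->
  exists2 K : R, 0 <= K & \forall z \near within X (nbhs y),
    enorm (G z - G y) <= K * enorm (z - y).
Proof.
move=> lG; pose K i := sval (cid2 (lG i)).
have K0 i : 0 <= K i by rewrite /K; case: cid2.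
have nearK i : \forall z \near within X (nbhs y),
    `|G z i 0 - G y i 0| <= K i * enorm (z - y) by rewrite /K; case: cid2.
exists (\sum_i K i); first exact: sumr_ge0.
have : \forall z \near within X (nbhs y), forall i,
    `|G z i 0 - G y i 0| <= K i * enorm (z - y) by exact: filter_forall.
apply: filterS => z hz; apply: le_trans (enorm_le_sum _) _.
by rewrite mulr_suml; apply: ler_sum => i _; rewrite !mxE.
Qed.

Lemma has_sdiffV f p : f y != 0 -> has_sdiff X y f p ->
  has_sdiff X y (fun z => (f z)^-1) (- (f y) ^- 2 *: p).
Proof. by move=> f0 fp; apply: has_sdiff_comp fp; exact: is_derive_inv. Qed.

Variables (f : 'cV[R]_d -> R) (gr : 'cV[R]_d -> 'cV[R]_d) (tau : R).
Let a z := 1 + 2 * tau * f z.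
Hypothesis a_neq0 : a y != 0.

Lemma flow_map_lipschitz : lipschitz_at X y f ->
  (forall i, lipschitz_at X y (fun z => gr z i 0)) ->
  exists2 K : R, 0 <= K & \forall z \near within X (nbhs y),
    enorm (flow_map (f z) tau (gr z) z - flow_map (f y) tau (gr y) y)
    <= K * enorm (z - y).
Proof.
move=> lf lgr.
have da : is_derive (f y) 1 (fun u => tau / (1 + 2 * tau * u))
    (tau * (- (2 * tau) / a y ^+ 2)).
  have haff : is_derive (f y) 1 (fun u => 1 + 2 * tau * u) (2 * tau).
    by apply: is_derive_eq; rewrite /GRing.scale /=; ring.
  apply: is_derive_scale; apply: is_derive_ext (@is_deriveV R _ (f y) _ 1 a_neq0 haff) => //.
  by rewrite /GRing.scale /= /a; field.
pose w z := (tau / a z) *: gr z.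
have lw i : lipschitz_at X y (fun z => w z i 0).
  have h := lipschitz_atM (lipschitz_at_comp da lf) (lgr i).
  by move: h; congr lipschitz_at; apply/funext => z; rewrite !mxE.
have [K K0 hK] := lipschitz_at_enorm lw.
exists (1 + 3 * K); first by rewrite addr_ge0// mulr_ge0.
apply: filterS hK => z hz; rewrite /flow_map -/(a z) -/(a y) -/(w z) -/(w y).
rewrite opprD addrACA; apply: le_trans (ler_enormD _ _) _.
rewrite mulrDl mul1r lerD2l; apply: le_trans (arctanv_lipschitz _ _) _.
by rewrite -mulrA ler_pM2l.
Qed.

Variables (H : 'M[R]_d).
Hypotheses (fp : has_sdiff X y f (gr y)) (gH : has_diff_on X gr y H).
Let p := gr y.
Let u := f y.
Let h i := (row i H)^T.

Let gh i : has_sdiff X y (fun z => gr z i 0) (h i).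
Proof. exact: (has_diff_onP _ _ _ _).1. Qed.

Let diff_a : has_sdiff X y a ((2 * tau) *: p).
Proof.
have := has_sdiffD (has_sdiff_cst X y 1) (has_sdiffZ (2 * tau) fp).
by rewrite add0r.
Qed.

Let diff_norm2 : has_sdiff X y (fun z => dot (gr z) (gr z)) (2 *: (H^T *m p)).
Proof.
have := has_sdiff_sum (fun i => has_sdiffM (gh i) (gh i)).
have -> : \sum_i (gr y i 0 *: h i + gr y i 0 *: h i) = 2 *: (H^T *m p) => //.
apply/colP => j; rewrite summxE !mxE mulr_sumr; apply: eq_bigr => i _.
by rewrite !mxE -/p; ring.
Qed.

Let Q0 : dil2 u tau p != 0.
Proof.
have h0 : 0 < a y ^+ 2 by rewrite lt_def sqr_ge0 expf_neq0.
have h1 : 0 <= tau ^+ 2 * dot p p by rewrite -sqr_enorm -exprMn sqr_ge0.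
by rewrite gt_eqF// /dil2 ltr_pwDl.
Qed.

Let diff_dil2 : has_sdiff X y (fun z => dil2 (f z) tau (gr z))
  ((4 * tau * a y) *: p + (2 * tau ^+ 2) *: (H^T *m p)).
Proof.
have := has_sdiffD (has_sdiffM diff_a diff_a) (has_sdiffZ (tau ^+ 2) diff_norm2).
rewrite !scalerA -scalerDl.
have -> : a y * (2 * tau) + a y * (2 * tau) = 4 * tau * a y by ring.
by rewrite [tau ^+ 2 * 2]mulrC; apply: has_sdiff_ext => z; rewrite expr2.
Qed.

Let outerE i j : (p *m p^T) i j = p i 0 * p j 0.
Proof. by rewrite mxE big_ord1 mxE. Qed.

Let outerHE i j : (p *m p^T *m H) i j = p i 0 * (H^T *m p) j 0.
Proof.
rewrite !mxE mulr_sumr; apply: eq_bigr => k _.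
by rewrite outerE !mxE -mulrA (mulrC (p k 0)).
Qed.

(** Product and chain rules applied to each coordinate of the velocity. *)
Lemma velocity_has_diff :
  has_diff_on X (fun z => (dil2 (f z) tau (gr z))^-1 *: gr z) y
    (velocity_diff u p H tau).
Proof.
apply/has_diff_onP => i.
have := has_sdiffM
  (@has_sdiffV (fun z => dil2 (f z) tau (gr z)) _ Q0 diff_dil2) (gh i).
set g1 := _ + _; have -> : g1 = (row i (velocity_diff u p H tau))^T.
  apply/colP => j; have e1 := outerE i j; have e2 := outerHE i j.
  rewrite /g1 /velocity_diff -/p -/u -/(a y); move: e1 e2.
  move: (p *m p^T *m H) => AH; move: (p *m p^T) => A; move: (H^T *m p) => c.
  move=> e1 e2; rewrite !mxE e1 e2.
  by move: (dil2 u tau p) Q0 => Q q0; field.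
by apply: has_sdiff_ext => z; rewrite mxE.
Qed.

(* Away from critical points the angle is a smooth function of the value and of
   the norm of the slope. *)
Let flow_diff_regular : p != 0 -> forall i,
  has_sdiff X y (fun z => (arctanv ((tau / a z) *: gr z)) i 0)
    (angle u p tau *: h i + p i 0 *:
      (bend u p tau *: (H^T *m p) - (2 * tau ^+ 2 / dil2 u tau p) *: p)).
Proof.
move=> p0 i; have sg0 := enorm_gt0 p0; set sg := enorm p in sg0.
have sgn : sg != 0 by rewrite gt_eqF.
have pp0 : 0 < dot (gr y) (gr y) by rewrite -sqr_enorm exprn_gt0.
have diff_sg : has_sdiff X y (fun z => enorm (gr z)) (sg^-1 *: (H^T *m p)).
  have := @has_sdiff_comp R d X y (fun z => dot (gr z) (gr z)) _
    Num.sqrt _ (is_derive1_sqrt pp0) diff_norm2.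
  rewrite -enormE scalerA -/p -/sg; have -> : (2 * sg)^-1 * 2 = sg^-1 by field.
  by apply: has_sdiff_ext => z; rewrite enormE.
have diff_rho := has_sdiffZ tau (has_sdiffM diff_sg (@has_sdiffV a _ a_neq0 diff_a)).
have diff_at := @has_sdiff_comp R d X y
  (fun z => tau * (enorm (gr z) * (a z)^-1)) _ atan _ (is_derive1_atan _) diff_rho.
have diff_ang := has_sdiffM diff_at (@has_sdiffV (fun z => enorm (gr z)) _ sgn diff_sg).
have := has_sdiffM diff_ang (gh i).
set q1 := _ + _; set q2 := _ + _.
have -> : q1 = q2.
  rewrite /q1 /q2 -/p -/sg /bend /angle -/sg !(negbTE sgn) -/u -/(a y).
  have -> : tau * (sg / a y) = tau * sg / a y by rewrite mulrA.
  move: (H^T *m p) => c.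
  apply/colP => j; rewrite !mxE /dil2 -/(a y) -sqr_enorm -/sg.
  have q0 : a y ^+ 2 + tau ^+ 2 * sg ^+ 2 != 0.
    by move: Q0; rewrite /dil2 -/(a y) -sqr_enorm.
  move: (atan _) (p i 0) (p j 0) (H i j) (c j 0) => at_ pi pj hij cj.
  move: q0 a_neq0; move: (a y) => b q0 b0.
  by field; rewrite exprMn q0 b0 sgn.
apply: has_sdiff_ext => z; rewrite arctanv_angle mxE /angle mulrA.
by case: eqP => // /enorm_eq0 ->; rewrite mxE !mulr0.
Qed.

(* At a critical point the displacement agrees to first order with its argument,
   since the arctangent is tangent to the identity at the origin. *)
Let flow_diff_critical : p = 0 -> forall i,
  has_sdiff X y (fun z => (arctanv ((tau / a z) *: gr z)) i 0)
    (angle u p tau *: h i + p i 0 *: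
      (bend u p tau *: (H^T *m p) - (2 * tau ^+ 2 / dil2 u tau p) *: p)).
Proof.
move=> p0 i; rewrite p0 mxE scale0r addr0 /angle enorm0 eqxx -/u -/(a y).
pose w z := (tau / a z) *: gr z.
have wy : w y = 0 by rewrite /w -/p p0 scaler0.
have dw j : has_sdiff X y (fun z => w z j 0) ((tau / a y) *: h j).
  have := has_sdiffM (has_sdiffZ tau (@has_sdiffV a _ a_neq0 diff_a)) (gh j).
  rewrite -/p p0 mxE scale0r add0r.
  by apply: has_sdiff_ext => z; rewrite /w mxE.
have [K K0 hK] := lipschitz_at_enorm (fun j => has_sdiff_lipschitz (dw j)).
rewrite -[_ *: h i]addr0.
have err : has_sdiff X y (fun z => (arctanv (w z) - w z) i 0) 0.
  move=> e e0; rewrite wy arctanv0 subr0.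
  have [e1 e10 e1K] := exists_small_factor e0 K0.
  have [r r0 hr] := (nbhs_ballP _ _).1 (is_derive_expansion (is_derive1_atan (0 : R)) e10).
  have r2 : 0 < r / 2 by rewrite divr_gt0.
  have [r1 r10 r1K] := exists_small_factor r2 K0.
  apply: filter_app hK; apply: filterS (near_enorm X y r10) => z zr1 hz.
  rewrite wy subr0 in hz.
  rewrite dot0l subr0 [X in _ - X]mxE subr0.
  have wr : enorm (w z) < r.
    apply: le_lt_trans hz _; apply: (@le_lt_trans _ _ (r / 2)).
      by apply: le_trans r1K; rewrite mulrC ler_wpM2r// ltW.
    by rewrite ltr_pdivrMr// ltr_pMr// ltr1n.
  have := hr (enorm (w z)); rewrite -ball_normE /= sub0r normrN ger0_norm//.
  move=> /(_ wr); rewrite atan0 !subr0 expr0n /= addr0 invr1 mul1r.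
  rewrite (ger0_norm (enorm_ge0 (w z))) => hat.
  apply: le_trans (coord_le_enorm _ _) _.
  have -> : arctanv (w z) - w z = (atan (enorm (w z)) / enorm (w z) - 1) *: w z.
    by rewrite /arctanv scalerBl scale1r.
  rewrite enormZ; have [w0|w0] := eqVneq (enorm (w z)) 0.
    by rewrite w0 mulr0 mulr_ge0// ltW.
  rewrite -{3}(ger0_norm (enorm_ge0 (w z))) -normrM mulrBl mul1r mulfVK//.
  apply: le_trans hat _; apply: le_trans (ler_wpM2l (ltW e10) hz) _.
  by rewrite mulrA ler_wpM2r.
apply: has_sdiff_ext (has_sdiffD (dw i) err) => z.
by rewrite -/(w z); move: (arctanv (w z)) (w z) => v v'; rewrite !mxE; ring.
Qed.

Lemma flow_map_has_diff :
  has_diff_on X (fun z => flow_map (f z) tau (gr z) z) y (flow_diff u p H tau).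
Proof.
apply/has_diff_onP => i.
have disp : has_sdiff X y (fun z => (arctanv ((tau / a z) *: gr z)) i 0)
    (angle u p tau *: h i + p i 0 *:
      (bend u p tau *: (H^T *m p) - (2 * tau ^+ 2 / dil2 u tau p) *: p)).
  by have [p0|p0] := eqVneq p 0; [exact: flow_diff_critical|exact: flow_diff_regular].
have := has_sdiffD (has_sdiff_coord X y i) disp.
set q := _ + _; have -> : q = (row i (flow_diff u p H tau))^T.
  apply/colP => j; have e1 := outerE i j; have e2 := outerHE i j.
  rewrite /q /flow_diff; move: e1 e2.
  move: (p *m p^T *m H) => AH; move: (p *m p^T) => A; move: (H^T *m p) => c.
  move=> e1 e2; rewrite !mxE e1 e2 eqxx andbT eq_sym.
  by ring.
by apply: has_sdiff_ext => z; rewrite /flow_map [RHS]mxE.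
Qed.

End flow_differential.

Lemma has_diff_on_ext {R : realType} {d : nat} (X : set 'cV[R]_d) (y : 'cV[R]_d)
    (F G : 'cV[R]_d -> 'cV[R]_d) (A : 'M[R]_d) : X y ->
  (forall z, X z -> F z = G z) -> has_diff_on X F y A -> has_diff_on X G y A.
Proof.
move=> Xy FG FA e e0; have := FA e e0; apply: filter_app.
have : \forall z \near within X (nbhs y), X z by apply: withinT.
by apply: filterS => z Xz; rewrite !FG.
Qed.

(** The Lipschitz bound for the left inverse is only local, so the continuity of
    [G] at [y] is needed to apply it; the differential provides it. *)
Lemma left_inverse_expands {R : realType} {d : nat} (X Y : set 'cV[R]_d)
    (y : 'cV[R]_d) (G S : 'cV[R]_d -> 'cV[R]_d) (B : 'M[R]_d) (K : R) :
  has_diff_on X G y B -> X y -> (forall z, X z -> Y (G z)) ->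
  (forall z, X z -> S (G z) = z) ->
  (\forall z \near within Y (nbhs (G y)),
    enorm (S z - S (G y)) <= K * enorm (z - G y)) ->
  \forall z \near within X (nbhs y), enorm (z - y) <= K * enorm (G z - G y).
Proof.
move=> dG Xy XY SG Slip.
have [L L0 hL] := lipschitz_at_enorm (fun i =>
  has_sdiff_lipschitz ((has_diff_onP _ _ _ _).1 dG i)).
have [r r0 hr] := (nbhs_enormP _ _).1 Slip.
have r2 : 0 < r / 2 by rewrite divr_gt0.
have [r1 r10 r1L] := exists_small_factor r2 L0.
apply: filter_app hL.
have : \forall z \near within X (nbhs y), X z by apply: withinT.
apply: filter_app; apply: filterS (near_enorm X y r10) => z zr1 Xz hz.
have := hr (G z); rewrite !SG// => /(_ _ (XY z Xz)); apply.
apply: le_lt_trans hz _; apply: (@le_lt_trans _ _ (r / 2)).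
  by apply: le_trans r1L; rewrite mulrC ler_wpM2r// ltW.
by rewrite ltr_pdivrMr// ltr_pMr// ltr1n.
Qed.

(** Differential of a map along a change of variables [G] with a Lipschitz
    inverse [S]. *)
Lemma has_diff_on_pushforward {R : realType} {d : nat} (X Y : set 'cV[R]_d)
    (y : 'cV[R]_d) (G S F : 'cV[R]_d -> 'cV[R]_d) (B M : 'M[R]_d) (K : R) :
  has_diff_on X G y B -> B \in unitmx -> 0 <= K ->
  (forall z, Y z -> X (S z) /\ G (S z) = z) -> S (G y) = y ->
  (\forall z \near within Y (nbhs (G y)),
    enorm (S z - S (G y)) <= K * enorm (z - G y)) ->
  has_diff_on X (fun z => F (G z)) y M ->
  has_diff_on Y F (G y) (M *m invmx B).
Proof.
move=> GB Bu K0 YS -> Slip FM e e0.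
set A := M *m invmx B; set L := \sum_i \sum_j `|A i j|.
have L0 : 0 <= L by apply: sumr_ge0 => i _; apply: sumr_ge0.
have M0 : 0 <= (1 + L) * K by rewrite mulr_ge0// addr_ge0.
have [e1 e10 e1M] := exists_small_factor e0 M0.
have [r r0 hr] := (nbhs_enormP _ _).1 (filterI (GB _ e10) (FM _ e10)).
have r2 : 0 < r / 2 by rewrite divr_gt0.
  have [r1 r10 r1K] := exists_small_factor r2 K0.
apply: filter_app Slip.
have : \forall z \near within Y (nbhs (G y)), Y z by apply: withinT.
apply: filter_app; apply: filterS (near_enorm Y (G y) r10) => z zr1 Yz Sz.
have [XS GS] := YS z Yz.
have Sr : enorm (S z - y) < r.
  apply: le_lt_trans Sz _; apply: (@le_lt_trans _ _ (r / 2)).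
    by apply: le_trans r1K; rewrite mulrC ler_wpM2r// ltW.
  by rewrite ltr_pdivrMr// ltr_pMr// ltr1n.
have [h1 h2] := hr _ Sr XS; rewrite GS in h1 h2.
have -> : F z - F (G y) - A *m (z - G y) =
   (F z - F (G y) - M *m (S z - y)) - A *m (z - G y - B *m (S z - y)).
  rewrite [A *m (_ - B *m _)]mulmxBr (mulmxA A B) /A mulmxKV//.
  move: (M *m (S z - y)) (M *m invmx B *m _) (F z) (F _) => c1 c2 c3 c4.
  by apply/matrixP => i j; rewrite !mxE; ring.
apply: le_trans (ler_enormB _ _) _; apply: le_trans (lerD h2 (enorm_mulmx_le _ _)) _.
apply: le_trans (_ : (1 + L) * (e1 * enorm (S z - y)) <= _).
  by rewrite mulrDl mul1r lerD2l ler_wpM2l.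
apply: le_trans (_ : (e1 * ((1 + L) * K)) * enorm (z - G y) <= _); last first.
  by rewrite ler_wpM2r.
have -> : (e1 * ((1 + L) * K)) * enorm (z - G y) =
  (1 + L) * (e1 * (K * enorm (z - G y))) by ring.
by rewrite ler_wpM2l ?addr_ge0// ler_pM2l.
Qed.

(** * Evolution along the contact sets *)

Section contact_sets.
Context {R : realType} {d : nat}.
Variables (xi0 xibar1 : 'cV[R]_d -> \bar R).
Hypotheses (xi0_ge : forall z, ((- 2^-1)%:E <= xi0 z)%E)
  (xi0_lsc : lower_semicontinuous xi0)
  (xibar1_ge : forall z, ((- 2^-1)%:E <= - xibar1 z)%E)
  (xibar1_lsc : lower_semicontinuous (fun z => (- xibar1 z)%E))
  (compatible : forall z, (xibar1 z <= hopf_laxP 1 xi0 z)%E).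
Implicit Types (s t : R) (x y z : 'cV[R]_d).

Definition contact_set t : set 'cV[R]_d :=
  [set z | hopf_laxP t xi0 z = hopf_laxR (1 - t) xibar1 z].

Local Notation xi := (hl xi0).
Local Notation Dxi t := (grad (xi t)).

Let contact_setP t z : 0 < t < 1 -> contact_set t z <->
  xi t z = - hl (fun w => (- xibar1 w)%E) (1 - t) z.
Proof.
move=> t01; have t01' : 0 < 1 - t < 1.
  by move: t01 => /andP[t0 t1]; rewrite subr_gt0 t1 ltrBlDr ltrDl.
rewrite /contact_set /= /hopf_laxR (hlE t01 xi0_ge) (hlE t01' xibar1_ge).
by split=> [[]|->].
Qed.

Lemma contact_set_touches t z : 0 < t < 1 -> contact_set t z ->
  touches (xi t) z (Dxi t z) (curv t).
Proof.
move=> t01 /(contact_setP _ t01) cz.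
have [p pz _] := contact_flow xi0_ge xi0_lsc xibar1_ge xibar1_lsc compatible t01 cz.
by rewrite (touches_grad (curv_ge0 t01) pz).
Qed.

Lemma contact_set_affine s t z : 0 < s < 1 -> 0 < t < 1 ->
  0 < 1 + 2 * (t - s) * xi s z.
Proof. by move=> s01 t01; apply: affine_gt0 => //; exact: hl_bounds. Qed.

Lemma contact_set_transport s t z : 0 < s < 1 -> 0 < t < 1 -> contact_set s z ->
  let T := transport (xi s) (t - s) z in
  [/\ contact_set t T, xi t T = flow_val (xi s z) (t - s) (Dxi s z) &
      Dxi t T = (dil2 (xi s z) (t - s) (Dxi s z))^-1 *: Dxi s z].
Proof.
move=> s01 t01 /(contact_setP _ s01) cz T.
have [p pz flow] := contact_flow xi0_ge xi0_lsc xibar1_ge xibar1_lsc compatible s01 cz.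
have pE := touches_grad (curv_ge0 s01) pz.
have [cT vT tT] := flow t t01; rewrite -pE in cT vT tT.
split; [exact/contact_setP|exact: vT|exact: touches_grad (curv_ge0 t01) tT].
Qed.

(** With value and slope updated, the factor [1 + 2 tau u] of the flow back is the
    one of the flow divided by [dil2], so that both displacements have the same
    argument up to the sign. *)
Lemma transportK s t z : 0 < s < 1 -> 0 < t < 1 -> contact_set s z ->
  transport (xi t) (s - t) (transport (xi s) (t - s) z) = z.
Proof.
move=> s01 t01 cz; have [_ vT gT] := contact_set_transport s01 t01 cz.
have a0 := contact_set_affine z s01 t01.
rewrite {1}/transport vT gT {1}/transport.
set p := Dxi s z in gT *; set u := xi s z in a0 *.
have q0 := dil2_gt0 p a0.
have -> : (s - t) / (1 + 2 * (s - t) * flow_val u (t - s) p) *: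
    ((dil2 u (t - s) p)^-1 *: p) = - ((t - s) / (1 + 2 * (t - s) * u) *: p).
  rewrite scalerA -scaleNr; congr (_ *: _).
  have -> : 1 + 2 * (s - t) * flow_val u (t - s) p =
      (1 + 2 * (t - s) * u) / dil2 u (t - s) p.
    apply: (mulIf (lt0r_neq0 q0)); rewrite mulfVK ?gt_eqF//.
    have -> : (1 + 2 * (s - t) * flow_val u (t - s) p) * dil2 u (t - s) p =
      dil2 u (t - s) p - (t - s) *
        (2 * u * (1 + 2 * (t - s) * u) + (t - s) * dot p p).
      by rewrite /flow_val; field; rewrite gt_eqF.
    by rewrite /dil2; ring.
  by field; rewrite !gt_eqF.
by rewrite arctanvN addrK.
Qed.

(** Backward transport is Lipschitz along the contact set because the gradient
    is; so the forward transport has an invertible differential. *)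
Lemma transport_lipschitz s t z : 0 < s < 1 -> 0 < t < 1 -> contact_set s z ->
  exists2 K : R, 0 <= K & \forall w \near within (contact_set s) (nbhs z),
    enorm (transport (xi s) (t - s) w - transport (xi s) (t - s) z)
    <= K * enorm (w - z).
Proof.
move=> s01 t01 cz; have tz := contact_set_touches s01 cz.
have C0 := curv_ge0 s01.
apply: flow_map_lipschitz.
- by rewrite gt_eqF// contact_set_affine.
- exact: has_sdiff_lipschitz (touches_has_sdiff _ C0 tz).
move=> i; exists (6 * curv s); first by rewrite mulr_ge0.
have : \forall w \near within (contact_set s) (nbhs z), contact_set s w by apply: withinT.
apply: filterS => w cw.
have := touches_lipschitz C0 (contact_set_touches s01 cw) tz; apply: le_trans.
have coord (v v' : 'cV[R]_d) : `|v i 0 - v' i 0| <= enorm (v - v').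
  by have := coord_le_enorm (v - v') i; rewrite !mxE.
exact: coord.
Qed.

Section at_differentiability_point.
Variables (s : R) (y : 'cV[R]_d) (H : 'M[R]_d).
Hypotheses (s01 : 0 < s < 1) (cy : contact_set s y).
Hypotheses (fy : fills (contact_set s) y)
  (Hy : has_diff_on (contact_set s) (Dxi s) y H).

Let u := xi s y.
Let p := Dxi s y.
Let Y t := transport (xi s) (t - s) y.
Let B t := flow_diff u p H (t - s).
Let M t := velocity_diff u p H (t - s).

Let a_neq0 t : 0 < t < 1 -> 1 + 2 * (t - s) * u != 0.
Proof. by move=> t01; rewrite gt_eqF// contact_set_affine. Qed.

Let dxi : has_sdiff (contact_set s) y (xi s) p.
Proof. exact: touches_has_sdiff (curv_ge0 s01) (contact_set_touches s01 cy). Qed.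

Lemma transport_has_diff t : 0 < t < 1 ->
  has_diff_on (contact_set s) (transport (xi s) (t - s)) y (B t).
Proof.
move=> t01.
exact: (@flow_map_has_diff R d (contact_set s) y (xi s) (Dxi s) (t - s)
  (a_neq0 t01) H dxi Hy).
Qed.

Lemma transport_diff_unitmx t : 0 < t < 1 -> B t \in unitmx.
Proof.
move=> t01; have dT := transport_has_diff t01.
have [cT _ _] := contact_set_transport s01 t01 cy.
have [K K0 hK] := transport_lipschitz t01 s01 cT.
apply: (fills_diff_unitmx fy dT K0).
apply: (@left_inverse_expands R d (contact_set s) (contact_set t) y
  (transport (xi s) (t - s)) (transport (xi t) (s - t)) (B t) K dT cy _ _ hK).
- by move=> z cz; have [] := contact_set_transport s01 t01 cz.
- by move=> z cz; exact: (transportK s01 t01 cz).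
Qed.

Lemma transport_fills t : 0 < t < 1 -> fills (contact_set t) (Y t).
Proof.
move=> t01; apply: (fills_image fy (transport_has_diff t01)).
  exact: transport_diff_unitmx.
by move=> z cz; have [] := contact_set_transport s01 t01 cz.
Qed.

(** The gradient at the transported point is the velocity, a function of the
    starting point; its differential is pulled back through the transport. *)
Lemma hessian_has_diff t : 0 < t < 1 ->
  has_diff_on (contact_set t) (Dxi t) (Y t) (M t *m invmx (B t)).
Proof.
move=> t01; have [cT _ _] := contact_set_transport s01 t01 cy.
have [K K0 hK] := transport_lipschitz t01 s01 cT.
apply: (@has_diff_on_pushforward R d (contact_set s) (contact_set t) y
  (transport (xi s) (t - s)) (transport (xi t) (s - t)) (Dxi t) (B t) (M t) K
  (transport_has_diff t01) (transport_diff_unitmx t01) K0 _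
  (transportK s01 t01 cy) hK).
  move=> z cz; have [cS _ _] := contact_set_transport t01 s01 cz.
  by split; [exact: cS|exact: (transportK t01 s01 cz)].
have dv := @velocity_has_diff R d (contact_set s) y (xi s) (Dxi s) (t - s)
  (a_neq0 t01) H dxi Hy.
apply: has_diff_on_ext cy _ dv => z cz.
have [_ _ gT] := contact_set_transport s01 t01 cz; exact: esym gT.
Qed.

Lemma hessian_sym t : 0 < t < 1 ->
  (M t *m invmx (B t))^T = M t *m invmx (B t).
Proof.
move=> t01; apply: (@fills_hessian_sym R d (contact_set t) (Y t) (xi t) (Dxi t) (curv t) _
  (transport_fills t01) (curv_ge0 t01) _ (hessian_has_diff t01)).
by move=> z w cz; exact: (contact_set_touches t01 cz).
Qed.

End at_differentiability_point.

End contact_sets.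

(** * The evolution equations *)

Section unit_interval.
Context {R : realType} {V : normedModType R}.
Implicit Types (F G W : R -> V) (s t : R).

Lemma is_derive_translate F s t (D : V) :
  is_derive (t - s) 1 F D -> is_derive t 1 (fun r => F (r - s)) D.
Proof.
have E : (fun h : R => h^-1 *: (((fun r => F (r - s)) \o shift t) (h *: 1) - F (t - s)))
    = (fun h : R => h^-1 *: ((F \o shift (t - s)) (h *: 1) - F (t - s))).
  by apply/funext => h /=; rewrite addrA.
by case=> dF <-; split; rewrite /derivable /derive E.
Qed.

Lemma is_derive_near01 F G t (D : V) : 0 < t < 1 ->
  (forall r : R, 0 < r < 1 -> F r = G r) -> is_derive t 1 G D -> is_derive t 1 F D.
Proof.
move=> t01 FG; apply: near_eq_is_derive.
have t01' : t \in `]0, 1[ by rewrite in_itv.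
have := near_in_itvoo t01'; apply: filterS => r.
by rewrite in_itv => r01; rewrite FG.
Qed.

Lemma is_derive_derive1 F W t (D : V) : 0 < t < 1 ->
  (forall r : R, 0 < r < 1 -> is_derive r 1 F (W r)) -> is_derive t 1 W D ->
  is_derive t 1 (derive1 F) D.
Proof.
move=> t01 FW; apply: is_derive_near01 => // r r01.
by rewrite derive1E; have [_ ->] := FW r r01.
Qed.

End unit_interval.

Section shifted_time.
Context {R : realType} {d : nat}.
Variables (u : R) (p x : 'cV[R]_d) (s t : R).
Hypothesis a0 : 1 + 2 * (t - s) * u != 0.

Lemma is_derive_flow_map_shift :
  is_derive t 1 (fun r => flow_map u (r - s) p x) ((dil2 u (t - s) p)^-1 *: p).
Proof.
apply: (@is_derive_translate _ _ (fun tau => flow_map u tau p x)).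
exact: is_derive_flow_map.
Qed.

Lemma is_derive_velocity_shift :
  is_derive t 1 (fun r => (dil2 u (r - s) p)^-1 *: p)
    (- 4 * flow_val u (t - s) p *: ((dil2 u (t - s) p)^-1 *: p)).
Proof.
apply: (@is_derive_translate _ _ (fun tau => (dil2 u tau p)^-1 *: p)).
exact: is_derive_velocity.
Qed.

Lemma is_derive_dilation_shift :
  is_derive t 1 (fun r => Num.sqrt (dil2 u (r - s) p))
    (2 * flow_val u (t - s) p * Num.sqrt (dil2 u (t - s) p)).
Proof.
apply: (@is_derive_translate _ _ (fun tau => Num.sqrt (dil2 u tau p))).
exact: is_derive_dilation.
Qed.

Lemma is_derive_dilation_rate_shift :
  is_derive t 1
    (fun r => 2 * flow_val u (r - s) p * Num.sqrt (dil2 u (r - s) p))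
    (enorm ((dil2 u (t - s) p)^-1 *: p) ^+ 2 * Num.sqrt (dil2 u (t - s) p)).
Proof.
have -> : enorm ((dil2 u (t - s) p)^-1 *: p) ^+ 2 = dot p p / dil2 u (t - s) p ^+ 2.
  by rewrite sqr_enorm dotZl dotZr mulrA -invfM -expr2 mulrC.
apply: (@is_derive_translate _ _
  (fun tau => 2 * flow_val u tau p * Num.sqrt (dil2 u tau p))).
exact: is_derive_dilation_rate.
Qed.

End shifted_time.

Theorem theorem4p8 (R : realType) (d : nat) (a abar : R)
    (xi0 xibar1 : 'cV[R]_d -> \bar R)
    (ha : - 2^-1 <= a) (habar : - 2^-1 <= abar)
    (hxi0 : forall z, (a%:E <= xi0 z)%E)
    (hxi0_lsc : lower_semicontinuous xi0)
    (hxibar1 : forall z, (xibar1 z <= (- abar)%:E)%E)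
    (hxibar1_usc : upper_semicontinuous xibar1)
    (hle : forall z, (xibar1 z <= hopf_laxP 1 xi0 z)%E) :
  let Xi (t : R) : set 'cV[R]_d :=
    [set z | hopf_laxP t xi0 z = hopf_laxR (1 - t) xibar1 z] in
  let xi (t : R) (z : 'cV[R]_d) : R := fine (hopf_laxP t xi0 z) in
  let Dxi (t : R) : 'cV[R]_d -> 'cV[R]_d := grad (xi t) in
  let D2xi (t : R) : 'cV[R]_d -> 'M[R]_d := diff_on (Xi t) (Dxi t) in
  let Lapl (t : R) (z : 'cV[R]_d) : R := \tr (D2xi t z) in
  forall (s : R) (x y : 'cV[R]_d),
  0 < s < 1 -> Xi s x -> diff_points (Xi s) (Dxi s) y ->
  let T (t : R) : 'cV[R]_d := transport (xi s) (t - s) x in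
  let q (t : R) : R := dilation (xi s) (t - s) x in
  let Y (t : R) : 'cV[R]_d := transport (xi s) (t - s) y in
  let B (t : R) : 'M[R]_d := diff_on (Xi s) (transport (xi s) (t - s)) y in
  let delta (t : R) : R := \det (B t) in
  [/\ T s = x, q s = 1, B s = 1%:M & delta s = 1] /\
  (forall t : R, 0 < t < 1 ->
    [/\ is_derive t 1 T (Dxi t (T t)) &
        is_derive t 1 (derive1 T) (- 4 * xi t (T t) *: Dxi t (T t))] /\
    [/\ is_derive t 1 q (2 * xi t (T t) * q t) &
        is_derive t 1 (derive1 q) (enorm (Dxi t (T t)) ^+ 2 * q t)] /\
    [/\ is_derive t 1 B (D2xi t (Y t) *m B t) &
        is_derive t 1 (derive1 B)
          ((- 4 *: (Dxi t (Y t) *m (Dxi t (Y t))^T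
                    + xi t (Y t) *: D2xi t (Y t))) *m B t)] /\
    [/\ is_derive t 1 delta (Lapl t (Y t) * delta t),
        delta t != 0,
        derivable (derive1 delta) t 1 &
        derive1 (derive1 delta) t / delta t =
          Lapl t (Y t) ^+ 2
          - \sum_(i < d) \sum_(j < d) D2xi t (Y t) i j ^+ 2
          - 4 * enorm (Dxi t (Y t)) ^+ 2
          - 4 * xi t (Y t) * Lapl t (Y t)]).
Proof.
move=> Xi xi Dxi D2xi Lapl s x y s01 Xx [Xy dens [H dH]] T q Y B delta.
have xi0_ge z : ((- 2^-1)%:E <= xi0 z)%E by apply: le_trans (hxi0 z); rewrite lee_fin.
have xibar1_ge z : ((- 2^-1)%:E <= - xibar1 z)%E.
  by rewrite leeNr; apply: le_trans (hxibar1 z) _; rewrite lee_fin lerNl opprK; lra.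
have xibar1_lsc : lower_semicontinuous (fun z => (- xibar1 z)%E).
  move=> z c; rewrite lteNr => /hxibar1_usc[V Vz hV]; exists V => // w /hV.
  by rewrite lteNr.
pose trans := contact_set_transport xi0_ge hxi0_lsc xibar1_ge xibar1_lsc hle.
have aff (r : R) z : 0 < r < 1 -> 1 + 2 * (r - s) * xi s z != 0.
  by move=> r01; rewrite gt_eqF//; exact: (contact_set_affine xi0_ge).
have fy : fills (Xi s) y := density_fills Xy dens.
pose u := xi s y; pose p := Dxi s y.
pose B' (t : R) := flow_diff u p H (t - s).
pose M (t : R) := velocity_diff u p H (t - s).
have BE (t : R) : 0 < t < 1 -> B t = B' t.
  move=> t01; apply: (diff_onE fy).
  exact: (transport_has_diff xi0_ge hxi0_lsc xibar1_ge xibar1_lsc hle).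
have Bs : B s = 1%:M by rewrite BE// /B' subrr flow_diff0.
have NE (t : R) : 0 < t < 1 -> D2xi t (Y t) = M t *m invmx (B' t).
  move=> t01; apply: diff_onE.
    exact: (transport_fills xi0_ge hxi0_lsc xibar1_ge xibar1_lsc hle s01 Xy fy dH).
  exact: (hessian_has_diff xi0_ge hxi0_lsc xibar1_ge xibar1_lsc hle s01 Xy fy dH).
have Bu (t : R) : 0 < t < 1 -> B' t \in unitmx.
  exact: (transport_diff_unitmx xi0_ge hxi0_lsc xibar1_ge xibar1_lsc hle s01 Xy fy dH).
have Nsym (t : R) : 0 < t < 1 -> (D2xi t (Y t))^T = D2xi t (Y t).
  move=> t01; rewrite NE//.
  exact: (hessian_sym xi0_ge hxi0_lsc xibar1_ge xibar1_lsc hle s01 Xy fy dH).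
have qE t : q t = Num.sqrt (dil2 (xi s x) (t - s) (Dxi s x)).
  by rewrite /q /dilation sqr_enorm.
split.
  split => //.
  - by rewrite /T /transport subrr mul0r scale0r arctanv0 addr0.
  - by rewrite qE subrr /dil2 mulr0 mul0r addr0 !expr0n /= mul0r addr0 expr1n sqrtr1.
  - by rewrite /delta Bs det1.
have dT (r : R) : 0 < r < 1 ->
    is_derive r 1 T ((dil2 (xi s x) (r - s) (Dxi s x))^-1 *: Dxi s x).
  by move=> r01; exact: (is_derive_flow_map_shift _ _ (aff r x r01)).
have dq (r : R) : 0 < r < 1 -> is_derive r 1 q
    (2 * flow_val (xi s x) (r - s) (Dxi s x) *
      Num.sqrt (dil2 (xi s x) (r - s) (Dxi s x))).
  move=> r01; have qf : q = fun r => Num.sqrt (dil2 (xi s x) (r - s) (Dxi s x)).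
    exact/funext.
  by rewrite qf; exact: (is_derive_dilation_shift _ (aff r x r01)).
have dB' (r : R) : 0 < r < 1 -> is_derive r 1 B' (M r).
  move=> r01; apply: (@is_derive_translate _ _ (flow_diff u p H)).
  exact/is_derive_flow_diff/aff.
have dB (r : R) : 0 < r < 1 -> is_derive r 1 B (M r).
  by move=> r01; apply: is_derive_near01 (dB' r r01).
have MN (r : R) : 0 < r < 1 -> M r = D2xi r (Y r) *m B' r.
  by move=> r01; rewrite NE// mulmxKV// Bu.
have ddelta (r : R) : 0 < r < 1 ->
    is_derive r 1 delta (\tr (M r *m \adj (B' r))).
  move=> r01; apply: is_derive_near01 (is_derive_det (dB' r r01)) => // r' r'01.
  by rewrite /delta BE.
move=> t t01.
have [vT gT] : xi t (T t) = flow_val (xi s x) (t - s) (Dxi s x) /\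
    Dxi t (T t) = (dil2 (xi s x) (t - s) (Dxi s x))^-1 *: Dxi s x.
  by have [_ vT gT] := trans s t x s01 t01 Xx; split; [exact: vT|exact: gT].
have [vY gY] : xi t (Y t) = flow_val u (t - s) p /\
    Dxi t (Y t) = (dil2 u (t - s) p)^-1 *: p.
  by have [_ vY gY] := trans s t y s01 t01 Xy; split; [exact: vY|exact: gY].
have a_p := aff t y t01.
(* Coefficient of the second-order equation for [B]. *)
pose D := - 4 *: (Dxi t (Y t) *m (Dxi t (Y t))^T + xi t (Y t) *: D2xi t (Y t)).
have dM : is_derive t 1 M (D *m B' t).
  have := is_derive_velocity_diff p H a_p => /is_derive_translate.
  apply: is_derive_ext => //; rewrite -/(M t) -/(B' t) /D vY gY.
  have outer (c : R) (v : 'cV[R]_d) (A : 'M[R]_d) :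
      (c^-1 *: v) *m (c^-1 *: v)^T *m A = c ^- 2 *: (v *m v^T *m A).
    rewrite linearZ /= -scalemxAl -scalemxAr scalerA -scalemxAl.
    by rewrite -invfM -expr2.
  have MN' c : c *: M t = (c *: D2xi t (Y t)) *m B' t by rewrite -scalemxAl -MN.
  by rewrite -[RHS]scalemxAl mulmxDl outer MN' addrC.
have delta0 : delta t != 0 by rewrite /delta BE// -unitfE -unitmxE Bu.
have dd : is_derive t 1 (derive1 delta)
    ((\tr D + Lapl t (Y t) ^+ 2 - \tr (D2xi t (Y t) *m D2xi t (Y t))) * delta t).
  apply: is_derive_derive1 ddelta _ => //.
  rewrite /delta BE//.
  exact: (is_derive2_det (Bu t t01) (dB' t t01) (MN t t01) dM).
split; first split.
- by rewrite gT; exact: dT.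
- rewrite gT vT; apply: (is_derive_derive1 t01 dT).
  exact: (is_derive_velocity_shift _ (aff t x t01)).
split; first split.
- by rewrite vT qE; exact: dq.
- rewrite gT qE; apply: (is_derive_derive1 t01 dq).
  exact: (is_derive_dilation_rate_shift _ (aff t x t01)).
split; first split.
- by rewrite BE// -MN//; exact: dB.
- by rewrite BE//; exact: is_derive_derive1 dB dM.
split => //.
  have := ddelta t t01; rewrite MN// -mulmxA mul_mx_adj mul_mx_scalar linearZ /=.
  by rewrite mulrC /delta BE.
rewrite derive1E; have [_ ->] := dd; rewrite mulfK//.
have -> : \tr (D2xi t (Y t) *m D2xi t (Y t)) =
    \sum_(i < d) \sum_(j < d) D2xi t (Y t) i j ^+ 2.
  apply: eq_bigr => i _; rewrite mxE; apply: eq_bigr => j _.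
  by rewrite -{2}Nsym// mxE expr2.
have -> : \tr D = - 4 * (enorm (Dxi t (Y t)) ^+ 2 + xi t (Y t) * Lapl t (Y t)).
  rewrite /D mxtraceZ mxtraceD mxtraceZ mxtrace_mulC dot_mx mxtrace_scalar.
  by rewrite sqr_enorm.
by ring.
Qed.
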